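(* Let $A$ be a Young function, let $u\in H^{s',A}(\mathbb{R}^n)$ and $0<s<s'<1$. Then $u\in W^{s,A}(\mathbb{R}^n)$ and there exists $C>0$, independent of $u$, such that $$\|u\|_{W^{s,A}(\mathbb{R}^n)}\leq\frac{C}{s'-s}\|u\|_{H^{s',A}(\mathbb{R}^n)}.$$ Moreover, if $u=G_{s'}*f$ with $f\in L^A(\mathbb{R}^n)$, then the following modular inequality holds: $$\int_{\mathbb{R}^n}A(|u|)\,dx+\int_{\mathbb{R}^n}\int_{\mathbb{R}^n}A\left(\frac{|u(x+h)-u(x)|}{|h|^s}\right)\frac{dx\,dh}{|h|^n}\leq\frac{C_1}{s'-s}\int_{\mathbb{R}^n}A(C_2|f|)\,dx+\int_{\mathbb{R}^n}A(\|G_{s'}\|_{L^1(\mathbb{R}^n)}|f|)\,dx,$$ where $C_1=\frac{2n\omega_n}{s}$ and $C_2=2\|G_{s'}\|_{L^1(\mathbb{R}^n)}+\frac{c}{1-s'}$, with $\omega_n$ the volume of the unit ball of $\mathbb{R}^n$ and $c>0$ a constant such that $\int_{\mathbb{R}^n}|G_{s'}(x+h)-G_{s'}(x)|\,dx\le\frac{c}{1-s'}|h|^{s'}$ for all $h\in\mathbb{R}^n$.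
   Context: A Young function is a function $A:[0,\infty)\to[0,\infty)$ that is convex, increasing, with $A(0)=0$, $\lim_{t\to0^+}A(t)/t=0$ and $\lim_{t\to\infty}A(t)/t=\infty$ (extended evenly to $\mathbb{R}$). No $\Delta_2$ condition is assumed on $A$ or its conjugate. The Orlicz space is $L^A(\mathbb{R}^n)=\{u:\mathbb{R}^n\to\mathbb{R}:\Phi_A(u)<\infty\}$, where $\Phi_A(u)=\int_{\mathbb{R}^n}A(|u|)\,dx$. For $s\in(0,1)$, the fractional Orlicz-Sobolev space is $W^{s,A}(\mathbb{R}^n)=\{u:\mathbb{R}^n\to\mathbb{R}:\Phi_A(u)+\Phi_{s,A}(u)<\infty\}$, where $$\Phi_{s,A}(u)=\iint_{\mathbb{R}^n\times\mathbb{R}^n}A\left(\frac{|u(x)-u(y)|}{|x-y|^s}\right)\frac{dx\,dy}{|x-y|^n}.$$ These spaces are endowed with the Luxemburg norms $\|u\|_{L^A(\mathbb{R}^n)}=\inf\{\lambda>0:\Phi_A(u/\lambda)\le1\}$ and $\|u\|_{W^{s,A}(\mathbb{R}^n)}=\|u\|_{L^A(\mathbb{R}^n)}+[u]_{W^{s,A}(\mathbb{R}^n)}$, where $[u]_{W^{s,A}(\mathbb{R}^n)}=\inf\{\lambda>0:\Phi_{s,A}(u/\lambda)\le1\}$. The Bessel kernel is $G_s=\mathcal{F}^{-1}\big((1+|\xi|^2)^{-s/2}\big)$, where $\mathcal{F}$ is the Fourier transform; $G_s\in L^1(\mathbb{R}^n)$ for $s>0$. The Bessel-Orlicz potential space is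 $H^{s,A}(\mathbb{R}^n)=\{u\in L^A(\mathbb{R}^n):u=G_s*f\text{ for some }f\in L^A(\mathbb{R}^n)\}$, with norm $\|u\|_{H^{s,A}(\mathbb{R}^n)}=\|f\|_{L^A(\mathbb{R}^n)}$.
   Formalization: L^A and W^{s,A} are taken as the linear spaces of u for which some multiple u/λ has finite modular, instead of u itself; with the literal definition ''u ∈ W^{s,A}'' fails without Δ_2, e.g. for A(t)=e^{-1/t} near 0. *)

(* Defs.v *)
From HB Require Import structures.
From mathcomp Require Import all_boot all_order all_algebra.
From mathcomp Require Import all_classical all_reals all_analysis.
From mathcomp Require Import complex.

Set Implicit Arguments.
Unset Strict Implicit.
Unset Printing Implicit Defensive.

Import Order.TTheory GRing.Theory Num.Theory.
Import numFieldNormedType.Exports.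

Local Open Scope classical_set_scope.
Local Open Scope ring_scope.

(* R^n is 'rV[R]_n with its Borel sigma-algebra, presented as the
   sigma-algebra generated by the coordinates. *)
Section rV_measurable.
Context {R : realType} (n : nat).

Let coord (i : 'I_n) (x : 'rV[R]_n) : R := x 0 i.

Let rV_set0 : g_sigma_preimage coord set0.
Proof. exact: sigma_algebra0. Qed.

Let rV_setC A : g_sigma_preimage coord A -> g_sigma_preimage coord (~` A).
Proof. exact: sigma_algebraC. Qed.

Let rV_bigcup (F : (set 'rV[R]_n)^nat) :
  (forall i, g_sigma_preimage coord (F i)) ->
  g_sigma_preimage coord (\bigcup_i (F i)).
Proof. exact: sigma_algebra_bigcup. Qed.

HB.instance Definition _ := @isMeasurable.Build
  (measure_tuple_display default_measure_display) 'rV[R]_n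
  (g_sigma_preimage coord) rV_set0 rV_setC rV_bigcup.

End rV_measurable.

Lemma measurable_coord (R : realType) n (i : 'I_n) :
  measurable_fun [set: 'rV[R]_n] (fun x : 'rV[R]_n => x 0 i).
Proof.
move=> _ Y mY; rewrite setTI; apply: sub_sigma_algebra => /=.
rewrite -bigcup_seq/=; exists i => /=; first by rewrite mem_index_enum.
by exists Y => //; rewrite setTI.
Qed.

Lemma measurable_fun_rV (R : realType) d (T : measurableType d) n
    (f : T -> 'rV[R]_n) :
  (forall i, measurable_fun [set: T] (fun t => f t 0 i)) ->
  measurable_fun [set: T] f.
Proof.
move=> mf _ A mA; rewrite setTI.
suff: g_sigma_preimage (fun i t => f t 0 i) `<=` @measurable _ T.
  have -> : (fun i t => f t 0 i) =
    (fun i => (fun x : 'rV[R]_n => x 0 i) \o f) by [].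
  by rewrite g_sigma_preimage_comp; apply; exists A => //; rewrite setTI.
apply: smallest_sub; first exact: sigma_algebra_measurable.
case: n => [|n] in f A mA mf *; first by rewrite big_ord0.
rewrite -bigcup_mkord_ord; apply: bigcup_sub => i Ii.
by move=> B [C mC <-]; exact: mf.
Qed.

Section lebesgue_rV.
Context {R : realType}.
Local Open Scope ereal_scope.

Definition rVcons n (p : measurableTypeR R * 'rV[R]_n) : 'rV[R]_n.+1 :=
  row_mx (\row_(_ < 1) p.1) p.2 : 'rV[R]_(1 + n).

Definition rVhead n (v : 'rV[R]_n.+1) : measurableTypeR R := v 0%R ord0.

Definition rVtail n (v : 'rV[R]_n.+1) : 'rV[R]_n :=
  \row_i v 0%R (lift ord0 i).

Lemma rVhead_cons n (p : measurableTypeR R * 'rV[R]_n) :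
  rVhead (rVcons p) = p.1.
Proof.
rewrite /rVhead /rVcons.
have -> : (ord0 : 'I_n.+1) = lshift n (ord0 : 'I_1) by exact/val_inj.
exact: etrans (row_mxEl _ _ _ _) (mxE _ _ _ _).
Qed.

Lemma rVtail_cons n (p : measurableTypeR R * 'rV[R]_n) :
  rVtail (rVcons p) = p.2.
Proof.
apply/rowP => i; rewrite mxE /rVcons.
have -> : lift ord0 i = rshift 1 i :> 'I_n.+1 by exact/val_inj.
exact: row_mxEr.
Qed.

Lemma measurable_rVcons n : measurable_fun setT (@rVcons n).
Proof.
apply: measurable_fun_rV => i; case: (unliftP ord0 i) => [j|] ->.
  rewrite [X in measurable_fun _ X](_ : _ = (fun v : 'rV[R]_n => v 0%R j) \o snd).
    exact: (measurableT_comp (@measurable_coord R n j) measurable_snd).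
  by apply/funext => p /=; rewrite -(rVtail_cons p) [RHS]mxE.
rewrite [X in measurable_fun _ X](_ : _ = fst); first exact: measurable_fst.
by apply/funext => p; exact: rVhead_cons.
Qed.

Lemma measurable_rVtail n : measurable_fun setT (@rVtail n).
Proof.
apply: measurable_fun_rV => i; under eq_fun do rewrite mxE.
exact: measurable_coord.
Qed.

Section cons_measure.
Variables (n : nat) (mu : {sigma_finite_measure set 'rV[R]_n -> \bar R}).

Definition cons_measure : set 'rV[R]_n.+1 -> \bar R :=
  pushforward (lebesgue_measure \x mu) (@rVcons n).

Let cons_measure0 : cons_measure set0 = 0.
Proof. by rewrite /cons_measure /pushforward preimage_set0 measure0. Qed.

Let cons_measure_ge0 A : 0 <= cons_measure A.
Proof. by rewrite /cons_measure /pushforward measure_ge0. Qed.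

Let cons_measure_semi_sigma_additive : semi_sigma_additive cons_measure.
Proof.
move=> F mF tF mUF; rewrite /cons_measure /pushforward preimage_bigcup.
apply: measure_semi_sigma_additive.
- by move=> k; rewrite -[X in measurable X]setTI; exact: measurable_rVcons.
- apply/trivIsetP => /= i j _ _ ij; rewrite -preimage_setI.
  by move/trivIsetP : tF => /(_ _ _ _ _ ij) ->//; rewrite preimage_set0.
- rewrite -preimage_bigcup -[X in measurable X]setTI.
  exact: measurable_rVcons.
Qed.

HB.instance Definition _ := isMeasure.Build _ _ _ cons_measure
  cons_measure0 cons_measure_ge0 cons_measure_semi_sigma_additive.

Let cons_measure_sigma_finite : sigma_finite setT cons_measure.
Proof.
have /sigma_finiteP[F [UF ndF mF]] := sigma_finiteT (@lebesgue_measure R).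
have /sigma_finiteP[G [UG ndG mG]] := sigma_finiteT mu.
have mhd : measurable_fun setT (@rVhead n) by exact: measurable_coord.
exists (fun k => @rVhead n @^-1` F k `&` @rVtail n @^-1` G k).
  rewrite predeqE => v; split=> // _.
  have [k _ Fk] : (\bigcup_i F i) (rVhead v) by rewrite -UF.
  have [l _ Gl] : (\bigcup_i G i) (rVtail v) by rewrite -UG.
  exists (maxn k l) => //; split.
  - by have /subsetPset := ndF _ _ (leq_maxl k l); apply.
  - by have /subsetPset := ndG _ _ (leq_maxr k l); apply.
move=> k; have [mFk Fk] := mF k; have [mGk Gk] := mG k; split.
  apply: measurableI; rewrite -[X in measurable X]setTI.
    exact: mhd.
  exact: measurable_rVtail.
rewrite /cons_measure /pushforward.
rewrite (_ : _ @^-1` _ = F k `*` G k).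
  by rewrite product_measure1E// lte_mul_pinfty// ge0_fin_numE.
apply/funext => p; rewrite /setI /preimage/= /setX/=.
by rewrite rVhead_cons rVtail_cons.
Qed.

HB.instance Definition _ := Measure_isSigmaFinite.Build _ _ _
  cons_measure cons_measure_sigma_finite.

End cons_measure.

Fixpoint lebesgue_rV n : {sigma_finite_measure set 'rV[R]_n -> \bar R} :=
  match n with
  | 0 => \d_(0%R : 'rV[R]_0)
  | m.+1 => cons_measure (lebesgue_rV m)
  end.

End lebesgue_rV.

Lemma lebesgue_rV_box (R : realType) n (B : 'I_n -> set R) :
  (forall i, measurable (B i)) ->
  lebesgue_rV n [set x : 'rV[R]_n | forall i, B i (x 0 i)] =
  (\prod_(i < n) lebesgue_measure (B i))%E.
Proof.
elim: n B => [|n IH] B mB.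
  rewrite big_ord0 /= diracE mem_set//=; by case.
have mBS : measurable [set x : 'rV[R]_n | forall i, B (lift ord0 i) (x 0 i)].
  rewrite (_ : mkset _ =
      \bigcap_(i in [set: 'I_n]) (fun x : 'rV[R]_n => x 0 i) @^-1`
        B (lift ord0 i)).
    apply: fin_bigcap_measurable; first exact: finite_finset.
    by move=> i _; rewrite -[X in measurable X]setTI; exact: measurable_coord.
  by apply/seteqP; split=> x /= Hx i => [_|]; exact: Hx.
have -> : lebesgue_rV n.+1 [set x : 'rV[R]_n.+1 | forall i, B i (x 0 i)] =
    (lebesgue_measure \x lebesgue_rV n)%E
      (B ord0 `*` [set x : 'rV[R]_n | forall i, B (lift ord0 i) (x 0 i)]).
  rewrite /= /cons_measure /pushforward; congr (_ _).
  apply/seteqP; split=> p /= => [Bp|[B0 BS] i].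
    split; first by rewrite -rVhead_cons; exact: Bp.
    by move=> i; rewrite -(rVtail_cons p) mxE; exact: Bp.
  case: (unliftP ord0 i) => [j|] ->.
    by have := BS j; rewrite -(rVtail_cons p) mxE.
  by have := B0; rewrite -rVhead_cons.
rewrite product_measure1E//; last exact: (mB ord0).
by rewrite big_ord_recl -IH// => i; exact: mB.
Qed.

(* The canonical norm of 'rV[R]_n is the sup norm; the Euclidean one is
   needed here. *)
Definition dot (R : realType) n (x y : 'rV[R]_n) : R :=
  \sum_(i < n) x 0 i * y 0 i.

Definition enorm (R : realType) n (x : 'rV[R]_n) : R := Num.sqrt (dot x x).

(* Only the restriction of A to [0, +oo[ matters: A is always applied to
   nonnegative reals below. *)
Record young_function (R : realType) (A : R -> R) : Prop := YoungFunction {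
  young_ge0 : forall t, 0 <= t -> 0 <= A t ;
  young_convex : @convex_function R R^o [set t | 0 <= t] A ;
  young_increasing : {in `[0, +oo[ &, {homo A : x y / x <= y}} ;
  young_at0 : A 0 = 0 ;
  young_slope_at0 : (A t / t) @[t --> 0^'+] --> 0 ;
  young_slope_pinfty : (A t / t) @[t --> +oo] --> +oo }.

Section spaces.
Context {R : realType} {n : nat}.
Local Notation mu := (@lebesgue_rV R n).
Local Notation fct := ('rV[R]_n -> R).
Implicit Types (A : R -> R) (u f G : fct) (s : R).

Definition modular A u : \bar R := (\int[mu]_x (A `|u x|)%:E)%E.

(* On the diagonal, a null set when 0 < n, the integrand is 0 by the
   convention 0^-1 = 0. *)
Definition frac_modular s A u : \bar R :=
  (\int[mu \x mu]_z (A (`|u z.1 - u z.2| / enorm (z.1 - z.2) `^ s)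
                     / enorm (z.1 - z.2) ^+ n)%:E)%E.

Definition luxemburg (Phi : fct -> \bar R) u : \bar R :=
  ereal_inf [set l%:E | l in
    [set l : R | 0 < l /\ (Phi (fun x => (u x / l)%R) <= 1)%E]].

(* Without a Delta_2 condition the functions of finite modular do not form a
   vector space; as usual, the space normed by the Luxemburg norm consists of
   the functions having a multiple of finite modular. *)
Definition in_orlicz A u : Prop :=
  measurable_fun [set: 'rV[R]_n] u /\
  exists2 l : R, 0 < l & (modular A (fun x => (u x / l)%R) < +oo)%E.

Definition in_frac_sobolev s A u : Prop :=
  measurable_fun [set: 'rV[R]_n] u /\
  exists2 l : R, 0 < l &
    (modular A (fun x => (u x / l)%R) +
     frac_modular s A (fun x => (u x / l)%R) < +oo)%E.

Definition orlicz_norm A u : \bar R := luxemburg (modular A) u.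

Definition frac_seminorm s A u : \bar R := luxemburg (frac_modular s A) u.

Definition frac_sobolev_norm s A u : \bar R :=
  (orlicz_norm A u + frac_seminorm s A u)%E.

(* F f (xi) = int f(x) e^(-i x.xi) dx, the normalization under which
   F (f * g) = F f . F g and G_s is the kernel of (1 - Delta)^(-s/2). *)
Definition fourier f (xi : 'rV[R]_n) : R[i] :=
  Complex (\int[mu]_x (f x * cos (dot x xi)))%R
          (- \int[mu]_x (f x * sin (dot x xi)))%R.

(* The symbol need not be integrable, so its inverse Fourier transform is
   taken in the sense of tempered distributions; as it is known to be an
   integrable function G, being that inverse transform amounts to having the
   symbol as Fourier transform, which determines G almost everywhere. *)
Definition is_bessel_kernel s G : Prop :=
  mu.-integrable [set: 'rV[R]_n] (EFin \o G) /\
  forall xi, fourier G xi = ((1 + enorm xi ^+ 2) `^ (- (s / 2)))%:C%C.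

Definition bessel_kernel s : fct :=
  get [set G | is_bessel_kernel s G].

(* u = G * f almost everywhere; as an equality of extended reals, it says in
   particular that the integral has a finite value. *)
Definition is_convolution G f u : Prop :=
  {ae mu, forall x, (u x)%:E = (\int[mu]_y (G (x - y) * f y)%:E)%E}.

Definition in_bessel_orlicz s A u : Prop :=
  in_orlicz A u /\
  exists2 f, in_orlicz A f & is_convolution (bessel_kernel s) f u.

(* The potential f of u is unique up to a null set, so this is the infimum of
   a single number. *)
Definition bessel_orlicz_norm s A u : \bar R :=
  ereal_inf [set orlicz_norm A f | f in
    [set f | in_orlicz A f /\ is_convolution (bessel_kernel s) f u]].

Definition L1norm f : R := \int[mu]_x `|f x|.

End spaces.

Definition unit_ball_volume (R : realType) n : R :=
  fine (lebesgue_rV n [set x : 'rV[R]_n | enorm x < 1]).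

(* Main.v *)
Require Import Defs.
From HB Require Import structures.
From mathcomp Require Import all_boot all_order all_algebra.
From mathcomp Require Import all_classical all_reals all_analysis.
From mathcomp Require Import measurable_realfun lebesgue_integral_nonneg.
From mathcomp Require Import ring lra.

Set Implicit Arguments.
Unset Strict Implicit.
Unset Printing Implicit Defensive.

Import Order.TTheory GRing.Theory Num.Theory.
Import numFieldNormedType.Exports.

Local Open Scope classical_set_scope.
Local Open Scope ring_scope.

(** Everything rests on an estimate of continuity in mean for the kernel,
      int |G (x + h) - G x| dx <= K |h|^s'   for all h,   (H)
    where G is the Bessel kernel of order s'.

    Given (H), the increment u (x + h) - u x is the convolution of f with
    G (. + h) - G, a kernel of mass at most K |h|^s' and also at most 2 |G|_1.
    Jensen's inequality and Tonelli's theorem bound the modular of a convolution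
    w * f by the ratio m / M times the modular of M f, where m is the mass of w
    and M any number above it ([modular_conv_le]); take M = 2 |G|_1 + K.  Since A
    is convex with A 0 = 0, factors at most 1 come out of A.  For |h| < 1 the
    difference quotient of order s is |h|^(s' - s) times the one of order s'; for
    |h| >= 1 the factor |h|^(- s) comes out.  It remains to integrate
    |h|^(s' - s - n) over the unit ball and |h|^(- s - n) outside of it; shells of
    doubling volume bound these integrals by 2 n omega / (s' - s) and
    2 n omega / s ([ge0_integral_enorm_powR_in], [ge0_integral_enorm_powR_out]).
    This is the modular inequality ([modular_le], [frac_modular_le]).  The
    inequality between norms follows by applying it to f divided by a constant so
    large that, by convexity again, the right-hand side is at most the modular of
    f ([total_modular_le]).

    To prove (H), recall that the kernel is known through its Fourier transform
    (1 + |xi|^2)^(-s'/2).  This is an average of the transforms exp (- t |xi|^2) of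
    the heat kernels, under the gamma law t^(s'/2 - 1) exp (- t) dt, so the same
    average of the heat kernels themselves has the right transform
    ([is_bessel_kernel_model]).  The heat kernel at time t satisfies
    int |p_t (x + h) - p_t x| dx <= C min (1, |h| / sqrt t) ([heat_translate_le]), and
    the average of this bound is O (|h|^s') by scaling in t; this is where
    0 < s' < 1 is needed, for convergence at 0 and at infinity.  Finally the
    Bessel kernel and this average are equal almost everywhere, because an
    integrable function whose transform vanishes is 0 almost everywhere
    ([fourier_eq0]): its integrals against Gaussians vanish, hence those against
    mollified indicators of orthants, hence those over orthants, which generate
    the Borel sets. *)

(** * Lebesgue measure under affine maps *)

Section affine_change_of_variables.
Context {R : realType}.
Local Open Scope ereal_scope.

Lemma measurable_affine (a b : R) :
  measurable_fun setT (fun t : R => a * t + b)%R.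
Proof. by apply: measurable_funD => //; exact: measurable_funM. Qed.

Lemma lebesgue_measure_affine (a b : R) : a != 0%R ->
  forall A : set R, measurable A ->
  lebesgue_measure A =
  `|a|%:E * lebesgue_measure ((fun t : R => a * t + b)%R @^-1` A).
Proof.
move=> a0 A mA.
pose phi := (fun t => a * t + b)%R : measurableTypeR R -> measurableTypeR R.
have mphi : measurable_fun setT phi by exact: measurable_affine.
have @nu : {measure set (measurableTypeR R) -> \bar R}.
  by refine (mscale (NngNum (normr_ge0 a)) (pushforward lebesgue_measure phi)); exact: mphi.
have -> : `|a|%:E * lebesgue_measure (phi @^-1` A) = nu A by [].
apply: lebesgue_measure_unique => // _ [[x y]] _ <-.
have -> : nu `]x, y]%classic =
  `|a|%:E * lebesgue_measure (phi @^-1` `]x, y]%classic) by [].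
case: (ltgtP a 0%R) a0 => // a0 _.
- have -> : phi @^-1` `]x, y] = `[((y - b) / a)%R, ((x - b) / a)%R[%classic.
    apply/seteqP; split => t /=; rewrite !in_itv/=.
      by rewrite ler_ndivrMr// ltr_ndivlMr// lerBrDr ltrBlDr ![(t * a)%R]mulrC andbC.
    by rewrite ler_ndivrMr// ltr_ndivlMr// lerBrDr ltrBlDr ![(t * a)%R]mulrC andbC.
  rewrite !lebesgue_measure_itv/= !lte_fin ltr_nM2r ?invr_lt0// ltrD2r.
  case: ifP => // _; last by rewrite mule0.
  rewrite -EFinM ltr0_norm//; congr EFin; field; exact: ltr0_neq0.
- have -> : phi @^-1` `]x, y] = `]((x - b) / a)%R, ((y - b) / a)%R]%classic.
    apply/seteqP; split => t /=; rewrite !in_itv/=.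
      by rewrite ler_pdivlMr// ltr_pdivrMr// lerBrDr ltrBlDr ![(t * a)%R]mulrC.
    by rewrite ler_pdivlMr// ltr_pdivrMr// lerBrDr ltrBlDr ![(t * a)%R]mulrC.
  rewrite !lebesgue_measure_itv/= !lte_fin ltr_pM2r ?invr_gt0// ltrD2r.
  case: ifP => // _; last by rewrite mule0.
  rewrite -EFinM gtr0_norm//; congr EFin; field; exact: lt0r_neq0.
Qed.

Lemma ge0_integral_affine (a b : R) (f : R -> \bar R) : a != 0%R ->
  measurable_fun setT f -> (forall t, 0 <= f t) ->
  \int[lebesgue_measure]_t f t =
  `|a|%:E * \int[lebesgue_measure]_t f (a * t + b)%R.
Proof.
move=> a0 mf f0.
pose phi := (fun t => a * t + b)%R : measurableTypeR R -> measurableTypeR R.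
have mphi : measurable_fun setT phi by exact: measurable_affine.
have @nu : {measure set (measurableTypeR R) -> \bar R}.
  by refine (mscale (NngNum (normr_ge0 a)) (pushforward lebesgue_measure phi)); exact: mphi.
rewrite (eq_measure_integral nu); last first.
  by move=> A mA _; exact: lebesgue_measure_affine.
rewrite ge0_integral_mscale//= ge0_integral_pushforward//=.
Qed.

End affine_change_of_variables.

Section lebesgue_rV_integration.
Context {R : realType}.
Local Open Scope ereal_scope.
Local Notation mu n := (@lebesgue_rV R n).

Lemma rV0_eq0 (x : 'rV[R]_0) : x = 0%R.
Proof. by apply/rowP => -[]. Qed.

Lemma rVcons_head n (p : measurableTypeR R * 'rV[R]_n) :
  rVcons p 0%R ord0 = p.1.
Proof. exact: rVhead_cons. Qed.

Lemma rVcons_lift n (p : measurableTypeR R * 'rV[R]_n) i :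
  rVcons p 0%R (lift ord0 i) = p.2 0%R i.
Proof. by rewrite -(rVtail_cons p) [RHS]mxE. Qed.

Lemma ge0_integral_rV0 (f : 'rV[R]_0 -> \bar R) : measurable_fun setT f ->
  \int[mu 0]_x f x = f 0%R.
Proof. by move=> mf; rewrite integral_dirac// diracT mul1e. Qed.

Lemma ge0_integral_rVS n (f : 'rV[R]_n.+1 -> \bar R) :
  measurable_fun setT f -> (forall x, 0 <= f x) ->
  \int[mu n.+1]_x f x =
  \int[lebesgue_measure]_t \int[mu n]_y f (rVcons (t, y)).
Proof.
move=> mf f0; rewrite (ge0_integral_pushforward (@measurable_rVcons R n))//=.
rewrite fubini_tonelli1//=.
by apply: measurableT_comp => //; exact: measurable_rVcons.
Qed.

Lemma measurable_rV_add d (T : measurableType d) n (f g : T -> 'rV[R]_n) :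
  measurable_fun setT f -> measurable_fun setT g ->
  measurable_fun setT (fun t => f t + g t)%R.
Proof.
move=> mf mg; apply: measurable_fun_rV => i; under eq_fun do rewrite mxE.
by apply: measurable_funD; apply: measurableT_comp (measurable_coord i) _.
Qed.

Lemma measurable_rV_scale d (T : measurableType d) n (a : T -> R)
    (f : T -> 'rV[R]_n) :
  measurable_fun setT a -> measurable_fun setT f ->
  measurable_fun setT (fun t => a t *: f t)%R.
Proof.
move=> ma mf; apply: measurable_fun_rV => i; under eq_fun do rewrite mxE.
by apply: measurable_funM => //; apply: measurableT_comp (measurable_coord i) _.
Qed.

Lemma measurable_rV_sub d (T : measurableType d) n (f g : T -> 'rV[R]_n) :
  measurable_fun setT f -> measurable_fun setT g ->
  measurable_fun setT (fun t => f t - g t)%R.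
Proof.
move=> mf mg; apply: measurable_rV_add => //.
under eq_fun do rewrite -scaleN1r.
exact: measurable_rV_scale.
Qed.


Lemma measurable_rVcons_pair n (t : R) (f : 'rV[R]_n.+1 -> \bar R) :
  measurable_fun setT f -> measurable_fun setT (fun y => f (rVcons (t, y))).
Proof.
move=> mf; apply: measurableT_comp => //; apply: measurableT_comp (@measurable_rVcons R n) _.
exact: pair1_measurable.
Qed.

Lemma measurable_integral_rVcons n (f : 'rV[R]_n.+1 -> \bar R) :
  measurable_fun setT f -> (forall x, 0 <= f x) ->
  measurable_fun [set: R] (fun t : R => \int[mu n]_y f (rVcons (t, y))).
Proof.
move=> mf f0.
apply: (measurable_fun_fubini_tonelli_F (f \o @rVcons R n)) => [|x].
  by apply: measurableT_comp => //; exact: measurable_rVcons.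
exact: f0.
Qed.

(** Translations, reflections and dilations are all needed below, so they are
    treated together; the induction peels off one coordinate at a time and
    uses the one-dimensional case for it. *)
Lemma ge0_integral_rV_affine n (a : R) (b : 'rV[R]_n) (f : 'rV[R]_n -> \bar R) :
  a != 0%R -> measurable_fun setT f -> (forall x, 0 <= f x) ->
  \int[mu n]_x f x = (`|a| ^+ n)%:E * \int[mu n]_x f (a *: x + b)%R.
Proof.
move=> a0; have mab m c : measurable_fun setT (fun x : 'rV[R]_m => a *: x + c)%R.
  by apply: measurable_rV_add => //; exact: measurable_rV_scale.
elim: n b f => [|n IH] b f mf f0.
  rewrite expr0 mul1e !ge0_integral_rV0//; last exact: measurableT_comp (mab _ _).
  by congr f; rewrite [RHS]rV0_eq0.
rewrite !ge0_integral_rVS//; last exact: measurableT_comp (mab _ _).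
rewrite [LHS](ge0_integral_affine (rVhead b) a0 (measurable_integral_rVcons mf f0)); last first.
  by move=> t; exact: integral_ge0.
rewrite exprS EFinM -muleA; congr *%E.
rewrite -ge0_integralZl//; last 2 first.
- apply: (measurable_integral_rVcons (f := fun x => f (a *: x + b)%R)) => //.
  exact: measurableT_comp (mab _ _).
- by move=> t _; exact: integral_ge0.
apply: eq_integral => t _.
rewrite (IH (rVtail b)) //; last exact: measurable_rVcons_pair.
congr *%E; apply: eq_integral => y _; congr f.
apply/rowP => i; case: (unliftP ord0 i) => [j|] ->.
  by rewrite [LHS]rVcons_lift/= [RHS]mxE [X in _ = (X + _)%R]mxE rVcons_lift/= 3!mxE.
by rewrite [LHS]rVcons_head [RHS]mxE [X in _ = (X + _)%R]mxE rVcons_head.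
Qed.

Lemma ge0_integral_rV_translate n (b : 'rV[R]_n) (f : 'rV[R]_n -> \bar R) :
  measurable_fun setT f -> (forall x, 0 <= f x) ->
  \int[mu n]_x f (x + b)%R = \int[mu n]_x f x.
Proof.
move=> mf f0; rewrite [RHS](@ge0_integral_rV_affine _ 1%R b) ?oner_neq0//.
rewrite normr1 expr1n mul1e.
by under [RHS]eq_integral do rewrite scale1r.
Qed.

Lemma ge0_integral_rV_reflect n (b : 'rV[R]_n) (f : 'rV[R]_n -> \bar R) :
  measurable_fun setT f -> (forall x, 0 <= f x) ->
  \int[mu n]_x f (b - x)%R = \int[mu n]_x f x.
Proof.
move=> mf f0; rewrite [RHS](@ge0_integral_rV_affine _ (-1)%R b) ?oppr_eq0 ?oner_neq0//.
rewrite normrN1 expr1n mul1e.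
by under [RHS]eq_integral do rewrite scaleN1r addrC.
Qed.

End lebesgue_rV_integration.

(** * The Euclidean norm and the volume of balls *)

Section euclidean_norm.
Context {R : realType}.
Implicit Types n : nat.

Lemma measurable_dot d (T : measurableType d) n (f g : T -> 'rV[R]_n) :
  measurable_fun setT f -> measurable_fun setT g ->
  measurable_fun setT (fun t => dot (f t) (g t)).
Proof.
move=> mf mg; apply: measurable_sum => i.
by apply: measurable_funM; apply: measurableT_comp (measurable_coord i) _.
Qed.

Lemma measurable_enorm d (T : measurableType d) n (f : T -> 'rV[R]_n) :
  measurable_fun setT f -> measurable_fun setT (fun t => enorm (f t)).
Proof.
move=> mf; apply: (measurableT_comp (f := @Num.sqrt R)); last exact: measurable_dot.
by apply: continuous_measurable_fun; exact: sqrt_continuous.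
Qed.

Lemma dot_ge0 n (x : 'rV[R]_n) : 0 <= dot x x.
Proof. by apply: sumr_ge0 => i _; rewrite -expr2 sqr_ge0. Qed.

Lemma enorm_ge0 n (x : 'rV[R]_n) : 0 <= enorm x.
Proof. exact: sqrtr_ge0. Qed.

Lemma sqr_enorm n (x : 'rV[R]_n) : enorm x ^+ 2 = dot x x.
Proof. by rewrite sqr_sqrtr// dot_ge0. Qed.

Lemma dotC n (x y : 'rV[R]_n) : dot x y = dot y x.
Proof. by apply: eq_bigr => i _; rewrite mulrC. Qed.

Lemma dotDl n (x y z : 'rV[R]_n) : dot (x + y) z = dot x z + dot y z.
Proof. by rewrite -big_split; apply: eq_bigr => i _; rewrite mxE mulrDl. Qed.

Lemma dotZl n a (x z : 'rV[R]_n) : dot (a *: x) z = a * dot x z.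
Proof. by rewrite mulr_sumr; apply: eq_bigr => i _; rewrite mxE mulrA. Qed.

Lemma dotDr n (x y z : 'rV[R]_n) : dot z (x + y) = dot z x + dot z y.
Proof. by rewrite dotC dotDl !(dotC z). Qed.

Lemma dotZr n a (x z : 'rV[R]_n) : dot z (a *: x) = a * dot z x.
Proof. by rewrite dotC dotZl (dotC z). Qed.

Lemma enormZ n a (x : 'rV[R]_n) : enorm (a *: x) = `|a| * enorm x.
Proof.
by rewrite /enorm dotZl dotZr mulrA -expr2 sqrtrM ?sqr_ge0// sqrtr_sqr.
Qed.

Lemma enormN n (x : 'rV[R]_n) : enorm (- x) = enorm x.
Proof. by rewrite -scaleN1r enormZ normrN1 mul1r. Qed.

Lemma enorm0 n : enorm (0 : 'rV[R]_n) = 0.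
Proof. by rewrite -(scale0r 0) enormZ normr0 mul0r. Qed.

Lemma coord_le_enorm n (x : 'rV[R]_n) i : `|x 0 i| <= enorm x.
Proof.
rewrite -sqrtr_sqr ler_wsqrtr// /dot (bigD1 i)//= expr2 lerDl.
by apply: sumr_ge0 => j _; rewrite -expr2 sqr_ge0.
Qed.

Lemma enorm_eq0 n (x : 'rV[R]_n) : (enorm x == 0) = (x == 0).
Proof.
apply/eqP/eqP => [x0|->]; last exact: enorm0.
apply/rowP => i; rewrite mxE; apply/eqP; rewrite -normr_le0.
by have := coord_le_enorm x i; rewrite x0.
Qed.

Lemma enorm_gt0 n (x : 'rV[R]_n) : (0 < enorm x) = (x != 0).
Proof. by rewrite lt_neqAle enorm_ge0 andbT eq_sym enorm_eq0. Qed.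

End euclidean_norm.

Section radial_integrals.
Context {R : realType} (n : nat).
Local Notation mu := (@lebesgue_rV R n).
Local Notation omega := (unit_ball_volume R n).
Local Notation ball r := [set x : 'rV[R]_n | enorm x < r].

Lemma measurable_enorm_ball r : measurable (ball r).
Proof.
have := measurable_enorm (@measurable_id _ 'rV[R]_n setT).
move=> /(_ measurableT `]-oo, r[%classic) => /(_ (measurable_itv _)).
rewrite setTI; congr measurable; apply/seteqP; split => x /=;
  by rewrite in_itv.
Qed.

(** [unit_ball_volume] is the real part of an extended real; it is a genuine
    volume because the unit ball lies in a cube. *)
Lemma unit_ball_volumeE : mu (ball 1) = omega%:E.
Proof.
rewrite fineK// ge0_fin_numE//.
pose box := [set x : 'rV[R]_n | forall i : 'I_n, `[-1, 1]%classic (x 0 i)].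
have box_vol := lebesgue_rV_box (B := fun i : 'I_n => `[-1, 1]%classic : set R).
apply: (@le_lt_trans _ _ (mu box)).
  rewrite le_measure ?inE//; first exact: measurable_enorm_ball.
    rewrite (_ : box = \bigcap_(i in [set: 'I_n])
      (fun x : 'rV[R]_n => x 0 i) @^-1` `[-1, 1]%classic).
      apply: fin_bigcap_measurable => [|i _]; first exact: finite_finset.
      rewrite -[X in measurable X]setTI; apply: measurable_coord => //.
    by apply/seteqP; split=> x /= Hx i => [_|]; exact: Hx.
  move=> x /= x1 i; rewrite /= in_itv/= -ler_norml.
  exact: le_trans (coord_le_enorm _ _) (ltW x1).
rewrite box_vol//.
rewrite (_ : (\prod_(i < n) _)%E = (\prod_(i < n) 2 : R)%:E) ?ltry//.
rewrite -prodEFin; apply: eq_bigr => i _.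
rewrite lebesgue_measure_itv/= lte_fin ifT; last by rewrite ltrN10 || lra.
by congr EFin; lra.
Qed.

Lemma unit_ball_volume_ge0 : 0 <= omega.
Proof. exact: fine_ge0. Qed.

Lemma ball_volume r : 0 < r -> mu (ball r) = (r ^+ n * omega)%:E.
Proof.
move=> r0; have r_neq0 := lt0r_neq0 r0.
have mball := measurable_enorm_ball.
have muE A : measurable A -> mu A = (\int[mu]_x (\1_A x)%:E)%E.
  by move=> mA; rewrite integral_indic// setIT.
rewrite [LHS]muE// (ge0_integral_rV_affine 0 r_neq0)//; last first.
  by apply/measurable_EFinP; exact: measurable_indic.
rewrite gtr0_norm// EFinM -unit_ball_volumeE; congr *%E.
rewrite [RHS]muE//.
apply: eq_integral => x _; rewrite !indicE; congr ((nat_of_bool _)%:R%:E).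
rewrite addr0; apply/idP/idP; rewrite !inE/= enormZ gtr0_norm//.
  by rewrite -ltr_pdivlMl// mulVf.
by move=> x1; rewrite -ltr_pdivlMl// mulVf.
Qed.

Lemma shell_volume a b : 0 < a -> a <= b ->
  mu (ball b `\` ball a) = ((b ^+ n - a ^+ n) * omega)%:E.
Proof.
move=> a0 ab; have mball := measurable_enorm_ball.
transitivity (mu (ball b) - mu (ball b `&` ball a))%E.
  apply: measureD => //.
  by have := ltry (b ^+ n * omega); rewrite -(ball_volume (lt_le_trans a0 ab)).
rewrite (_ : ball b `&` ball a = ball a); last first.
  by apply/seteqP; split => [x []//|x xa]; split => //=; exact: lt_le_trans ab.
by rewrite !ball_volume// ?(lt_le_trans a0)// -EFinB mulrBl.
Qed.

End radial_integrals.

(** * Powers of the norm near the origin and at infinity *)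

Section geometric_shells.
Local Open Scope ereal_scope.

(** A function that is at most [a k] on the [k]-th of countably many sets that
    cover its support is dominated by the series of the [a k] times the
    indicators, whence a bound on its integral by a geometric series. *)
Lemma ge0_integral_geometric_cover d (T : measurableType d) (R : realType)
    (mu : {measure set T -> \bar R}) (phi : T -> R) (S : (set T)^nat)
    (a : R^nat) (w z : R) :
  measurable_fun setT phi -> (forall k, measurable (S k)) ->
  (forall x, phi x = 0%R \/ exists k, S k x) ->
  (forall k x, S k x -> (phi x <= a k)%R) -> (forall k, 0 <= a k)%R ->
  (forall x, 0 <= phi x)%R ->
  (0 <= z < 1)%R -> (forall k, (a k)%:E * mu (S k) <= (w * z ^+ k)%:E) ->
  \int[mu]_x (phi x)%:E <= (w / (1 - z))%:E.
Proof.
move=> mphi mS covS phia a0 phi0 /andP[z0 z1] muS.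
pose u k x := (a k)%:E * (\1_(S k) x)%:E.
have u0 k x : 0 <= u k x by rewrite mule_ge0// lee_fin.
have meas_u k : measurable_fun setT (u k).
  by rewrite /u; apply: measurable_funeM; apply/measurable_EFinP; exact: measurable_indic.
apply: (@le_trans _ _ (\int[mu]_x (\sum_(k <oo) u k x))).
  apply: ge0_le_integral => //.
  - by move=> x _; rewrite lee_fin.
  - exact/measurable_EFinP.
  - by apply: ge0_emeasurable_sum => // k x _ _; exact: u0.
  - move=> x _; have [->|[k Skx]] := covS x; first exact: nneseries_ge0.
    apply: (@le_trans _ _ (u k x)).
      by rewrite /u indicE mem_set// mule1 lee_fin phia.
    apply: le_trans (nneseries_lim_ge k.+1 _) => //.
    by rewrite big_mkord (bigD1 ord_max)//= leeDl// sume_ge0.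
rewrite integral_nneseries//.
apply: (@le_trans _ _ (\sum_(k <oo) (w * z ^+ k)%:E)).
  apply: lee_nneseries => [k _ _|k _]; first exact: integral_ge0.
  rewrite /u ge0_integralZl ?lee_fin//; last first.
    by apply/measurable_EFinP; exact: measurable_indic.
  by rewrite integral_indic// setIT.
rewrite (_ : (fun N => _) = EFin \o series (geometric w z)); last first.
  by apply/funext => N; rewrite /= sumEFin.
have zlt : (`|z| < 1)%R by rewrite ger0_norm.
rewrite EFin_lim; last exact: is_cvg_geometric_series.
by rewrite (cvg_lim _ (@cvg_geometric_series _ w _ zlt)).
Qed.

End geometric_shells.

Lemma powR_expr (R : realType) (x a : R) k : 0 <= x ->
  (x ^+ k) `^ a = (x `^ a) ^+ k.
Proof.
by move=> x0; rewrite -(powR_mulrn _ x0) -powRrM mulrC powRrM powR_mulrn ?powR_ge0.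
Qed.

Lemma measurable_ge0_inv d (T : measurableType d) (R : realType) (f : T -> R) :
  measurable_fun setT f -> (forall x, 0 <= f x) ->
  measurable_fun setT (fun x => (f x)^-1).
Proof.
move=> mf f0; rewrite (_ : (fun _ => _) = (@powR R ^~ (-1)) \o f).
  by apply: measurableT_comp => //; exact: measurable_powR.
by apply/funext => x /=; rewrite powR_inv1.
Qed.

Section power_integrals.
Context {R : realType} (n : nat).
Hypothesis n_gt0 : (0 < n)%N.
Local Notation mu := (@lebesgue_rV R n).
Local Notation omega := (unit_ball_volume R n).

Local Notation ball r := [set x : 'rV[R]_n | enorm x < r].

Let ex_root : exists q : R, 0 < q /\ q ^+ n = 2.
Proof.
exists (2 `^ n%:R^-1); split; first exact: powR_gt0.
rewrite -powR_expr// -powR_mulrn// -powRrM mulfV ?powRr1//.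
by rewrite pnatr_eq0 -lt0n.
Qed.

Section root_of_two.
Variable q : R.
Hypotheses (q_gt0 : 0 < q) (qX : q ^+ n = 2).

Let q_ge0 : 0 <= q. Proof. exact: ltW. Qed.

Let q_gt1 : 1 < q.
Proof. by rewrite -(@expr_gt1 _ n)// qX ltr1n. Qed.

Let qk_gt0 k : 0 < q ^+ k. Proof. exact: exprn_gt0. Qed.

(** Chord inequality for the convex function exp between [- ln 2] and 0, at
    the point [- (x / n) ln 2]; here [q `^ (- x)] is [2 `^ (- (x / n))]. *)
Let one_sub_powR_ge (x : R) : 0 < x <= n%:R -> x / (2 * n%:R) <= 1 - q `^ (- x).
Proof.
move=> /andP[x0 xn]; have n0 : 0 < n%:R :> R by rewrite ltr0n.
have y0 : 0 <= x / n%:R by rewrite divr_ge0 ?(ltW x0).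
have y1 : x / n%:R <= 1 by rewrite ler_pdivrMr// mul1r.
have -> : x / (2 * n%:R) = x / n%:R / 2 by field; rewrite lt0r_neq0.
have -> : q `^ (- x) = 2 `^ (- (x / n%:R)).
  rewrite -qX -(powR_mulrn n q_ge0) -powRrM; congr powR.
  by field; rewrite lt0r_neq0.
set y := x / n%:R in y0 y1 *.
have := convex_expR (Itv01 y0 y1) (- ln 2 : R) 0.
rewrite !convRE/= expR0 mulr0 addr0 expRN lnK ?posrE// mulr1.
rewrite /powR ifF ?pnatr_eq0// mulNr mulrN; move: y0 y1.
rewrite /mathcomp.classical.unstable.onem.
lra.
Qed.

Let exists_qk (r : R) : 1 <= r -> exists k, q ^+ k <= r < q ^+ k.+1.
Proof.
move=> r1; have [N rN] : exists N, r < q ^+ N.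
  have [m rm] : exists m, r < (2 ^ m)%:R.
    exists (Num.truncn r).+1; apply: lt_trans (truncnS_gt r) _.
    by rewrite ltr_nat ltn_expl.
  by exists (n * m)%N; rewrite exprM qX -natrX.
have ex : exists N, r < q ^+ N by exists N.
case: (ex_minnP ex) => -[|k]; first by rewrite expr0 ltNge r1.
move=> rk kmin; exists k; rewrite rk andbT leNgt; apply/negP => /kmin.
by rewrite ltnn.
Qed.

Let measurable_enorm_powR (a : R) :
  measurable_fun setT (fun h : 'rV[R]_n => enorm h `^ a / enorm h ^+ n).
Proof.
have me := measurable_enorm (@measurable_id _ 'rV[R]_n setT).
apply: measurable_funM.
  by apply: (measurableT_comp (f := fun x : R => x `^ a)) => //; exact: measurable_powR.
apply: measurable_ge0_inv => [|x]; first exact: measurable_funX.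
by rewrite exprn_ge0// enorm_ge0.
Qed.


(** The shells have consecutive radii in ratio [q], where [q ^+ n = 2], so
    that their volumes double from each one to the next: the doubling cancels
    the factor [enorm h ^- n] and a geometric series of ratio [q `^ (- s)] is
    left.  Its sum is larger than the exact value of the integral,
    [n omega / s], by at most a factor 2. *)
Local Lemma integral_out (s : R) : 0 < s -> s <= n%:R ->
  (\int[mu]_(h in ~` ball 1%R) (enorm h `^ (- s) / enorm h ^+ n)%:E
    <= (2 * n%:R * omega / s)%:E)%E.
Proof.
move=> s0 sn; have mb := @measurable_enorm_ball R n.
have nR0 : 0 < n%:R :> R by rewrite ltr0n.
have sub := one_sub_powR_ge (introT andP (conj s0 sn)).
have z1 : 0 < s / (2 * n%:R) by rewrite divr_gt0// mulr_gt0.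
rewrite integral_mkcond.
pose phi := (fun h : 'rV[R]_n => enorm h `^ (- s) / enorm h ^+ n) \_ (~` ball 1).
have phi0 x : 0 <= phi x.
  rewrite /phi patchE; case: ifP => // _.
  by rewrite divr_ge0 ?powR_ge0// exprn_ge0// enorm_ge0.
rewrite (eq_integral (fun x => (phi x)%:E)); last first.
  by move=> x _; rewrite /phi restrict_EFin.
apply: (@le_trans _ _ (omega / (1 - q `^ (- s)))%:E).
  apply: (@ge0_integral_geometric_cover _ _ _ mu phi
    (fun k => ball (q ^+ k.+1) `\` ball (q ^+ k)) (fun k => (q `^ (- s)) ^+ k / 2 ^+ k)).
  - apply/measurable_restrict => //; first exact: measurableC.
    exact: measurable_funTS.
  - by move=> k; exact: measurableD.
  - move=> x; rewrite /phi patchE; case: ifPn => [|_]; last by left.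
    rewrite inE/= => /negP; rewrite -leNgt => /exists_qk[k /andP[kx xk]].
    by right; exists k; split => //=; apply/negP; rewrite -leNgt.
  - move=> k x [/= xk /negP]; rewrite -leNgt => kx; rewrite /phi patchE.
    case: ifPn => _; last first.
      by rewrite divr_ge0// exprn_ge0// powR_ge0.
    have x_gt0 : 0 < enorm x by exact: lt_le_trans kx.
    rewrite -powR_expr ?q_ge0// -qX -exprM mulnC exprM; apply: ler_pM.
    + exact: powR_ge0.
    + by rewrite invr_ge0 exprn_ge0// enorm_ge0.
    + rewrite !powRN lef_pV2 ?posrE ?powR_gt0//.
      by apply: ge0_ler_powR; rewrite ?nnegrE ?enorm_ge0 ?exprn_ge0 ?(ltW s0).
    + rewrite lef_pV2 ?posrE ?exprn_gt0//.
      by apply: lerXn2r; rewrite ?nnegrE ?enorm_ge0 ?exprn_ge0.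
  - by move=> k; rewrite divr_ge0// exprn_ge0// powR_ge0.
  - exact: phi0.
  - rewrite powR_ge0/=; lra.
  - move=> k; rewrite ?/S /= shell_volume//; last by rewrite exprS ler_peMl// ltW.
    rewrite -EFinM lee_fin -!exprM ![(_ * n)%N]mulnC !exprM qX exprS.
    by rewrite [leLHS](_ : _ = omega * q `^ (- s) ^+ k)//; field; rewrite expf_eq0 pnatr_eq0 andbF.
have -> : 2 * n%:R * omega / s = omega * (s / (2 * n%:R))^-1.
  by field; rewrite !lt0r_neq0.
rewrite lee_fin ler_wpM2l ?unit_ball_volume_ge0// lef_pV2 ?posrE//.
exact: lt_le_trans sub.
Qed.

(** Same shells as outside of the ball, with inverse radii. *)
Local Lemma integral_in (s : R) : 0 < s -> s <= n%:R ->
  (\int[mu]_(h in ball 1%R) (enorm h `^ s / enorm h ^+ n)%:E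
    <= (2 * n%:R * omega / s)%:E)%E.
Proof.
move=> s0 sn; have mb := @measurable_enorm_ball R n.
have nR0 : 0 < n%:R :> R by rewrite ltr0n.
have sub := one_sub_powR_ge (introT andP (conj s0 sn)).
have z1 : 0 < s / (2 * n%:R) by rewrite divr_gt0// mulr_gt0.
rewrite integral_mkcond.
pose phi := (fun h : 'rV[R]_n => enorm h `^ s / enorm h ^+ n) \_ (ball 1).
have phi0 x : 0 <= phi x.
  rewrite /phi patchE; case: ifP => // _.
  by rewrite divr_ge0 ?powR_ge0// exprn_ge0// enorm_ge0.
rewrite (eq_integral (fun x => (phi x)%:E)); last first.
  by move=> x _; rewrite /phi restrict_EFin.
pose S k := ball ((q ^+ k)^-1) `\` ball ((q ^+ k.+1)^-1).
apply: (@le_trans _ _ (omega / (1 - q `^ (- s)))%:E).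
  apply: (@ge0_integral_geometric_cover _ _ _ mu phi S
    (fun k => (q `^ (- s)) ^+ k * 2 ^+ k.+1)).
  - apply/measurable_restrict => //.
    exact: measurable_funTS.
  - by move=> k; exact: measurableD.
  - move=> x; rewrite /phi patchE; case: ifPn => [|_]; last by left.
    have [->|x0] := eqVneq x 0.
      by left; rewrite enorm0 powR0 ?mul0r// gt_eqF.
    rewrite inE/= => x1; right.
    have ex : exists k, (q ^+ k.+1)^-1 <= enorm x.
      have [|k /andP[_ /ltW kx]] := @exists_qk (enorm x)^-1.
        by rewrite invf_ge1 ?enorm_gt0// ltW.
      exists k; rewrite -[leRHS]invrK lef_pV2 ?posrE ?invr_gt0 ?enorm_gt0//.
    case: (ex_minnP ex) => k kx kmin; exists k; split => /=; last first.
      by apply/negP; rewrite -leNgt.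
    case: k kx kmin => [_ _|k kx kmin]; first by rewrite expr0 invr1.
    by rewrite ltNge; apply/negP => /kmin; rewrite ltnn.
  - move=> k x [/= xk /negP]; rewrite -leNgt => kx; rewrite /phi patchE.
    case: ifPn => _; last first.
      by rewrite mulr_ge0// exprn_ge0// powR_ge0.
    have x_gt0 : 0 < enorm x by apply: lt_le_trans kx; rewrite invr_gt0.
    rewrite -powR_expr ?q_ge0// -qX -exprM mulnC exprM; apply: ler_pM.
    + exact: powR_ge0.
    + by rewrite invr_ge0 exprn_ge0// enorm_ge0.
    + have -> : (q ^+ k) `^ (- s) = ((q ^+ k)^-1) `^ s.
        by rewrite -powR_inv1 ?exprn_ge0// -powRrM mulN1r.
      by apply: ge0_ler_powR; rewrite ?nnegrE ?enorm_ge0 ?invr_ge0 ?exprn_ge0 ?(ltW s0) ?(ltW xk).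
    + rewrite -[leRHS]invrK lef_pV2 ?posrE ?invr_gt0 ?exprn_gt0// -exprVn.
      by apply: lerXn2r; rewrite ?nnegrE ?enorm_ge0 ?invr_ge0 ?exprn_ge0.
  - by move=> k; rewrite mulr_ge0// exprn_ge0// powR_ge0.
  - exact: phi0.
  - rewrite powR_ge0/=; lra.
  - move=> k; rewrite ?/S /= shell_volume ?invr_gt0//; last first.
      by rewrite lef_pV2 ?posrE// exprS ler_peMl// ltW.
    rewrite -EFinM lee_fin !exprVn -!exprM ![(_ * n)%N]mulnC !exprM qX exprS.
    rewrite [leLHS](_ : _ = omega * q `^ (- s) ^+ k)//; field.
    by rewrite expf_eq0 pnatr_eq0 andbF.
have -> : 2 * n%:R * omega / s = omega * (s / (2 * n%:R))^-1.
  by field; rewrite !lt0r_neq0.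
rewrite lee_fin ler_wpM2l ?unit_ball_volume_ge0// lef_pV2 ?posrE//.
exact: lt_le_trans sub.
Qed.

End root_of_two.

Lemma ge0_integral_enorm_powR_out (s : R) : 0 < s -> s <= n%:R ->
  (\int[mu]_(h in ~` ball 1%R) (enorm h `^ (- s) / enorm h ^+ n)%:E
    <= (2 * n%:R * omega / s)%:E)%E.
Proof. by have [q [q0 qX]] := ex_root; exact: (integral_out q0). Qed.

Lemma ge0_integral_enorm_powR_in (s : R) : 0 < s -> s <= n%:R ->
  (\int[mu]_(h in ball 1%R) (enorm h `^ s / enorm h ^+ n)%:E
    <= (2 * n%:R * omega / s)%:E)%E.
Proof. by have [q [q0 qX]] := ex_root; exact: (integral_in q0). Qed.

End power_integrals.

(** * Young functions and Jensen's inequality *)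

Lemma ge0_integralM d (T : measurableType d) (R : realType)
    (mu : {measure set T -> \bar R}) (c : R) (f : T -> R) :
  measurable_fun setT f -> (forall x, 0 <= f x) -> 0 <= c ->
  (\int[mu]_x (c * f x)%:E = c%:E * \int[mu]_x (f x)%:E)%E.
Proof.
move=> mf f0 c0; under eq_integral do rewrite EFinM.
rewrite ge0_integralZl//; first exact/measurable_EFinP.
by move=> x _; rewrite lee_fin.
Qed.

Section young.
Context {R : realType} (A : R -> R).
Hypothesis YA : young_function A.

Lemma young_homo x y : 0 <= x -> x <= y -> A x <= A y.
Proof.
move=> x0 xy; apply: (young_increasing YA) => //; rewrite in_itv/= andbT//.
exact: le_trans xy.
Qed.

Lemma measurable_young d (T : measurableType d) (f : T -> R) :
  measurable_fun setT f -> (forall x, 0 <= f x) ->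
  measurable_fun setT (fun x => A (f x)).
Proof.
move=> mf f0; rewrite (_ : (fun _ => _) = (fun t : R => A (Num.max 0 t)) \o f).
  apply: measurableT_comp => //; apply: nondecreasing_measurable => // x y xy.
  apply: young_homo; first by rewrite le_max lexx.
  by rewrite ge_max le_max lexx/= le_max xy orbT.
by apply/funext => x /=; rewrite (max_idPr _).
Qed.

Lemma young_convex_comb t x y : 0 <= t <= 1 -> 0 <= x -> 0 <= y ->
  A (t * x + (1 - t) * y) <= t * A x + (1 - t) * A y.
Proof.
move=> /andP[t0 t1] x0 y0.
exact: (young_convex YA (Itv01 t0 t1) (mem_set x0) (mem_set y0)).
Qed.

Lemma young_scale t x : 0 <= t <= 1 -> 0 <= x -> A (t * x) <= t * A x.
Proof.
move=> t01 x0; have := young_convex_comb t01 x0 (lexx 0).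
by rewrite (young_at0 YA) !mulr0 !addr0.
Qed.

Let chord p a t : 0 <= p -> p < a -> a < t ->
  (A a - A p) / (a - p) <= (A t - A a) / (t - a).
Proof.
move=> p0 pa at_; have tp : 0 < t - p by lra.
have ap : 0 < a - p by lra.
have ta : 0 < t - a by lra.
have l01 : 0 <= (t - a) / (t - p) <= 1.
  apply/andP; split; first by rewrite divr_ge0// ltW.
  by rewrite ler_pdivrMr//; lra.
have := young_convex_comb l01 p0 (ltW (le_lt_trans p0 (lt_trans pa at_))).
have -> : (t - a) / (t - p) * p + (1 - (t - a) / (t - p)) * t = a.
  by field; rewrite lt0r_neq0.
have -> : (t - a) / (t - p) * A p + (1 - (t - a) / (t - p)) * A t =
    ((t - a) * A p + (a - p) * A t) / (t - p) by field; rewrite lt0r_neq0.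
move=> H; rewrite ler_pdivlMr// in H.
rewrite ler_pdivrMr// mulrAC ler_pdivlMr//; nra.
Qed.

(** The infimum of the slopes of the chords on the right of [a] is at least
    the slope of every chord on its left. *)
Lemma young_supporting_line a : 0 < a -> exists2 k : R, 0 <= k &
  forall t, 0 <= t -> A a + k * (t - a) <= A t.
Proof.
move=> a0; pose E := [set (A t - A a) / (t - a) | t in [set t | a < t]].
have E0 : E !=set0 by exists ((A (a + 1) - A a) / (a + 1 - a)), (a + 1) => //=; lra.
have lbE p : 0 <= p -> p < a -> lbound E ((A a - A p) / (a - p)).
  by move=> p0 pa _ [t /= at_ <-]; exact: chord.
have hlE : has_lbound E by exists ((A a - A 0) / (a - 0)); exact: lbE.
exists (inf E).
  apply: lb_le_inf => // _ [t /= at_ <-].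
  by rewrite divr_ge0 ?subr_ge0 ?(ltW at_)// young_homo// ltW.
move=> t t0; case: (ltgtP t a) => [ta|at_|->]; last by rewrite subrr mulr0 addr0.
  have : (A a - A t) / (a - t) <= inf E by apply: lb_le_inf => //; exact: lbE.
  rewrite ler_pdivrMr ?subr_gt0//; lra.
have : inf E <= (A t - A a) / (t - a) by apply: ge_inf => //; exists t.
rewrite ler_pdivlMr ?subr_gt0//; lra.
Qed.

(** Jensen's inequality for a weight of mass at most [M].  Integrate the
    supporting line at [a] against [w]: the line is nonpositive at 0, because
    [A 0 = 0], so replacing the mass of [w] by the larger [M] goes in the right
    direction.  The integral of [w * f] may be infinite, which is why [a] is
    only assumed to be a lower bound. *)
Lemma young_jensen d (T : measurableType d) (mu : {measure set T -> \bar R})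
    (w f : T -> R) (M a : R) :
  measurable_fun setT w -> measurable_fun setT f ->
  (forall x, 0 <= w x) -> (forall x, 0 <= f x) -> 0 <= M -> 0 <= a ->
  (\int[mu]_x (w x)%:E <= M%:E)%E -> (a%:E <= \int[mu]_x (w x * f x)%:E)%E ->
  ((M * A a)%:E <= \int[mu]_x (w x * A (M * f x))%:E)%E.
Proof.
move=> mw mf w0 f0 M0; rewrite le_eqVlt => /predU1P[<- _ _|a0 wM af].
  rewrite (young_at0 YA) mulr0; apply: integral_ge0 => x _.
  by rewrite lee_fin mulr_ge0// (young_ge0 YA)// mulr_ge0.
have [k k0 Hk] := young_supporting_line a0.
pose b := k * a - A a.
have b0 : 0 <= b by have := Hk 0 (lexx _); rewrite (young_at0 YA) /b; lra.
have Mf0 x : 0 <= M * f x by rewrite mulr_ge0.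
have AMf0 x : 0 <= A (M * f x) by exact: (young_ge0 YA).
have mAf : measurable_fun setT (fun x => A (M * f x)).
  by apply: measurable_young => //; exact: measurable_funM.
have mwf : measurable_fun setT (fun x => w x * f x) by exact: measurable_funM.
have mwA : measurable_fun setT (fun x => w x * A (M * f x)).
  exact: measurable_funM.
have H : (\int[mu]_x ((k * M) * (w x * f x))%:E <=
    \int[mu]_x ((w x * A (M * f x))%:E + (b * w x)%:E))%E.
  apply: ge0_le_integral => //.
  - by move=> x _; rewrite lee_fin !mulr_ge0.
  - by apply/measurable_EFinP; exact: measurable_funM.
  - by apply: emeasurable_funD; apply/measurable_EFinP => //; exact: measurable_funM.
  - move=> x _; rewrite -EFinD lee_fin.
    have := ler_wpM2l (w0 x) (Hk _ (Mf0 x)); rewrite /b; lra.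
rewrite ge0_integralD// in H; last 4 first.
- by move=> x _; rewrite lee_fin mulr_ge0.
- exact/measurable_EFinP.
- by move=> x _; rewrite lee_fin mulr_ge0.
- by apply/measurable_EFinP; exact: measurable_funM.
have E1 : (\int[mu]_x (b * w x)%:E <= (b * M)%:E)%E.
  by rewrite ge0_integralM// EFinM lee_wpmul2l ?lee_fin.
have E2 : ((k * M * a)%:E <= \int[mu]_x ((k * M) * (w x * f x))%:E)%E.
  rewrite ge0_integralM ?mulr_ge0// => [|x]; last by rewrite mulr_ge0.
  by rewrite EFinM lee_wpmul2l ?lee_fin// mulr_ge0.
have := le_trans E2 (le_trans H (leeD2l _ E1)).
rewrite -leeBlDr// -EFinB; congr (_%:E <= _)%E.
by rewrite /b; ring.
Qed.

End young.

(** * Modulars of convolutions *)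

Section orlicz_convolution.
Context {R : realType} (n : nat).
Local Notation mu := (@lebesgue_rV R n).
Local Notation rV := 'rV[R]_n.
Implicit Types (G f u w : rV -> R) (h x y : rV).

Lemma ae_translate (P : rV -> Prop) h :
  {ae mu, forall x, P x} -> {ae mu, forall x, P (x + h)}.
Proof.
move=> [N [mN N0 PN]]; have madd : measurable_fun setT (fun x : rV => x + h).
  by apply: measurable_rV_add.
have mNh : measurable ((fun x : rV => x + h) @^-1` N).
  by rewrite -[X in measurable X]setTI; exact: madd.
exists ((fun x => x + h) @^-1` N); split => //.
  have muE A : measurable A -> mu A = (\int[mu]_x (\1_A x)%:E)%E.
    by move=> mA; rewrite integral_indic// setIT.
  rewrite [LHS]muE//.
  have := @ge0_integral_rV_translate R n h (fun x => (\1_N x)%:E).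
  rewrite -[RHS]muE// [RHS]N0 => <-//.
  by apply/measurable_EFinP; exact: measurable_indic.
by move=> x /= nP; apply: PN => /= Px; exact: nP.
Qed.

(** The equation of [is_convolution] has a finite left-hand side; this turns
    it into absolute convergence of the convolution integral. *)
Lemma integral_fin_integrable d (T : measurableType d)
    (nu : {measure set T -> \bar R}) (g : T -> R) :
  measurable_fun setT g -> (\int[nu]_x (g x)%:E)%E \is a fin_num ->
  nu.-integrable setT (EFin \o g).
Proof.
move=> mg; rewrite integralE; set a := integral _ _ _; set b := integral _ _ _.
have a0 : (0 <= a)%E by exact: integral_ge0.
have b0 : (0 <= b)%E by exact: integral_ge0.
rewrite fin_numB => /andP[afin bfin].
apply/integrableP; split; first exact/measurable_EFinP.
have mEg : measurable_fun setT (EFin \o g) by exact/measurable_EFinP.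
rewrite -/(abse \o _) fune_abse ge0_integralD//; last 2 first.
- exact: measurable_funepos.
- exact: measurable_funeneg.
by rewrite lte_add_pinfty// ltey_eq ?afin ?bfin.
Qed.

Lemma measurable_shift_kernel w :
  measurable_fun setT w -> measurable_fun setT (fun z : rV * rV => w (z.1 - z.2)).
Proof.
move=> mw; apply: measurableT_comp => //.
by apply: measurable_rV_sub; [exact: measurable_fst|exact: measurable_snd].
Qed.

Lemma measurable_sub_r x : measurable_fun setT (fun y : rV => x - y).
Proof. by apply: measurable_rV_sub. Qed.

Lemma measurable_sub_l y : measurable_fun setT (fun x : rV => x - y).
Proof. by apply: measurable_rV_sub. Qed.

Lemma conv_point_le G f (a : R) x : measurable_fun setT G -> measurable_fun setT f ->
  a%:E = (\int[mu]_y (G (x - y) * f y)%:E)%E ->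
  (`|a|%:E <= \int[mu]_y (`|G (x - y)| * `|f y|)%:E)%E.
Proof.
move=> mG mf ae; rewrite -abse_EFin ae; apply: le_trans (le_abse_integral _ _ _) _ => //.
  apply/measurable_EFinP; apply: measurable_funM => //.
  exact: measurableT_comp (measurable_sub_r x).
by under eq_integral do rewrite abse_EFin normrM.
Qed.

Lemma conv_diff_le G f (a b : R) x h :
  measurable_fun setT G -> measurable_fun setT f ->
  a%:E = (\int[mu]_y (G (x + h - y) * f y)%:E)%E ->
  b%:E = (\int[mu]_y (G (x - y) * f y)%:E)%E ->
  (`|a - b|%:E <= \int[mu]_y (`|G (x - y + h) - G (x - y)| * `|f y|)%:E)%E.
Proof.
move=> mG mf aE bE.
have mGx z : measurable_fun setT (fun y => G (z - y)).
  exact: measurableT_comp (measurable_sub_r z).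
have mGf z : measurable_fun setT (fun y => G (z - y) * f y) by exact: measurable_funM.
have ia : mu.-integrable setT (fun y => (G (x + h - y) * f y)%:E).
  by apply: integral_fin_integrable => //; rewrite -aE.
have ib : mu.-integrable setT (fun y => (G (x - y) * f y)%:E).
  by apply: integral_fin_integrable => //; rewrite -bE.
rewrite -abse_EFin EFinB aE bE -integralB//.
apply: le_trans (le_abse_integral _ _ _) _ => //.
  by apply: emeasurable_funB; exact/measurable_EFinP.
rewrite le_eqVlt; apply/orP; left; apply/eqP; apply: eq_integral => y _.
by rewrite -EFinB abse_EFin -mulrBl normrM addrAC.
Qed.

Variable A : R -> R.
Hypothesis YA : young_function A.

(** The key estimate.  Jensen's inequality bounds [A (D x)] by an average of
    [A (M |f|)] against [w (x - y) / M]; integrating over [x] first, by Tonelli,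
    produces the mass of [w].  Keeping [m] and [M] apart lets two kernels of
    different masses be compared with the same multiple of [f]. *)
Lemma modular_conv_le w f (D : rV -> R) (m M : R) :
  measurable_fun setT w -> measurable_fun setT f -> measurable_fun setT D ->
  (forall x, 0 <= w x) -> (forall x, 0 <= D x) ->
  0 <= m -> m <= M -> 0 < M -> (\int[mu]_x (w x)%:E <= m%:E)%E ->
  {ae mu, forall x, ((D x)%:E <= \int[mu]_y (w (x - y) * `|f y|)%:E)%E} ->
  (\int[mu]_x (A (D x))%:E <=
    (m / M)%:E * \int[mu]_x (A (M * `|f x|))%:E)%E.
Proof.
move=> mw mf mD w0 D0 m0 mM M0 wm Df.
have Mf0 y : 0 <= M * `|f y| by rewrite mulr_ge0 // ltW.
have A0 y : 0 <= A (M * `|f y|) by exact: (young_ge0 YA).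
have mAf : measurable_fun setT (fun y => A (M * `|f y|)).
  apply: measurable_young => //; apply: measurable_funM => //.
  exact: measurableT_comp.
have mK : measurable_fun setT
    (fun z : rV * rV => (w (z.1 - z.2) * A (M * `|f z.2|))%:E).
  apply/measurable_EFinP; apply: measurable_funM; first exact: measurable_shift_kernel.
  exact: (measurableT_comp mAf measurable_snd).
have K0 (z : rV * rV) : (0 <= (w (z.1 - z.2) * A (M * `|f z.2|))%:E)%E.
  by rewrite lee_fin mulr_ge0.
have mI : measurable_fun setT
    (fun x => \int[mu]_y (w (x - y) * A (M * `|f y|))%:E)%E.
  exact: (measurable_fun_fubini_tonelli_F _ mK K0).
have jensen : {ae mu, forall x, setT x -> ((A (D x))%:E <=
    (M^-1)%:E * \int[mu]_y (w (x - y) * A (M * `|f y|))%:E)%E}.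
  move: Df; apply: filterS => x Dx _.
  have mwx : measurable_fun setT (fun y => w (x - y)).
    exact: measurableT_comp (measurable_sub_r x).
  have : ((M * A (D x))%:E <= \int[mu]_y (w (x - y) * A (M * `|f y|))%:E)%E.
    apply: (young_jensen YA) => //.
    - exact: measurableT_comp.
    - exact: ltW.
    - rewrite (ge0_integral_rV_reflect x (f := EFin \o w))//.
      + by apply: le_trans wm _; rewrite lee_fin.
      + exact/measurable_EFinP.
  move=> /(lee_wpmul2l _) -/(_ (M^-1)%:E); rewrite lee_fin invr_ge0 => /(_ (ltW M0)).
  by rewrite -EFinM mulKf// gt_eqF.
apply: le_trans (ae_ge0_le_integral _ _ _ _ _ jensen) _ => //.
- by move=> x _; rewrite lee_fin (young_ge0 YA).
- by apply/measurable_EFinP; exact: measurable_young.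
- move=> x _; rewrite mule_ge0 ?lee_fin ?invr_ge0 ?(ltW M0)//.
  by apply: integral_ge0 => y _; exact: (K0 (x, y)).
- exact: measurable_funeM.
rewrite ge0_integralZl ?lee_fin ?invr_ge0 ?(ltW M0)//; last first.
  by move=> x _; apply: integral_ge0 => y _; exact: (K0 (x, y)).
rewrite (fubini_tonelli _ mK K0)/= mulrC EFinM -muleA.
rewrite lee_wpmul2l ?lee_fin ?invr_ge0 ?(ltW M0)//.
rewrite -(ge0_integralM mu mAf A0 m0).
apply: ge0_le_integral => //.
  - by move=> y _; apply: integral_ge0 => x _; exact: (K0 (x, y)).
  - exact: (measurable_fun_fubini_tonelli_G _ mK K0).
  - by apply/measurable_EFinP; exact: measurable_funM.
  - move=> y _; under eq_integral do rewrite mulrC.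
    rewrite ge0_integralM//; last exact: measurableT_comp (measurable_sub_l y).
    rewrite muleC EFinM lee_wpmul2r ?lee_fin//.
    rewrite (ge0_integral_rV_translate (- y) (f := EFin \o w))//.
    exact/measurable_EFinP.
Qed.

End orlicz_convolution.

(** * The modular inequality *)

Section modular_inequality.
Context {R : realType} (n : nat) (A : R -> R).
Hypothesis n_gt0 : (0 < n)%N.
Hypothesis YA : young_function A.
Local Notation mu := (@lebesgue_rV R n).
Local Notation rV := 'rV[R]_n.
Local Notation omega := (unit_ball_volume R n).
Local Notation ball r := [set x : 'rV[R]_n | enorm x < r].
Variables (s s' : R) (G f u : rV -> R) (K : R).
Hypotheses (s_gt0 : 0 < s) (ss' : s < s') (s'_lt1 : s' < 1).
Hypothesis iG : mu.-integrable setT (EFin \o G).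
Hypothesis G_gt0 : 0 < L1norm G.
Hypotheses (mf : measurable_fun setT f) (meas_u : measurable_fun setT u).
Hypothesis fGu : is_convolution G f u.
Hypothesis K_gt0 : 0 < K.
Hypothesis holderG : forall h : rV,
  (\int[mu]_x `|G (x + h) - G x|%:E <= (K * enorm h `^ s')%:E)%E.

Let M := 2 * L1norm G + K.

Let mG : measurable_fun setT G.
Proof. by apply/measurable_EFinP; exact: measurable_int iG. Qed.

Let intG : (\int[mu]_x `|G x|%:E)%E = (L1norm G)%:E.
Proof.
rewrite /L1norm /Rintegral fineK// ge0_fin_numE ?integral_ge0//.
  by case/integrableP : iG.
Qed.

Let intG2 (h : rV) : (\int[mu]_x `|G (x + h) - G x|%:E <= (2 * L1norm G)%:E)%E.
Proof.
have mGh : measurable_fun setT (fun x : rV => G (x + h)).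
  by apply: measurableT_comp => //; exact: measurable_rV_add.
apply: (@le_trans _ _ (\int[mu]_x (`|G (x + h)|%:E + `|G x|%:E))%E).
  apply: ge0_le_integral => [//|x _|||x _].
  - by rewrite lee_fin.
  - by apply/measurable_EFinP/measurableT_comp => //; exact: measurable_funB.
  - by apply: emeasurable_funD; apply/measurable_EFinP/measurableT_comp.
  - by rewrite -EFinD lee_fin ler_normB.
rewrite ge0_integralD//; last 2 first.
- exact/measurable_EFinP/measurableT_comp.
- exact/measurable_EFinP/measurableT_comp.
rewrite (ge0_integral_rV_translate h (f := fun x => `|G x|%:E))//; last first.
  exact/measurable_EFinP/measurableT_comp.
by rewrite intG -EFinD lee_fin mulr2n mulrDl mul1r.
Qed.

Let A0 x : 0 <= x -> 0 <= A x. Proof. exact: (young_ge0 YA). Qed.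

(** The kernel is its own comparison mass here, so the constant is 1. *)
Lemma modular_le : (modular A u <=
  \int[mu]_x (A (L1norm G * `|f x|))%:E)%E.
Proof.
have := @modular_conv_le R n A YA (fun x => `|G x|) f (fun x => `|u x|)
  (L1norm G) (L1norm G).
rewrite divff ?gt_eqF// mul1e; apply => //.
- exact: measurableT_comp.
- exact: measurableT_comp.
- exact: ltW.
- by rewrite intG.
- by move: fGu; apply: filterS => x; exact: conv_point_le.
Qed.

Let I := (\int[mu]_x (A (M * `|f x|))%:E)%E.

Let I_ge0 : (0 <= I)%E.
Proof.
apply: integral_ge0 => x _; rewrite lee_fin A0// mulr_ge0// /M addr_ge0//.
  by rewrite mulr_ge0// ltW.
exact: ltW.
Qed.

Let M_gt0 : 0 < M. Proof. by rewrite /M addr_gt0// mulr_gt0. Qed.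

(** The kernel of the difference is [G (. + h) - G], whose mass is small by
    the Hoelder estimate and at most twice that of [G]. *)
Let diff_conv (h : rV) : {ae mu, forall x, (`|u (x + h) - u x|%:E <=
  \int[mu]_y (`|G (x - y + h) - G (x - y)| * `|f y|)%:E)%E}.
Proof.
have fGuh := ae_translate h fGu.
move: fGu fGuh; apply: filterS2 => x ux uxh; exact: conv_diff_le.
Qed.

Let mGh (h : rV) : measurable_fun setT (fun x : rV => `|G (x + h) - G x|).
Proof.
apply: measurableT_comp => //; apply: measurable_funB => //.
by apply: measurableT_comp => //; exact: measurable_rV_add.
Qed.

Let muh (h : rV) : measurable_fun setT (fun x : rV => `|u (x + h) - u x|).
Proof.
apply: measurableT_comp => //; apply: measurable_funB => //.
by apply: measurableT_comp => //; exact: measurable_rV_add.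
Qed.

(** Only the trivial bound on the mass of [G (. + h) - G] is used: since
    [enorm h `^ (- s) <= 1], convexity takes that factor out of [A]. *)
Let diff_quotient_far (h : rV) : 1 <= enorm h ->
  (\int[mu]_x (A (`|u (x + h)%R - u x| / enorm h `^ s) / enorm h ^+ n)%:E <=
   (enorm h `^ (- s) / enorm h ^+ n)%:E * ((2 * L1norm G / M)%:E * I))%E.
Proof.
move=> h1; have h0 : 0 < enorm h by exact: lt_le_trans h1.
have t01 : 0 <= enorm h `^ (- s) <= 1.
  rewrite powR_ge0/= powRN invf_le1 ?powR_gt0//.
  by rewrite -(powRr0 (enorm h)) ler_powR// ltW.
apply: (@le_trans _ _ (\int[mu]_x
  (enorm h `^ (- s) / enorm h ^+ n * A `|u (x + h) - u x|)%:E)%E).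
  apply: ge0_le_integral => //.
  - move=> x _; rewrite lee_fin divr_ge0 ?exprn_ge0 ?A0 ?divr_ge0 ?powR_ge0//.
    exact: ltW.
  - apply/measurable_EFinP/measurable_funM => //; apply: measurable_young => //.
      exact: measurable_funM.
    by move=> x; rewrite divr_ge0// powR_ge0.
  - by apply/measurable_EFinP/measurable_funM => //; exact: measurable_young.
  - move=> x _; rewrite lee_fin mulrAC ler_wpM2r ?invr_ge0 ?exprn_ge0 ?(ltW h0)//.
    by rewrite -powRN mulrC young_scale.
have c0 : 0 <= enorm h `^ (- s) / enorm h ^+ n.
  by rewrite divr_ge0 ?powR_ge0 ?exprn_ge0 ?(ltW h0).
rewrite ge0_integralM//; last 2 first.
- exact: measurable_young.
- by move=> x; exact: A0.
rewrite lee_wpmul2l ?lee_fin//.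
apply: (@modular_conv_le R n A YA (fun x : rV => `|G (x + h) - G x|)) => //.
- by rewrite mulr_ge0// ltW.
- by rewrite /M lerDl ltW.
Qed.

(** Here the difference quotient of order [s'] is controlled, and the factor
    [enorm h `^ (s' - s) <= 1] that remains is taken out of [A] by
    convexity. *)
Let diff_quotient_near (h : rV) : 0 < enorm h -> enorm h < 1 ->
  (\int[mu]_x (A (`|u (x + h)%R - u x| / enorm h `^ s) / enorm h ^+ n)%:E <=
   (enorm h `^ (s' - s) / enorm h ^+ n)%:E * ((K / M)%:E * I))%E.
Proof.
move=> h0 h1; set t := enorm h in h0 h1 *.
have t01 : 0 <= t `^ (s' - s) <= 1.
  rewrite powR_ge0/= -(powRr0 t) ger_powR ?h0 ?(ltW h1)//.
  by rewrite subr_ge0 ltW.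
have ts'0 : 0 < t `^ s' by rewrite powR_gt0.
have tsE : t `^ s = t `^ s' / t `^ (s' - s).
  rewrite -powRN -powRD; last by rewrite (gt_eqF h0) implybT.
  by rewrite opprB addrC subrK.
apply: (@le_trans _ _ (\int[mu]_x
  (t `^ (s' - s) / t ^+ n * A (`|u (x + h) - u x| / t `^ s'))%:E)%E).
  apply: ge0_le_integral => //.
  - move=> x _; rewrite lee_fin divr_ge0 ?exprn_ge0 ?A0 ?divr_ge0 ?powR_ge0//.
    exact: ltW.
  - apply/measurable_EFinP/measurable_funM => //; apply: measurable_young => //.
      exact: measurable_funM.
    by move=> x; rewrite divr_ge0// powR_ge0.
  - apply/measurable_EFinP/measurable_funM => //; apply: measurable_young => //.
      exact: measurable_funM.
    by move=> x; rewrite divr_ge0// powR_ge0.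
  - move=> x _; rewrite lee_fin mulrAC ler_wpM2r ?invr_ge0 ?exprn_ge0 ?(ltW h0)//.
    rewrite tsE invf_div mulrCA; apply: (young_scale YA) => //.
    by rewrite divr_ge0// ltW.
have c0 : 0 <= t `^ (s' - s) / t ^+ n.
  by rewrite divr_ge0 ?powR_ge0 ?exprn_ge0 ?(ltW h0).
rewrite ge0_integralM//; last 2 first.
- apply: measurable_young => //; first exact: measurable_funM.
  by move=> x; rewrite divr_ge0// powR_ge0.
- by move=> x; rewrite A0// divr_ge0// powR_ge0.
rewrite lee_wpmul2l ?lee_fin//.
apply: (@modular_conv_le R n A YA (fun x : rV => (t `^ s')^-1 * `|G (x + h) - G x|)) => //.
- exact: measurable_funM.
- exact: measurable_funM.
- by move=> x; rewrite mulr_ge0// invr_ge0 ltW.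
- by move=> x; rewrite divr_ge0// ltW.
- exact: ltW.
- by rewrite /M lerDr mulr_ge0// ltW.
- rewrite ge0_integralM// ?invr_ge0 ?(ltW ts'0)//.
  apply: le_trans (lee_wpmul2l _ (holderG h)) _.
    by rewrite lee_fin invr_ge0 ltW.
  by rewrite -EFinM lee_fin mulrCA mulVf ?mulr1// gt_eqF.
- move: (diff_conv h); apply: filterS => x Hx.
  under eq_integral do rewrite -mulrA.
  rewrite ge0_integralM ?invr_ge0 ?(ltW ts'0)//; last first.
    apply: measurable_funM; last exact: measurableT_comp.
    exact: (measurableT_comp (mGh h) (measurable_sub_r x)).
  by rewrite mulrC EFinM lee_wpmul2l// lee_fin invr_ge0 ltW.
Qed.

Definition frac_integrand (v : rV -> R) (z : rV * rV) : R :=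
  A (`|v (z.2 + z.1) - v z.2| / enorm z.1 `^ s) / enorm z.1 ^+ n.

Lemma frac_integrand_ge0 v z : 0 <= frac_integrand v z.
Proof.
by rewrite divr_ge0 ?exprn_ge0 ?enorm_ge0// A0// divr_ge0// powR_ge0.
Qed.

Lemma measurable_frac_integrand v : measurable_fun setT v ->
  measurable_fun setT (frac_integrand v).
Proof.
move=> mv; have men := measurable_enorm (@measurable_fst _ _ rV rV).
apply: measurable_funM; last first.
  apply: measurable_ge0_inv => [|z]; first exact: measurable_funX.
  by rewrite exprn_ge0// enorm_ge0.
apply: measurable_young => // [|z]; last by rewrite divr_ge0// powR_ge0.
apply: measurable_funM; last first.
  apply: measurable_ge0_inv => [|z]; last exact: powR_ge0.
  by apply: (measurableT_comp (f := fun x : R => x `^ s)) => //; exact: measurable_powR.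
apply: measurableT_comp => //; apply: measurable_funB.
  apply: measurableT_comp => //.
  by apply: measurable_rV_add; [exact: measurable_snd|exact: measurable_fst].
exact: (measurableT_comp mv measurable_snd).
Qed.

(** The change of variables [h = x - y] between the symmetric form of the
    fractional modular and the form with increments. *)
Lemma frac_modularE v : measurable_fun setT v ->
  frac_modular s A v = (\int[mu]_h \int[mu]_x
    (A (`|v (x + h)%R - v x| / enorm h `^ s) / enorm h ^+ n)%:E)%E.
Proof.
move=> mv; pose F (z : rV * rV) :=
  (A (`|v z.1 - v z.2| / enorm (z.1 - z.2) `^ s) / enorm (z.1 - z.2) ^+ n)%:E.
have FE z : F z = (frac_integrand v (z.1 - z.2, z.2))%:E.
  by rewrite /F /frac_integrand/= subrKC.
have mF : measurable_fun setT F.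
  rewrite (_ : F = EFin \o (frac_integrand v \o fun z => (z.1 - z.2, z.2))).
    apply/measurable_EFinP/measurableT_comp; first exact: measurable_frac_integrand.
    apply: measurable_fun_pair; last exact: measurable_snd.
    by apply: measurable_rV_sub; [exact: measurable_fst|exact: measurable_snd].
  by apply/funext => z; rewrite FE.
have F0 z : (0 <= F z)%E by rewrite FE lee_fin frac_integrand_ge0.
transitivity (\int[mu]_y \int[mu]_x F (x, y))%E; first exact: fubini_tonelli2.
have mfi : measurable_fun setT (EFin \o frac_integrand v).
  by apply/measurable_EFinP; exact: measurable_frac_integrand.
transitivity (\int[mu]_y \int[mu]_h (frac_integrand v (h, y))%:E)%E; last first.
  apply/esym; apply: (fubini_tonelli (EFin \o frac_integrand v)) => // z.
  by rewrite lee_fin frac_integrand_ge0.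
apply: eq_integral => y _.
rewrite -(ge0_integral_rV_translate y (f := fun x => F (x, y)))//.
  by apply: eq_integral => h _; rewrite -/(F (h + y, y)) FE/= addrK.
exact: (measurableT_comp mF (pair2_measurable y)).
Qed.

(** With [M = 2 * L1norm G + K], the far and near parts carry the weights
    [2 * L1norm G / M] and [K / M], which add up to 1, and the radial integrals
    [2 n omega / s] and [2 n omega / (s' - s)], both at most
    [2 n omega / (s (s' - s))]. *)
Lemma frac_modular_le : (frac_modular s A u <=
  (2 * n%:R * omega / s / (s' - s))%:E * I)%E.
Proof.
have mb : measurable (ball 1) by exact: measurable_enorm_ball.
have d0 : 0 < s' - s by rewrite subr_gt0.
have s1 : s <= 1 by rewrite (le_trans (ltW ss'))// ltW.
have d1 : s' - s <= 1 by rewrite lerBlDr (le_trans (ltW s'_lt1))// lerDl ltW.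
have n1 : 1 <= n%:R :> R by rewrite ler1n.
have fi0 h x : (0 <= (frac_integrand u (h, x))%:E)%E.
  by rewrite lee_fin frac_integrand_ge0.
have mfi : measurable_fun setT (EFin \o frac_integrand u).
  by apply/measurable_EFinP; exact: measurable_frac_integrand.
have mJ : measurable_fun setT (fun h => \int[mu]_x (frac_integrand u (h, x))%:E)%E.
  by apply: (measurable_fun_fubini_tonelli_F (EFin \o frac_integrand u)) => // -[].
have J0 h : (0 <= \int[mu]_x (frac_integrand u (h, x))%:E)%E.
  exact: integral_ge0.
have mpow (a : R) : measurable_fun setT (fun h : rV => (enorm h `^ a / enorm h ^+ n)%:E).
  have me := measurable_enorm (@measurable_id _ 'rV[R]_n setT).
  apply/measurable_EFinP/measurable_funM.
    by apply: (measurableT_comp (f := fun x : R => x `^ a)) => //; exact: measurable_powR.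
  apply: measurable_ge0_inv => [|x]; first exact: measurable_funX.
  by rewrite exprn_ge0// enorm_ge0.
have pow0 (a : R) (h : rV) : (0 <= (enorm h `^ a / enorm h ^+ n)%:E)%E.
  by rewrite lee_fin divr_ge0 ?powR_ge0// exprn_ge0// enorm_ge0.
have KM0 : (0 <= (K / M)%:E)%E by rewrite lee_fin divr_ge0 ?ltW.
have GM0 : (0 <= (2 * L1norm G / M)%:E)%E.
  by rewrite lee_fin divr_ge0 ?mulr_ge0 ?ltW.
have -> : (frac_modular s A u =
    \int[mu]_(h in ball 1%R) \int[mu]_x (frac_integrand u (h, x))%:E +
    \int[mu]_(h in ~` ball 1%R) \int[mu]_x (frac_integrand u (h, x))%:E)%E.
  rewrite frac_modularE// -ge0_integral_setU ?setUv//; first exact: measurableC.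
  by rewrite disj_set2E setICr.
apply: (@le_trans _ _ ((2 * n%:R * omega / (s' - s))%:E * ((K / M)%:E * I) +
   (2 * n%:R * omega / s)%:E * ((2 * L1norm G / M)%:E * I))%E).
  apply: leeD.
    apply: (@le_trans _ _ (\int[mu]_(h in ball 1%R)
      ((enorm h `^ (s' - s) / enorm h ^+ n)%:E * ((K / M)%:E * I)))%E).
      apply: ge0_le_integral => //.
      - exact: measurable_funTS.
      - by apply: measurable_funTS; apply: emeasurable_funM.
      - move=> h /= h1; have [->|hN0] := eqVneq h 0; last first.
          by apply: diff_quotient_near => //; rewrite enorm_gt0.
        rewrite [leLHS](_ : _ = 0%E); first by rewrite !mule_ge0.
        apply: integral0_eq => x _.
        by rewrite /frac_integrand/= addr0 subrr normr0 mul0r (young_at0 YA) mul0r.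
    rewrite ge0_integralZr//; last 2 first.
    - exact: measurable_funTS.
    - by rewrite mule_ge0.
    apply: lee_wpmul2r; first by rewrite mule_ge0.
    apply: ge0_integral_enorm_powR_in => //.
    exact: le_trans n1.
  apply: (@le_trans _ _ (\int[mu]_(h in ~` ball 1%R)
    ((enorm h `^ (- s) / enorm h ^+ n)%:E * ((2 * L1norm G / M)%:E * I)))%E).
    apply: ge0_le_integral => //.
    - exact: measurableC.
    - exact: measurable_funTS.
    - by apply: measurable_funTS; apply: emeasurable_funM.
    - by move=> h /= /negP; rewrite -leNgt; exact: diff_quotient_far.
  rewrite ge0_integralZr//; last 3 first.
  - exact: measurableC.
  - exact: measurable_funTS.
  - by rewrite mule_ge0.
  apply: lee_wpmul2r; first by rewrite mule_ge0.
  apply: ge0_integral_enorm_powR_out => //.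
  exact: le_trans n1.
have o0 := unit_ball_volume_ge0 (R := R) n.
have no0 : 0 <= 2 * n%:R * omega by rewrite !mulr_ge0.
rewrite !muleA -!EFinM -ge0_muleDl ?lee_fin ?mulr_ge0 ?divr_ge0 ?invr_ge0 ?mulr_ge0
  ?(ltW s_gt0) ?(ltW d0) ?(ltW K_gt0) ?(ltW M_gt0) ?(ltW G_gt0)//.
rewrite lee_wpmul2r// lee_fin.
have -> : 2 * n%:R * omega / (s' - s) * (K / M) + 2 * n%:R * omega / s * (2 * L1norm G / M) =
  2 * n%:R * omega / s / (s' - s) * ((s * K + (s' - s) * (2 * L1norm G)) / M).
  by field; rewrite !gt_eqF.
rewrite ler_piMr ?divr_ge0 ?(ltW s_gt0) ?(ltW d0)// ler_pdivrMr// mul1r /M addrC.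
apply: lerD; first by rewrite ler_piMl ?mulr_ge0 ?(ltW G_gt0).
by rewrite ler_piMl ?(ltW K_gt0).
Qed.

End modular_inequality.

(** * The inequality between the norms *)

Section embedding.
Context {R : realType} (n : nat) (A : R -> R).
Hypothesis n_gt0 : (0 < n)%N.
Hypothesis YA : young_function A.
Local Notation mu := (@lebesgue_rV R n).
Local Notation rV := 'rV[R]_n.
Local Notation omega := (unit_ball_volume R n).
Variables (s s' : R) (G : rV -> R) (K : R).
Hypotheses (s_gt0 : 0 < s) (ss' : s < s') (s'_lt1 : s' < 1).
Hypothesis iG : mu.-integrable setT (EFin \o G).
Hypothesis G_gt0 : 0 < L1norm G.
Hypothesis K_gt0 : 0 < K.
Hypothesis holderG : forall h : rV,
  (\int[mu]_x `|G (x + h) - G x|%:E <= (K * enorm h `^ s')%:E)%E.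

Lemma is_convolution_div (f u : rV -> R) (t : R) : measurable_fun setT f ->
  is_convolution G f u ->
  is_convolution G (fun x => f x / t) (fun x => u x / t).
Proof.
move=> mf; apply: filterS => x uE.
have mG : measurable_fun setT G.
  by apply/measurable_EFinP; exact: measurable_int iG.
have mGf : measurable_fun setT (fun y : rV => G (x - y) * f y).
  apply: measurable_funM => //; exact: measurableT_comp (measurable_sub_r x).
have iGf : mu.-integrable setT (fun y : rV => (G (x - y) * f y)%:E).
  by apply: integral_fin_integrable => //; rewrite -uE.
rewrite mulrC EFinM uE -integralZl//.
by apply: eq_integral => y _; rewrite -EFinM mulrC mulrA.
Qed.

Let C0 := 2 * n%:R * omega / s / (s' - s).

Let C0_ge0 : 0 <= C0.
Proof.
have o0 := unit_ball_volume_ge0 (R := R) n.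
have d0 : 0 <= s' - s by rewrite subr_ge0 ltW.
by rewrite /C0 !divr_ge0 ?mulr_ge0 ?(ltW s_gt0).
Qed.

Let M := 2 * L1norm G + K.

(** Dividing [f] by this number makes the modular inequality a contraction:
    [A] is applied to at most [|f| / (1 + C0)], and convexity turns this into
    a factor [1 / (1 + C0)] that absorbs the constants of both terms. *)
Definition embedding_constant := (1 + C0) * (M + L1norm G).
Local Notation lam := embedding_constant.

Let M_gt0 : 0 < M. Proof. by rewrite /M addr_gt0// mulr_gt0. Qed.

Lemma embedding_constant_gt0 : 0 < lam.
Proof. by apply: mulr_gt0; rewrite ltr_pwDl// ltW. Qed.

Let lam_gt0 := embedding_constant_gt0.


Let scaled_modular_le (f : rV -> R) (m : R) : measurable_fun setT f ->
  0 <= m <= M + L1norm G ->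
  (\int[mu]_x (A (m * `|f x / lam|))%:E <=
    ((1 + C0)^-1)%:E * \int[mu]_x (A `|f x|)%:E)%E.
Proof.
move=> mf /andP[m0 mM].
have k0 : 0 < 1 + C0 by rewrite ltr_pwDl.
have mAf : measurable_fun setT (fun x => A `|f x|).
  by apply: measurable_young => //; exact: measurableT_comp.
have t01 : 0 <= m / lam <= (1 + C0)^-1.
  rewrite divr_ge0//= ?(ltW lam_gt0)// ler_pdivrMr// mulrA.
  by rewrite mulVf ?mul1r// gt_eqF.
rewrite -ge0_integralM// ?invr_ge0 ?(ltW k0)//; last first.
  by move=> x; exact: (young_ge0 YA).
have kV1 : (1 + C0)^-1 <= 1 by rewrite invf_le1// lerDl.
apply: ge0_le_integral => [//|x _|||x _].
- by rewrite lee_fin (young_ge0 YA)// mulr_ge0.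
- apply/measurable_EFinP/(measurable_young YA) => [|x]; last by rewrite mulr_ge0.
  apply: measurable_funM => //; apply: measurableT_comp => //.
  exact: measurable_funM.
- by apply/measurable_EFinP; exact: measurable_funM.
rewrite lee_fin normrM (gtr0_norm (x := lam^-1)) ?invr_gt0// mulrA mulrAC.
have /andP[t0 t1] := t01.
apply: le_trans (young_scale YA _ _) _ => //.
  by rewrite t0 (le_trans t1).
by rewrite ler_wpM2r// (young_ge0 YA).
Qed.

Lemma total_modular_le (f u : rV -> R) (l : R) :
  measurable_fun setT f -> measurable_fun setT u -> 0 < l ->
  is_convolution G f u ->
  (modular A (fun x => (u x / (lam * l))%R) +
   frac_modular s A (fun x => (u x / (lam * l))%R) <=
   modular A (fun x => (f x / l)%R))%E.
Proof.
move=> mf meas_u l0 fGu.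
have mfl t : measurable_fun setT (fun x => f x / t) by exact: measurable_funM.
have mul t : measurable_fun setT (fun x => u x / t) by exact: measurable_funM.
have cv := is_convolution_div (lam * l) mf fGu.
have k0 : 0 < 1 + C0 by rewrite ltr_pwDl.
have fE x : f x / (lam * l) = f x / l / lam by rewrite invfM mulrA mulrAC.
have Phi0 : (0 <= modular A (fun x => (f x / l)%R))%E.
  by apply: integral_ge0 => x _; rewrite lee_fin (young_ge0 YA).
have H1 := modular_le YA iG G_gt0 (mfl _) (mul _) cv.
have H2 := frac_modular_le n_gt0 YA s_gt0 ss' s'_lt1 iG G_gt0 (mfl _) (mul _) cv K_gt0 holderG.
have B m : 0 <= m <= M + L1norm G -> (\int[mu]_x (A (m * `|f x / (lam * l)|))%:E <=
    ((1 + C0)^-1)%:E * modular A (fun x => (f x / l)%R))%E.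
  by move=> mM; under eq_integral do rewrite fE; exact: scaled_modular_le.
apply: le_trans (leeD H1 H2) _.
apply: (@le_trans _ _ (((1 + C0)^-1)%:E * modular A (fun x => (f x / l)%R) +
   C0%:E * (((1 + C0)^-1)%:E * modular A (fun x => (f x / l)%R)))%E).
  apply: leeD; first by apply: B; rewrite lerDr (ltW G_gt0) (ltW M_gt0).
  apply: lee_wpmul2l; first by rewrite lee_fin.
  by apply: B; rewrite lerDl (ltW G_gt0) (ltW M_gt0).
rewrite muleA -EFinM -ge0_muleDl ?lee_fin ?(mulr_ge0 C0_ge0) ?invr_ge0 ?(ltW k0)//.
rewrite -EFinD (_ : (1 + C0)^-1 + C0 * (1 + C0)^-1 = 1) ?mul1e//.
by rewrite -[X in X + _]mul1r -mulrDl mulfV// gt_eqF.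
Qed.

Lemma frac_sobolev_norm_le (u : rV -> R) : in_orlicz A u ->
  (exists2 f, in_orlicz A f & is_convolution G f u) ->
  in_frac_sobolev s A u /\
  (frac_sobolev_norm s A u <= (2 * lam)%:E * ereal_inf [set orlicz_norm A f | f in
    [set f | in_orlicz A f /\ is_convolution G f u]])%E.
Proof.
move=> [meas_u _] [f0 [mf0 [l0 l0_gt0 fl0]] fGu0]; split.
  split => //; exists (lam * l0); first by rewrite mulr_gt0.
  exact: le_lt_trans (total_modular_le mf0 meas_u l0_gt0 fGu0) fl0.
have l2 : 0 < 2 * lam by rewrite mulr_gt0.
rewrite -lee_pdivrMl//; apply: le_ereal_inf_tmp => _ [f [[mf _] fGu] <-].
apply: le_ereal_inf_tmp => _ [l [l_gt0 fl] <-].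
rewrite lee_pdivrMl// -EFinM.
have H := le_trans (total_modular_le mf meas_u l_gt0 fGu) fl.
have ll0 : 0 < lam * l by rewrite mulr_gt0.
have H1 : (orlicz_norm A u <= (lam * l)%:E)%E.
  apply: ereal_inf_lbound; exists (lam * l) => //; split => //.
  apply: le_trans H; rewrite leeDl//.
  apply: integral_ge0 => x _; rewrite lee_fin divr_ge0 ?exprn_ge0 ?enorm_ge0//.
  by rewrite (young_ge0 YA)// divr_ge0// powR_ge0.
have H2 : (frac_seminorm s A u <= (lam * l)%:E)%E.
  apply: ereal_inf_lbound; exists (lam * l) => //; split => //.
  apply: le_trans H; rewrite leeDr//.
  by apply: integral_ge0 => x _; rewrite lee_fin (young_ge0 YA).
apply: le_trans (leeD H1 H2) _.
rewrite -EFinD lee_fin le_eqVlt; apply/orP; left; apply/eqP; ring.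
Qed.

End embedding.

(** * Fourier transform of Gaussians on the line *)

Section gauss_density.
Context {R : realType}.
Local Notation leb := (@lebesgue_measure R).
Variable c : R.
Hypothesis c_gt0 : 0 < c.

Definition gauss (x : R) := expR (- (c * x ^+ 2)).

Lemma gauss_gt0 x : 0 < gauss x. Proof. exact: expR_gt0. Qed.

Lemma continuous_gauss : continuous gauss.
Proof.
move=> x; apply: (@continuous_comp _ _ _ (fun x : R => - (c * x ^+ 2)) expR).
  apply: cvgN; apply: cvgM; first exact: cvg_cst.
  exact: exprn_continuous.
exact: continuous_expR.
Qed.

Lemma measurable_gauss : measurable_fun setT gauss.
Proof. by apply: continuous_measurable_fun; exact: continuous_gauss. Qed.

Lemma integral_gauss : (\int[leb]_x (gauss x)%:E)%E = (Num.sqrt (pi / c))%:E.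
Proof.
have sc0 : 0 < Num.sqrt c by rewrite sqrtr_gt0.
have := @integralT_gauss R.
rewrite (ge0_integral_affine 0 (lt0r_neq0 sc0)); last 2 first.
- by apply/measurable_EFinP; exact: measurable_gauss_fun.
- by move=> x; rewrite lee_fin gauss_fun_ge0.
under eq_integral => x _.
  rewrite (_ : gauss_fun _ = gauss x); last first.
    by rewrite /gauss_fun addr0 exprMn sqr_sqrtr// ltW.
  over.
rewrite gtr0_norm// => /(congr1 (fun z => (Num.sqrt c)^-1%:E * z)%E).
rewrite muleA -EFinM mulVf ?gt_eqF// mul1e => ->.
by rewrite -EFinM sqrtrM ?pi_ge0// sqrtrV ?(ltW c_gt0)// mulrC.
Qed.

Lemma integrable_gauss : leb.-integrable setT (EFin \o gauss).
Proof.
apply/integrableP; split; first by apply/measurable_EFinP; exact: measurable_gauss.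
under eq_integral => x _ do rewrite /= ger0_norm ?(ltW (gauss_gt0 _))//.
by rewrite integral_gauss ltry.
Qed.

End gauss_density.

Section gauss_fourier.
Context {R : realType}.
Local Notation leb := (@lebesgue_measure R).
Variable c : R.
Hypothesis c_gt0 : 0 < c.
Local Notation g := (gauss c).

(** Half of the Gaussian decay absorbs the factor [|x|], since
    [|x| <= c^-1 + c x^2 / 4] and [1 + c x^2 / 2 <= exp (c x^2 / 2)]. *)
Lemma normr_gauss_le (x : R) : `|x| * g x <= (c^-1 + 1) * gauss (c / 2) x.
Proof.
have -> : g x = gauss (c / 2) x * gauss (c / 2) x.
  by rewrite /gauss -expRD; congr expR; field.
rewrite mulrA ler_wpM2r ?(ltW (gauss_gt0 _ _))//.
rewrite /gauss expRN ler_pdivrMr ?expR_gt0//.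
have e1 := expR_ge1Dx (c / 2 * x ^+ 2).
have k0 : 0 < c^-1 by rewrite invr_gt0.
apply: le_trans (ler_wpM2l _ e1); last by lra.
have : `|x| <= c^-1 + c * x ^+ 2 / 4.
  rewrite -subr_ge0 -(pmulr_rge0 _ c_gt0).
  have -> : c * (c^-1 + c * x ^+ 2 / 4 - `|x|) = (c * `|x| / 2 - 1) ^+ 2.
    by rewrite -(real_normK (num_real x)); field; rewrite gt_eqF.
  exact: sqr_ge0.
have := mulr_ge0 (ltW c_gt0) (sqr_ge0 x).
have -> : (c^-1 + 1) * (1 + c / 2 * x ^+ 2) = c^-1 + 1 + x ^+ 2 / 2 + c * x ^+ 2 / 2.
  by field; rewrite gt_eqF.
have := sqr_ge0 x; lra.
Qed.

Lemma integrable_gauss_mul (h : R -> R) (k : R) : measurable_fun setT h ->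
  (forall x, `|h x| <= k) -> leb.-integrable setT (fun x => (g x * h x)%:E).
Proof.
move=> mh hk; have k0 : 0 <= k by exact: le_trans (hk 0).
have ig : leb.-integrable setT (fun x => k%:E * (g x)%:E)%E.
  by apply: integrableZl => //; exact: integrable_gauss.
apply: le_integrable ig => //.
- by apply/measurable_EFinP/measurable_funM => //; exact: measurable_gauss.
- move=> x _; rewrite -EFinM !abse_EFin lee_fin !normrM mulrC ler_wpM2r//.
  by rewrite (ger0_norm k0).
Qed.

Lemma integrable_id_gauss_mul (h : R -> R) : measurable_fun setT h ->
  (forall x, `|h x| <= 1) -> leb.-integrable setT (fun x => (x * g x * h x)%:E).
Proof.
move=> mh hk.
have k0 : 0 <= c^-1 + 1 by rewrite addr_ge0// invr_ge0 ltW.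
have ig : leb.-integrable setT (fun x => (c^-1 + 1)%:E * (gauss (c / 2) x)%:E)%E.
  by apply: integrableZl => //; apply: integrable_gauss; rewrite divr_gt0.
apply: le_integrable ig => //.
- apply/measurable_EFinP/measurable_funM => //; apply: measurable_funM => //.
  exact: measurable_gauss.
- move=> x _; rewrite -EFinM !abse_EFin lee_fin !normrM.
  rewrite (ger0_norm k0) !(ger0_norm (ltW (gauss_gt0 _ _))).
  apply: le_trans (normr_gauss_le x).
  by rewrite ler_piMr// mulr_ge0// ltW// gauss_gt0.
Qed.

Let measurable_cosM (xi : R) : measurable_fun setT (fun x : R => cos (x * xi)).
Proof.
apply: (measurableT_comp (f := @cos R)); last exact: measurable_funM.
exact: continuous_measurable_fun (@continuous_cos R).
Qed.

Let measurable_sinM (xi : R) : measurable_fun setT (fun x : R => sin (x * xi)).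
Proof.
apply: (measurableT_comp (f := @sin R)); last exact: measurable_funM.
exact: continuous_measurable_fun (@continuous_sin R).
Qed.

Let dphi (xi x : R) := xi * (g x * cos (x * xi)) - 2 * c * (x * g x * sin (x * xi)).

Let is_derive_phi (xi x : R) :
  is_derive x 1 (fun x => g x * sin (x * xi)) (dphi xi x).
Proof.
by apply: trigger_derive; rewrite /GRing.scale/= /dphi /gauss; ring.
Qed.

Let continuous_dphi xi : continuous (dphi xi).
Proof.
have cM : continuous (fun x : R => x * xi).
  by move=> x; apply: cvgM; [exact: cvg_id|exact: cvg_cst].
have cg := @continuous_gauss R c.
have cc : continuous (fun x : R => cos (x * xi)).
  move=> x; apply: (@continuous_comp _ _ _ (fun x : R => x * xi) cos); first exact: cM.
  exact: continuous_cos.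
have cs : continuous (fun x : R => sin (x * xi)).
  move=> x; apply: (@continuous_comp _ _ _ (fun x : R => x * xi) sin); first exact: cM.
  exact: continuous_sin.
move=> x; apply: cvgB.
  by apply: cvgM; [exact: cvg_cst|apply: cvgM; [exact: cg|exact: cc]].
apply: cvgM; first exact: cvg_cst.
by apply: cvgM; [apply: cvgM; [exact: cvg_id|exact: cg]|exact: cs].
Qed.

Let integrable_dphi xi : leb.-integrable setT (EFin \o dphi xi).
Proof.
have i1 := integrable_gauss_mul (measurable_cosM xi) (fun x => cos_max (x * xi)).
have i2 := integrable_id_gauss_mul (measurable_sinM xi) (fun x => sin_max (x * xi)).
rewrite (_ : EFin \o _ = (fun x => xi%:E * (g x * cos (x * xi))%:E) \-
  (fun x => (2 * c)%:E * (x * g x * sin (x * xi))%:E))%E.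
  by apply: integrableB => //; exact: integrableZl.
by apply/funext => x.
Qed.

(** [dphi xi] is the derivative of [g x * sin (x * xi)], which vanishes at
    infinity.  The next lemma reads this identity as an integration by
    parts. *)
Let integral_dphi xi : (\int[leb]_x (dphi xi x)%:E)%E = 0.
Proof.
pose phi x := g x * sin (x * xi).
pose D n : set R := `[- n.+1%:R, n.+1%:R]%classic.
have mD n : measurable (D n) by exact: measurable_itv.
have mdphi : measurable_fun setT (dphi xi).
  exact: continuous_measurable_fun (@continuous_dphi xi).
have H1 : (\int[leb]_x ((dphi xi \_ (D n)) x)%:E)%E @[n --> \oo] -->
    (\int[leb]_x (dphi xi x)%:E)%E.
  apply: (@dominated_cvg _ _ _ leb setT measurableT
    (fun n x => ((dphi xi \_ (D n)) x)%:E) _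
    (fun x => `|dphi xi x|%:E)) => //.
  - move=> n; apply/measurable_EFinP.
    exact: (measurable_restrictT (dphi xi) (mD n)).1 (measurable_funTS mdphi).
  - move=> x _; apply: cvg_near_cst; near=> n.
    rewrite patchE ifT// inE/= /D/= in_itv/= -ler_norml.
    by near: n; exists (Num.truncn `|x|) => // m /= xm;
       rewrite (le_trans (ltW (truncnS_gt _)))// ler_nat ltnS.
  - rewrite (_ : (fun x => _) = abse \o (EFin \o dphi xi)); first exact: integrable_abse.
    by apply/funext => x.
  - move=> n x _; rewrite abse_EFin lee_fin patchE.
    by case: ifP => //; rewrite normr0.
have H2 : (\int[leb]_x ((dphi xi \_ (D n)) x)%:E)%E @[n --> \oo] -->
    0%:E.
  have E n : (\int[leb]_x ((dphi xi \_ (D n)) x)%:E)%E =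
      (phi n.+1%:R - phi (- n.+1%:R))%:E.
    transitivity (\int[leb]_x ((EFin \o dphi xi) \_ (D n)) x)%E.
      by apply: eq_integral => x _; rewrite restrict_EFin.
    rewrite -integral_mkcond (@continuous_FTC2 _ _ phi)//.
    - by rewrite -subr_gt0 opprK addr_gt0.
    - by apply: continuous_subspaceT; exact: continuous_dphi.
    - have cphi : continuous phi.
        by move=> x; apply/differentiable_continuous/derivable1_diffP; exact: ex_derive.
      split.
      + by move=> x _; exact: ex_derive.
      + exact/cvg_at_right_filter/cphi.
      + exact/cvg_at_left_filter/cphi.
    - by move=> x _; rewrite derive1E; have [_ ->] := is_derive_phi xi x.
  under eq_fun do rewrite E.
  apply: cvg_EFin; first exact: nearW.
  apply: norm_cvg0.
  have z1 : `|expR (- c)| < 1.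
    by rewrite ger0_norm ?expR_ge0// expR_lt1 oppr_lt0.
  apply: (@squeeze_cvgr _ _ _ _ (cst 0) (fun n => 2 * expR (- c) ^+ n)).
  - apply: nearW => n /=; rewrite normr_ge0/=.
    have phile (x : R) : n%:R <= x ^+ 2 -> `|phi x| <= expR (- c) ^+ n.
      move=> nx; rewrite normrM ger0_norm ?(ltW (gauss_gt0 _ _))//.
      apply: (@le_trans _ _ (g x)); first by rewrite ler_piMr ?sin_max// ltW// gauss_gt0.
      rewrite /gauss -expRM_natl ler_expR mulrN lerN2 mulrC ler_wpM2l ?(ltW c_gt0)//.
    have nn : n%:R <= n.+1%:R ^+ 2 :> R.
      rewrite -natrX ler_nat; apply: (@leq_trans n.+1) => //.
      by rewrite -mulnn leq_pmull.
    apply: le_trans (ler_normB _ _) _; rewrite mulr2n mulrDl !mul1r.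
    by apply: lerD; apply: phile; rewrite ?sqrrN.
  - exact: cvg_cst.
  - rewrite -(mulr0 2); apply: cvgM; first exact: cvg_cst.
    exact: cvg_expr.
exact: (cvg_unique _ H1 H2).
Unshelve. all: by end_near. Qed.

Let F xi := (\int[leb]_x (g x * cos (x * xi)))%R.

Let int_cos xi : leb.-integrable setT (EFin \o (fun x => g x * cos (x * xi))).
Proof. exact: (integrable_gauss_mul (measurable_cosM xi) (fun x => cos_max (x * xi))). Qed.

Let int_sin xi : leb.-integrable setT (EFin \o (fun x => x * g x * sin (x * xi))).
Proof. exact: (integrable_id_gauss_mul (measurable_sinM xi) (fun x => sin_max (x * xi))). Qed.

Let by_parts xi :
  (\int[leb]_x (x * g x * sin (x * xi)))%R = xi / (2 * c) * F xi.
Proof.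
have := integral_dphi xi.
rewrite (_ : (fun x => _) = (fun x => xi%:E * (g x * cos (x * xi))%:E) \-
  (fun x => (2 * c)%:E * (x * g x * sin (x * xi))%:E))%E; last by apply/funext.
rewrite integralB//; last 2 first.
- by apply: integrableZl => //; exact: int_cos.
- by apply: integrableZl => //; exact: int_sin.
rewrite integralZl//; last exact: int_cos.
rewrite integralZl//; last exact: int_sin.
have E1 := fineK (integrable_fin_num measurableT (int_cos xi)).
have E2 := fineK (integrable_fin_num measurableT (int_sin xi)).
rewrite -E1 -E2 -!EFinM -EFinB => -[].
rewrite -/(Rintegral _ _ _) -/(Rintegral _ _ _) -/(F xi) => /eqP.
rewrite subr_eq0 => /eqP H.
by rewrite mulrAC H mulrAC mulfV ?mul1r// mulf_neq0// gt_eqF.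
Qed.

(** The transform [F] solves [F' = - xi / (2 c) F]: differentiate under the
    integral sign, then integrate by parts. *)
Let derive_F (xi : R) : is_derive xi 1 F (- (xi / (2 * c) * F xi)).
Proof.
pose f (z x : R) := g x * cos (x * z).
have df (z y : R) : is_derive z 1 (fun t : R => f t y) (- (y * g y * sin (y * z))).
  by apply: trigger_derive; rewrite /GRing.scale/=; ring.
pose k := c^-1 + 1.
have k0 : 0 <= k by rewrite addr_ge0// invr_ge0 ltW.
pose G y := k * gauss (c / 2) y.
have xi_in : `]xi - 1, xi + 1[%classic xi by rewrite /= in_itv/=; lra.
have intf z : `]xi - 1, xi + 1[%classic z -> leb.-integrable setT (EFin \o f z).
  by move=> _; exact: int_cos.
have dd z y : `]xi - 1, xi + 1[%classic z -> setT y -> derivable (f ^~ y) z 1.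
  by move=> _ _; have [] := df z y.
have G0 y : 0 <= G y by rewrite mulr_ge0// ltW// gauss_gt0.
have iG : leb.-integrable setT (EFin \o G).
  rewrite (_ : EFin \o G = (fun x => k%:E * (gauss (c / 2) x)%:E)%E); last by apply/funext.
  by apply: integrableZl => //; apply: integrable_gauss; rewrite divr_gt0.
have Gub z y : `]xi - 1, xi + 1[%classic z -> setT y -> `|partial1of2 f z y| <= G y.
  move=> _ _; rewrite /partial1of2 derive1E; have [_ ->] := df z y.
  rewrite normrN !normrM (ger0_norm (ltW (gauss_gt0 _ _))).
  apply: le_trans (normr_gauss_le y).
  by rewrite ler_piMr ?sin_max// mulr_ge0// ltW// gauss_gt0.
have dF := derivable_under_integral measurableT xi_in intf dd G0 iG Gub.
have := differentiation_under_integral measurableT xi_in intf dd G0 iG Gub.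
rewrite derive1E => D; apply: DeriveDef => //; rewrite D -by_parts.
rewrite -[RHS]mulN1r -(RintegralZl (-1) measurableT (int_sin xi)).
apply: eq_Rintegral => y _.
by rewrite mulN1r /partial1of2 derive1E; have [_ ->] := df xi y.
Qed.

(** By the differential equation, [F xi * exp (xi^2 / (4 c))] is constant. *)
Lemma integral_gauss_cos xi : (\int[leb]_x (g x * cos (x * xi))%:E =
  (Num.sqrt (pi / c) * expR (- (xi ^+ 2 / (4 * c))))%:E)%E.
Proof.
have FE : F xi = Num.sqrt (pi / c) * expR (- (xi ^+ 2 / (4 * c))).
  pose H z := F z * expR (z ^+ 2 / (4 * c)).
  have dH (z : R) : is_derive z 1 H 0.
    have dFz := derive_F z.
    apply: trigger_derive; rewrite /GRing.scale/= mulr0; field.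
    by rewrite gt_eqF.
  have := is_derive_0_is_cst xi 0 dH.
  rewrite {2}/H expr0n/= mul0r expR0 mulr1 /H expRN => HE.
  have -> : Num.sqrt (pi / c) = F 0.
    rewrite /F /Rintegral; under eq_integral do rewrite mulr0 cos0 mulr1.
    by rewrite integral_gauss.
  by rewrite -HE mulfK// gt_eqF// expR_gt0.
by rewrite -FE /F /Rintegral fineK//; exact: integrable_fin_num (int_cos xi).
Qed.

Lemma integral_odd_eq0 (h : R -> R) : leb.-integrable setT (EFin \o h) ->
  (forall x, h (- x) = - h x) -> (\int[leb]_x (h x)%:E = 0)%E.
Proof.
move=> ih hN.
have mh := measurable_int _ ih.
have H : (\int[leb]_x (EFin \o h)^\+ x = \int[leb]_x (EFin \o h)^\- x)%E.
  have N1 : (-1 : R) != 0 by rewrite oppr_eq0 oner_eq0.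
  rewrite (ge0_integral_affine 0 N1)//; last exact: measurable_funepos.
  rewrite normrN1 mul1e; apply: eq_integral => x _.
  by rewrite funeposE funenegE /= addr0 mulN1r hN.
rewrite integralE -/(EFin \o h) H subee//.
apply: integrable_neg_fin_num => //.
Qed.

Lemma integral_gauss_sin xi : (\int[leb]_x (g x * sin (x * xi))%:E = 0)%E.
Proof.
apply: (integral_odd_eq0 (h := fun x => g x * sin (x * xi))).
  exact: (integrable_gauss_mul (measurable_sinM xi) (fun x => sin_max (x * xi))).
by move=> x; rewrite /gauss sqrrN mulNr sinN mulrN.
Qed.

Lemma integrable_gauss_cos xi :
  leb.-integrable setT (fun x => (g x * cos (x * xi))%:E).
Proof. exact: int_cos. Qed.

Lemma integrable_gauss_sin xi :
  leb.-integrable setT (fun x => (g x * sin (x * xi))%:E).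
Proof.
exact: (integrable_gauss_mul (measurable_sinM xi) (fun x => sin_max (x * xi))).
Qed.

End gauss_fourier.

(** * Fourier transform of Gaussians in several variables *)

Section gaussn.
Context {R : realType}.
Local Notation leb := (@lebesgue_measure R).
Local Notation mu n := (@lebesgue_rV R n).

Lemma integrable_rVcons n (f : 'rV[R]_n.+1 -> \bar R) :
  (mu n.+1).-integrable setT f ->
  (leb \x mu n)%E.-integrable setT (f \o @rVcons R n).
Proof.
move=> /integrableP[mf fi]; apply/integrableP; split.
  by apply: measurableT_comp => //; exact: measurable_rVcons.
move: fi; rewrite ge0_integral_rVS//; last exact: measurableT_comp.
rewrite fubini_tonelli1//=; apply: measurableT_comp => //.
by apply: measurableT_comp => //; exact: measurable_rVcons.
Qed.

Lemma integral_rVS n (f : 'rV[R]_n.+1 -> \bar R) :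
  (mu n.+1).-integrable setT f ->
  (\int[mu n.+1]_x f x = \int[leb]_t \int[mu n]_y f (rVcons (t, y)))%E.
Proof.
move=> fi; rewrite (integral12_prod_meas1 (integrable_rVcons fi)).
rewrite (integral_pushforward (@measurable_rVcons R n))//.
  exact: measurable_int fi.
exact: integrable_rVcons.
Qed.

Lemma dot_rVcons n (s : R) (y : 'rV[R]_n) (z : 'rV[R]_n.+1) :
  dot (rVcons (s, y)) z = s * rVhead z + dot y (rVtail z).
Proof.
rewrite /dot big_ord_recl rVcons_head; congr (_ + _).
by apply: eq_bigr => i _; rewrite rVcons_lift [in RHS]mxE.
Qed.

Lemma rVhead_rVcons n (s : R) (y : 'rV[R]_n) : rVhead (rVcons (s, y)) = s.
Proof. exact: rVhead_cons. Qed.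

Lemma rVtail_rVcons n (s : R) (y : 'rV[R]_n) : rVtail (rVcons (s, y)) = y.
Proof. exact: rVtail_cons. Qed.

Variable c : R.
Hypothesis c_gt0 : 0 < c.

Definition gaussn n (x : 'rV[R]_n) := expR (- (c * dot x x)).

Lemma gaussn_ge0 n (x : 'rV[R]_n) : 0 <= gaussn x. Proof. exact: expR_ge0. Qed.

Lemma measurable_gaussn d (T : measurableType d) n (f : T -> 'rV[R]_n) :
  measurable_fun setT f -> measurable_fun setT (fun t => gaussn (f t)).
Proof.
move=> mf; apply: (measurableT_comp (f := @expR R)) => //.
by apply: measurable_funN; apply: measurable_funM => //; exact: measurable_dot.
Qed.

Lemma gaussn_rVcons n (s : R) (y : 'rV[R]_n) :
  gaussn (rVcons (s, y)) = gauss c s * gaussn y.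
Proof.
rewrite /gaussn /gauss -expRD dot_rVcons rVhead_rVcons rVtail_rVcons.
by congr expR; ring.
Qed.

Lemma integral_gaussn n :
  (\int[mu n]_x (gaussn x)%:E = (Num.sqrt (pi / c) ^+ n)%:E)%E.
Proof.
have mg m : measurable_fun setT (fun x : 'rV[R]_m => (gaussn x)%:E).
  by apply/measurable_EFinP; exact: measurable_gaussn.
elim: n => [|n IH].
  rewrite ge0_integral_rV0// expr0 /gaussn /dot big_ord0 mulr0 oppr0 expR0//.
rewrite ge0_integral_rVS//; last by move=> x; rewrite lee_fin gaussn_ge0.
transitivity (\int[leb]_s (Num.sqrt (pi / c) ^+ n * gauss c s)%:E)%E.
  apply: eq_integral => s _.
  under eq_integral do rewrite gaussn_rVcons.
  have mgn : measurable_fun setT (@gaussn n) by exact: measurable_gaussn.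
  have := ge0_integralM (mu n) mgn (@gaussn_ge0 n) (ltW (gauss_gt0 c s)).
  by move=> ->; rewrite IH -EFinM mulrC.
have k0 : 0 <= Num.sqrt (pi / c) ^+ n by rewrite exprn_ge0 ?sqrtr_ge0.
have g0 s : 0 <= gauss c s by exact: ltW (gauss_gt0 c s).
have := ge0_integralM leb (measurable_gauss c) g0 k0.
move=> ->.
by rewrite integral_gauss// -EFinM exprSr.
Qed.

Lemma integrable_gaussn n : (mu n).-integrable setT (EFin \o @gaussn n).
Proof.
apply/integrableP; split; first by apply/measurable_EFinP; exact: measurable_gaussn.
under eq_integral => x _ do rewrite /= ger0_norm ?gaussn_ge0//.
by rewrite integral_gaussn ltry.
Qed.

Lemma integrable_gaussn_mul n (h : 'rV[R]_n -> R) (k : R) :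
  measurable_fun setT h -> (forall x, `|h x| <= k) ->
  (mu n).-integrable setT (fun x => (gaussn x * h x)%:E).
Proof.
move=> mh hk; have k0 : 0 <= k by exact: le_trans (hk 0).
have ig : (mu n).-integrable setT (fun x => k%:E * (gaussn x)%:E)%E.
  by apply: integrableZl => //; exact: integrable_gaussn.
apply: le_integrable ig => //.
- by apply/measurable_EFinP/measurable_funM => //; exact: measurable_gaussn.
- move=> x _; rewrite -EFinM !abse_EFin lee_fin !normrM mulrC ler_wpM2r//.
  by rewrite (ger0_norm k0).
Qed.

Lemma measurable_cos_dot d (T : measurableType d) n (f g : T -> 'rV[R]_n) :
  measurable_fun setT f -> measurable_fun setT g ->
  measurable_fun setT (fun t => cos (dot (f t) (g t))).
Proof.
move=> mf mg; apply: (measurableT_comp (f := @cos R)); last exact: measurable_dot.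
exact: continuous_measurable_fun (@continuous_cos R).
Qed.

Lemma measurable_sin_dot d (T : measurableType d) n (f g : T -> 'rV[R]_n) :
  measurable_fun setT f -> measurable_fun setT g ->
  measurable_fun setT (fun t => sin (dot (f t) (g t))).
Proof.
move=> mf mg; apply: (measurableT_comp (f := @sin R)); last exact: measurable_dot.
exact: continuous_measurable_fun (@continuous_sin R).
Qed.

Lemma integrable_gaussn_cos n (xi : 'rV[R]_n) :
  (mu n).-integrable setT (fun x => (gaussn x * cos (dot x xi))%:E).
Proof.
apply: (integrable_gaussn_mul (k := 1)); last by move=> x; exact: cos_max.
exact: measurable_cos_dot.
Qed.

Lemma integrable_gaussn_sin n (xi : 'rV[R]_n) :
  (mu n).-integrable setT (fun x => (gaussn x * sin (dot x xi))%:E).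
Proof.
apply: (integrable_gaussn_mul (k := 1)); last by move=> x; exact: sin_max.
exact: measurable_sin_dot.
Qed.

(** The Gaussian is a product and [dot] is a sum over the coordinates, so the
    addition formulas reduce each dimension to the previous one; they mix
    cosine and sine, hence the simultaneous induction. *)
Lemma integral_gaussn_cos_sin n (xi : 'rV[R]_n) :
  (\int[mu n]_x (gaussn x * cos (dot x xi))%:E =
    (Num.sqrt (pi / c) ^+ n * expR (- (dot xi xi / (4 * c))))%:E)%E /\
  (\int[mu n]_x (gaussn x * sin (dot x xi))%:E = 0)%E.
Proof.
elim: n xi => [|n IH] xi.
  rewrite !ge0_integral_rV0; last 2 first.
  - exact: measurable_int (integrable_gaussn_sin xi).
  - exact: measurable_int (integrable_gaussn_cos xi).
  rewrite /gaussn /dot !big_ord0 cos0 sin0 mulr0 mul0r oppr0 expR0 expr0.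
  by rewrite mulr1 mulr0.
have [IHc IHs] := IH (rVtail xi).
set Q := Num.sqrt (pi / c) ^+ n * _ in IHc.
have ic := integrable_gaussn_cos (rVtail xi).
have isn := integrable_gaussn_sin (rVtail xi).
have dotxi : dot xi xi = rVhead xi ^+ 2 + dot (rVtail xi) (rVtail xi).
  rewrite /dot big_ord_recl expr2; congr (_ + _).
  by apply: eq_bigr => i _; rewrite !mxE.
split.
- rewrite integral_rVS; last exact: integrable_gaussn_cos.
  transitivity (\int[leb]_s (Q * (gauss c s * cos (s * rVhead xi)))%:E)%E.
    apply: eq_integral => s _.
    under eq_integral => y _.
      rewrite gaussn_rVcons dot_rVcons cosD.
      rewrite (_ : (_ * _)%:E = ((gauss c s * cos (s * rVhead xi))%:E *
        (gaussn y * cos (dot y (rVtail xi)))%:E -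
        (gauss c s * sin (s * rVhead xi))%:E *
        (gaussn y * sin (dot y (rVtail xi)))%:E)%E); last first.
        by rewrite -!EFinM -EFinB; congr EFin; ring.
      over.
    rewrite integralB//; [|exact: integrableZl|exact: integrableZl].
    rewrite (integralZl measurableT ic) (integralZl measurableT isn).
    by rewrite IHc IHs mule0 sube0 -EFinM mulrC.
  under eq_integral do rewrite EFinM.
  rewrite integralZl//; last exact: integrable_gauss_cos.
  rewrite integral_gauss_cos// -EFinM; congr EFin.
  have -> : - (dot xi xi / (4 * c)) =
      - (dot (rVtail xi) (rVtail xi) / (4 * c)) + - (rVhead xi ^+ 2 / (4 * c)).
    by rewrite dotxi; field; rewrite gt_eqF.
  by rewrite expRD /Q [_ ^+ n.+1]exprSr; ring.
- rewrite integral_rVS; last exact: integrable_gaussn_sin.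
  transitivity (\int[leb]_s (Q * (gauss c s * sin (s * rVhead xi)))%:E)%E.
    apply: eq_integral => s _.
    under eq_integral => y _.
      rewrite gaussn_rVcons dot_rVcons sinD.
      rewrite (_ : (_ * _)%:E = ((gauss c s * sin (s * rVhead xi))%:E *
        (gaussn y * cos (dot y (rVtail xi)))%:E +
        (gauss c s * cos (s * rVhead xi))%:E *
        (gaussn y * sin (dot y (rVtail xi)))%:E)%E); last first.
        by rewrite -!EFinM -EFinD; congr EFin; ring.
      over.
    rewrite integralD//; [|exact: integrableZl|exact: integrableZl].
    rewrite (integralZl measurableT ic) (integralZl measurableT isn).
    by rewrite IHc IHs mule0 adde0 -EFinM mulrC.
  under eq_integral do rewrite EFinM.
  rewrite integralZl//; last exact: integrable_gauss_sin.
  by rewrite integral_gauss_sin// mule0.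
Qed.

End gaussn.

(** * Orthants determine integrable functions *)

Section density_measure.
Context d (T : measurableType d) {R : realType} (mu : {measure set T -> \bar R}).
Variable f : T -> \bar R.
Hypotheses (mf : measurable_fun setT f) (f0 : forall x, (0 <= f x)%E).

(** The pair keeps the proofs [mf] and [f0] among the parameters, so that the
    measure structure below can be inferred from the term. *)
Definition density_measure (A : set T) : \bar R :=
  let _ := (mf, f0) in (\int[mu]_(x in A) f x)%E.

Let density0 : density_measure set0 = 0%E.
Proof. exact: integral_set0. Qed.

Let density_ge0 A : (0 <= density_measure A)%E.
Proof. exact: integral_ge0. Qed.

Let density_additive : semi_sigma_additive density_measure.
Proof. exact: semi_sigma_additive_nng_induced. Qed.

HB.instance Definition _ := isMeasure.Build _ _ _ density_measure
  density0 density_ge0 density_additive.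

End density_measure.

Section orthants.
Context {R : realType} (n : nat).
Local Notation mu := (@lebesgue_rV R n).
Local Notation rV := 'rV[R]_n.

Definition orthant (a : rV) : set rV := [set x | forall i, a 0 i < x 0 i].

Lemma measurable_orthant a : measurable (orthant a).
Proof.
rewrite (_ : orthant a = \bigcap_(i in [set: 'I_n])
    (fun x : rV => x 0 i) @^-1` `]a 0 i, +oo[%classic).
  apply: fin_bigcap_measurable => [|i _]; first exact: finite_finset.
  by rewrite -[X in measurable X]setTI; exact: measurable_coord.
apply/seteqP; split=> x /= Hx i; first by move=> _; rewrite /= in_itv/= andbT.
by have := Hx i I; rewrite /= in_itv/= andbT.
Qed.

Lemma orthantI a b :
  orthant a `&` orthant b = orthant (\row_i Num.max (a 0 i) (b 0 i)).
Proof.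
apply/seteqP; split => [x [/= xa xb] i|x /= xab].
  by rewrite mxE gt_max xa xb.
by split => i; have := xab i; rewrite mxE gt_max => /andP[].
Qed.

(** A half-space [x i > a] is the union of the orthants with corner [a] in
    direction [i] and [- k] in the other directions. *)
Lemma measurable_orthantE : (@measurable _ rV) = <<s range orthant >>.
Proof.
apply/seteqP; split; last first.
  apply: smallest_sub; first exact: sigma_algebra_measurable.
  by move=> _ [a _ <-]; exact: measurable_orthant.
have sG : sigma_algebra setT (<<s range orthant >>) by exact: smallest_sigma_algebra.
have coordG (i : 'I_n) : measurable_fun
    [set: g_sigma_algebraType (range orthant)] (fun x : rV => x 0 i).
  apply: (measurability (@RGenOInfty.G R) (RGenOInfty.measurableE R)).
  move=> _ [_ [a ->] <-]; rewrite setTI.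
  rewrite (_ : _ @^-1` _ = \bigcup_k orthant (\row_j if j == i then a else - k%:R)).
    apply: sigma_algebra_bigcup => k.
    by apply: sub_sigma_algebra; exists (\row_j if j == i then a else - k%:R).
  apply/seteqP; split => x /=; rewrite in_itv/= andbT; last first.
    by move=> [k _ /(_ i)]; rewrite mxE eqxx.
  move=> ax; exists (\max_(j < n) (Num.truncn `|x 0%R j|).+1)%N => // j.
  rewrite mxE; case: eqP => [->//|_].
  rewrite ltrNl (le_lt_trans (ler_norm _))// normrN.
  rewrite (lt_le_trans (truncnS_gt _))// ler_nat.
  by rewrite (bigD1 j)//= leq_max leqnn.
apply: smallest_sub => //.
apply: (big_ind (fun S => S `<=` <<s range orthant >>)) => [//|S1 S2 S1G S2G|i _].
  by move=> B [/S1G|/S2G].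
by move=> _ [C mC <-]; apply: coordG.
Qed.

(** The positive and negative parts of [f] are densities of two finite measures
    that agree on orthants.  Orthants are stable under intersection and
    generate the Borel sets, so the measures are equal. *)
Lemma integral_orthant_eq0 (f : rV -> R) : mu.-integrable setT (EFin \o f) ->
  (forall a, \int[mu]_(x in orthant a) (f x)%:E = 0)%E ->
  {ae mu, forall x, f x = 0}.
Proof.
move=> fi f0.
have mf := measurable_int _ fi.
have mfp : measurable_fun setT ((EFin \o f)^\+)%E by exact: measurable_funepos.
have mfn : measurable_fun setT ((EFin \o f)^\-)%E by exact: measurable_funeneg.
have fp0 x : (0 <= ((EFin \o f)^\+)%E x)%E by exact: funepos_ge0.
have fn0 x : (0 <= ((EFin \o f)^\-)%E x)%E by exact: funeneg_ge0.
pose m1 : {measure set rV -> \bar R} := density_measure mu mfp fp0.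
pose m2 : {measure set rV -> \bar R} := density_measure mu mfn fn0.
have fin1 A : measurable A -> m1 A \is a fin_num.
  move=> mA; apply: integrable_pos_fin_num => //.
  exact: integrableS fi.
have fin2 A : measurable A -> m2 A \is a fin_num.
  move=> mA; apply: integrable_neg_fin_num => //.
  exact: integrableS fi.
have m12 A : measurable A -> m1 A = m2 A.
  apply: (@measure_unique _ _ _ (range orthant) (fun k => orthant (const_mx (- k%:R)))).
  - exact: measurable_orthantE.
  - by move=> _ _ [a _ <-] [b _ <-]; rewrite orthantI; eexists.
  - by move=> k; eexists.
  - apply/seteqP; split => // x _.
    exists (\max_(j < n) (Num.truncn `|x 0%R j|).+1)%N => // j.
    rewrite mxE ltrNl (le_lt_trans (ler_norm _))// normrN.
    rewrite (lt_le_trans (truncnS_gt _))// ler_nat.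
    by rewrite (bigD1 j)//= leq_max leqnn.
  - move=> _ [a _ <-]; have ma := measurable_orthant a.
    have := f0 a; rewrite integralE => /eqP.
    by rewrite sube_eq ?add0e ?fin_num_adde_defl// ?fin1 ?fin2// => /eqP.
  - by move=> k; rewrite ltey_eq fin1//; exact: measurable_orthant.
have : ae_eq mu setT (EFin \o f) (cst 0%E).
  apply: integral_ae_eq => // E _ mE.
  rewrite integral_cst// mul0e integralE.
  have := m12 _ mE; rewrite /m1 /m2/= /density_measure => ->.
  by rewrite subee//; exact: (fin2 _ mE).
by apply: filterS => x /(_ I) /= [].
Qed.

End orthants.

(** * Uniqueness for the Fourier transform of integrable functions *)

Lemma integrable_prodM d1 d2 (T1 : measurableType d1) (T2 : measurableType d2)
    (R : realType) (m1 : {sigma_finite_measure set T1 -> \bar R})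
    (m2 : {sigma_finite_measure set T2 -> \bar R}) (f : T1 -> R) (g : T2 -> R) :
  m1.-integrable setT (EFin \o f) -> m2.-integrable setT (EFin \o g) ->
  (m1 \x m2)%E.-integrable setT (fun z => (f z.1 * g z.2)%:E).
Proof.
move=> fi gi.
have mf : measurable_fun setT f by apply/measurable_EFinP; exact: measurable_int fi.
have mg : measurable_fun setT g by apply/measurable_EFinP; exact: measurable_int gi.
apply/integrable12ltyP.
  apply/measurable_EFinP; apply: measurable_funM.
    exact: (measurableT_comp mf measurable_fst).
  exact: (measurableT_comp mg measurable_snd).
have ge : (\int[m2]_y `|g y|%:E \is a fin_num)%E.
  rewrite ge0_fin_numE; last by apply: integral_ge0 => y _; rewrite lee_fin.
  by case/integrableP : gi.
have mag : measurable_fun setT (fun y => `|g y|) by exact: measurableT_comp.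
have maf : measurable_fun setT (fun y => `|f y|) by exact: measurableT_comp.
under eq_integral => x _.
  under eq_integral do rewrite /= normrM.
  rewrite (ge0_integralM m2 mag (fun y => normr_ge0 (g y)) (normr_ge0 (f x))).
  rewrite -(fineK ge) -EFinM mulrC.
  over.
have k0 : 0 <= fine (\int[m2]_y `|g y|%:E).
  by rewrite fine_ge0//; apply: integral_ge0 => y _; rewrite lee_fin.
rewrite (ge0_integralM m1 maf (fun y => normr_ge0 (f y)) k0).
rewrite -ge0_fin_numE; last first.
  by rewrite mule_ge0 ?lee_fin//; apply: integral_ge0 => y _; rewrite lee_fin.
rewrite fin_numM// ge0_fin_numE; last first.
  by apply: integral_ge0 => y _; rewrite lee_fin.
by case/integrableP : fi.
Qed.

Section fourier_uniqueness.
Context {R : realType} (n : nat).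
Local Notation mu := (@lebesgue_rV R n).
Local Notation rV := 'rV[R]_n.
Variable F : rV -> R.
Hypothesis iF : mu.-integrable setT (EFin \o F).
Hypothesis F_cos : forall xi, (\int[mu]_x (F x * cos (dot x xi))%:E = 0)%E.
Hypothesis F_sin : forall xi, (\int[mu]_x (F x * sin (dot x xi))%:E = 0)%E.

Let mF : measurable_fun setT F.
Proof. by apply/measurable_EFinP; exact: measurable_int iF. Qed.

Let integrableFM (h : rV -> R) : measurable_fun setT h -> (forall x, `|h x| <= 1) ->
  mu.-integrable setT (fun x => (F x * h x)%:E).
Proof.
move=> mh h1; apply: le_integrable iF => //.
  by apply/measurable_EFinP; exact: measurable_funM.
by move=> x _; rewrite !abse_EFin lee_fin normrM ler_piMr.
Qed.

(** A Gaussian is the Fourier transform of a Gaussian, so integrating [F]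
    against it amounts, by Fubini, to integrating the transform of [F], which
    is 0. *)
Lemma integral_gaussn_translate_eq0 (b : R) (a : rV) : 0 < b ->
  (\int[mu]_x (F x * gaussn b (x - a))%:E = 0)%E.
Proof.
move=> b0; pose c := (4 * b)^-1.
have c0 : 0 < c by rewrite invr_gt0 mulr_gt0.
pose k := Num.sqrt (pi / c) ^+ n.
have k0 : 0 < k by rewrite exprn_gt0// sqrtr_gt0 divr_gt0// pi_gt0.
have gE x : (k * gaussn b (x - a))%:E =
    (\int[mu]_xi (gaussn c xi * cos (dot xi (x - a)))%:E)%E.
  have [-> _] := integral_gaussn_cos_sin c0 (x - a).
  congr (_ * expR (- _))%:E; rewrite /c; field.
  by rewrite gt_eqF.
have mFg : measurable_fun setT (fun x => F x * gaussn b (x - a)).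
  by apply: measurable_funM => //; apply: measurable_gaussn; exact: measurable_sub_l.
pose H (z : rV * rV) := (F z.1 * gaussn c z.2 * cos (dot z.2 (z.1 - a)))%:E.
have m1 := @measurable_fst _ _ rV rV.
have m2 := @measurable_snd _ _ rV rV.
have iFg := integrable_prodM iF (integrable_gaussn c0 n).
have iH : (mu \x mu)%E.-integrable setT H.
  apply: le_integrable iFg => //.
    apply/measurable_EFinP; apply: measurable_funM; last first.
      by apply: measurable_cos_dot => //; exact: measurable_rV_sub.
    apply: measurable_funM; first exact: (measurableT_comp mF m1).
    exact: measurable_gaussn.
  by move=> z _; rewrite !abse_EFin lee_fin [leLHS]normrM ler_piMr// cos_max.
have E1 x : (\int[mu]_xi H (x, xi) = k%:E * (F x * gaussn b (x - a))%:E)%E.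
  rewrite /H/=; under eq_integral do rewrite -mulrA EFinM.
  rewrite integralZl//; last exact: integrable_gaussn_cos.
  by rewrite -gE -!EFinM mulrCA.
have E2 xi : (\int[mu]_x H (x, xi) = 0)%E.
  rewrite /H/=.
  have -> : (\int[mu]_x (F x * gaussn c xi * cos (dot xi (x - a)))%:E =
    \int[mu]_x ((gaussn c xi * cos (dot xi a))%:E * (F x * cos (dot x xi))%:E +
     (gaussn c xi * sin (dot xi a))%:E * (F x * sin (dot x xi))%:E))%E.
    apply: eq_integral => x _; rewrite -!EFinM -EFinD; congr EFin.
    have -> : dot xi (x - a) = dot x xi - dot xi a.
      by rewrite dotDr -scaleN1r dotZr mulN1r (dotC xi x).
    by rewrite cosB; ring.
  rewrite integralD//; last 2 first.
  - apply: integrableZl => //; apply: integrableFM; first exact: measurable_cos_dot.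
    by move=> x; exact: cos_max.
  - apply: integrableZl => //; apply: integrableFM; first exact: measurable_sin_dot.
    by move=> x; exact: sin_max.
  rewrite integralZl//; last first.
    by apply: integrableFM; [exact: measurable_cos_dot|move=> x; exact: cos_max].
  rewrite integralZl//; last first.
    by apply: integrableFM; [exact: measurable_sin_dot|move=> x; exact: sin_max].
  by rewrite F_cos F_sin !mule0 adde0.
have := Fubini iH.
under eq_integral do rewrite E1.
under [RHS]eq_integral do rewrite E2.
rewrite integral0 integralZl//; last first.
  apply: integrableFM; first by apply: measurable_gaussn; exact: measurable_sub_l.
  move=> x; rewrite ger0_norm ?gaussn_ge0// /gaussn -expR0 ler_expR oppr_le0.
  by rewrite mulr_ge0// ?(ltW b0)// dot_ge0.
move=> /eqP; rewrite mule_eq0 => /orP[|/eqP//].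
by rewrite eqe gt_eqF.
Qed.

Let eps (k : nat) : R := k.+1%:R^-1.
Let ones : rV := const_mx 1.
(** The point at which the indicator of an orthant is evaluated when it is
    mollified: a Gaussian perturbation of size [eps k ^+ 2], and a shift
    inwards along the diagonal by the larger amount [eps k].  The shift pushes
    the boundary points out of the open orthant, so the mollified indicators
    converge at every point, not only off the boundary. *)
Let shift k x z : rV := x - eps k *: ones - eps k ^+ 2 *: z.

Let eps_gt0 k : 0 < eps k. Proof. by rewrite invr_gt0. Qed.

Let near_eps (r : R) : \forall k \near \oo, `|r| * eps k < 1.
Proof.
exists (Num.truncn `|r|) => // m /= rm.
rewrite ltr_pdivrMr// mul1r (lt_le_trans (truncnS_gt _))// ler_nat ltnS//.
Qed.

Let orthant_shift a x z :
  \forall k \near \oo, \1_(orthant a) (shift k x z) = \1_(orthant a) x :> R.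
Proof.
have H (i : 'I_n) : \forall k \near \oo, (a 0 i < shift k x z 0 i) = (a 0 i < x 0 i).
  have shE k : shift k x z 0 i = x 0 i - eps k * (1 + eps k * z 0 i).
    by rewrite !mxE; ring.
  case: (ltP (a 0 i) (x 0 i)) => [ax|xa].
  - pose r := (1 + `|z 0 i|) / (x 0 i - a 0 i).
    have d0 : 0 < x 0 i - a 0 i by rewrite subr_gt0.
    have r0 : 0 <= r by apply: divr_ge0; [exact: addr_ge0|exact: ltW].
    near=> k; rewrite shE ltrBrDr -ltrBrDl.
    have ek1 : eps k <= 1 by rewrite invf_le1 ?ler1n.
    apply: (@le_lt_trans _ _ (eps k * (1 + `|z 0 i|))).
      rewrite ler_wpM2l ?(ltW (eps_gt0 k))// lerD2l (le_trans (ler_norm _))//.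
      rewrite normrM ger0_norm ?(ltW (eps_gt0 k))//.
      by rewrite ler_piMl.
    have : `|r| * eps k < 1 by near: k; exact: near_eps.
    by rewrite ger0_norm// /r mulrAC ltr_pdivrMr// mul1r mulrC.
  - near=> k; apply/negbTE; rewrite -leNgt shE lerBlDr (le_trans xa)// lerDl.
    rewrite mulr_ge0 ?(ltW (eps_gt0 k))// -lerBlDl sub0r.
    have /ltW : `|z 0 i| * eps k < 1 by near: k; exact: near_eps.
    move=> ze; rewrite lerNl; apply: le_trans ze.
    rewrite -[X in _ <= _ * X](ger0_norm (ltW (eps_gt0 k))) -normrM.
    by rewrite mulrC -normrN ler_norm.
have {}H := filter_forall _ H.
near=> k; rewrite !indicE; congr ((nat_of_bool _)%:R).
have Hk : forall i, (a 0 i < shift k x z 0 i) = (a 0 i < x 0 i).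
  by near: k; exact: H.
apply/idP/idP; rewrite !inE => Hx i; first by rewrite -Hk; exact: Hx.
by rewrite Hk; exact: Hx.
Unshelve. all: by end_near. Qed.

Let Cg : R := Num.sqrt (pi / 1) ^+ n.

Let Cg_gt0 : 0 < Cg.
Proof. by rewrite exprn_gt0// sqrtr_gt0 divr_gt0// pi_gt0. Qed.

Let moll a k x := (\int[mu]_z (gaussn 1 z * \1_(orthant a) (shift k x z))%:E)%E.

Let measurable_shift k : measurable_fun setT (fun p : rV * rV => shift k p.1 p.2).
Proof.
apply: measurable_rV_sub; first apply: measurable_rV_sub => //.
by apply: measurable_rV_scale.
Qed.

Let measurable_moll_integrand a k : measurable_fun setT (fun p : rV * rV =>
  gaussn 1 p.2 * \1_(orthant a) (shift k p.1 p.2)).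
Proof.
apply: measurable_funM; first exact: measurable_gaussn.
apply: measurableT_comp (measurable_shift k).
by apply: measurable_indic; exact: measurable_orthant.
Qed.

Let indic01 (B : set rV) x : `|\1_B x : R| <= 1.
Proof. by rewrite indicE; case: (_ \in _); rewrite ?normr1 ?normr0. Qed.

Let integrable_moll a k x :
  mu.-integrable setT (fun z => (gaussn 1 z * \1_(orthant a) (shift k x z))%:E).
Proof.
apply: (integrable_gaussn_mul ltr01 (k := 1)) => [|z]; last exact: indic01.
apply: measurableT_comp; first by apply: measurable_indic; exact: measurable_orthant.
exact: (measurableT_comp (measurable_shift k) (pair1_measurable x)).
Qed.

Let moll_ge0 a k x : (0 <= moll a k x)%E.
Proof. by apply: integral_ge0 => z _; rewrite lee_fin mulr_ge0// gaussn_ge0. Qed.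

Let moll_le a k x : (moll a k x <= Cg%:E)%E.
Proof.
rewrite /Cg -(integral_gaussn ltr01 n).
apply: ge0_le_integral => [//|z _|||z _].
- by rewrite lee_fin mulr_ge0// gaussn_ge0.
- exact: measurable_int (integrable_moll a k x).
- by apply/measurable_EFinP; exact: measurable_gaussn.
- by rewrite lee_fin ler_piMr ?gaussn_ge0// (le_trans (ler_norm _)).
Qed.

Let measurable_moll a k : measurable_fun setT (moll a k).
Proof.
apply: (measurable_fun_fubini_tonelli_F (fun p : rV * rV =>
  (gaussn 1 p.2 * \1_(orthant a) (shift k p.1 p.2))%:E)).
  by apply/measurable_EFinP; exact: measurable_moll_integrand.
by move=> p; rewrite lee_fin mulr_ge0// gaussn_ge0.
Qed.

Let moll_cvg a x : moll a k x @[k --> \oo] --> (Cg * \1_(orthant a) x)%:E.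
Proof.
have -> : (Cg * \1_(orthant a) x)%:E =
    (\int[mu]_z (gaussn 1 z * \1_(orthant a) x)%:E)%E.
  under eq_integral do rewrite mulrC EFinM.
  rewrite integralZl//; last exact: integrable_gaussn.
  by rewrite integral_gaussn// -EFinM mulrC.
apply: (@dominated_cvg _ _ _ mu setT measurableT
  (fun k z => (gaussn 1 z * \1_(orthant a) (shift k x z))%:E) _
  (fun z => (gaussn 1 z)%:E)) => //.
- by move=> k; exact: measurable_int (integrable_moll a k x).
- move=> z _; apply: cvg_near_cst; have := orthant_shift a x z.
  by apply: filterS => k ->.
- exact: integrable_gaussn.
- move=> k z _; rewrite abse_EFin lee_fin normrM ger0_norm ?gaussn_ge0//.
  by rewrite ler_piMr ?gaussn_ge0.
Qed.

(** The substitution [y = shift k x z] exhibits the mollified indicator as a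
    superposition of translated Gaussians. *)
Let moll_gaussn a k x : (((eps k ^+ 2) ^+ n)%:E * moll a k x =
  \int[mu]_y (\1_(orthant a) y * gaussn (eps k ^- 4) (x - (y + eps k *: ones))%R)%:E)%E.
Proof.
have e0 : - eps k ^+ 2 != 0 by rewrite oppr_eq0 expf_eq0/= gt_eqF.
have mI : measurable_fun setT (fun y : rV => \1_(orthant a) y : R).
  by apply: measurable_indic; exact: measurable_orthant.
rewrite [RHS](ge0_integral_rV_affine (x - eps k *: ones) e0); last 2 first.
- apply/measurable_EFinP; apply: measurable_funM => //.
  by apply: measurable_gaussn; apply: measurable_rV_sub => //; exact: measurable_rV_add.
- by move=> y; rewrite lee_fin mulr_ge0// gaussn_ge0.
rewrite normrN ger0_norm ?exprn_ge0 ?(ltW (eps_gt0 k))//; congr *%E.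
apply: eq_integral => z _; rewrite mulrC; congr (_ * _)%:E.
  by rewrite /shift scaleNr addrC.
rewrite /gaussn; congr expR; rewrite mul1r.
have -> : x - (- eps k ^+ 2 *: z + (x - eps k *: ones) + eps k *: ones) = eps k ^+ 2 *: z.
  by rewrite addrA subrK scaleNr opprD opprK addrC -addrA addNr addr0.
rewrite dotZl dotZr; move: (eps_gt0 k); move: (eps k) => e e_gt0.
by field; rewrite gt_eqF.
Qed.

Let integral_F_moll a k : (\int[mu]_x ((F x)%:E * moll a k x) = 0)%E.
Proof.
pose b := eps k ^- 4.
have b0 : 0 < b by rewrite invr_gt0 exprn_gt0.
pose e := (eps k ^+ 2) ^+ n.
have e0 : 0 < e by rewrite !exprn_gt0.
have mI : measurable_fun setT (fun y : rV => \1_(orthant a) y : R).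
  by apply: measurable_indic; exact: measurable_orthant.
pose H (p : rV * rV) := (F p.1 * (\1_(orthant a) p.2 *
  gaussn b (p.1 - (p.2 + eps k *: ones))))%:E.
have m1 := @measurable_fst _ _ rV rV.
have m2 := @measurable_snd _ _ rV rV.
have mG : measurable_fun setT (fun p : rV * rV => \1_(orthant a) p.2 *
  gaussn b (p.1 - (p.2 + eps k *: ones))).
  apply: measurable_funM; first exact: (measurableT_comp mI m2).
  by apply: measurable_gaussn; apply: measurable_rV_sub => //; exact: measurable_rV_add.
have mH : measurable_fun setT H.
  by apply/measurable_EFinP/measurable_funM => //; exact: (measurableT_comp mF m1).
have momE x : (\int[mu]_y (\1_(orthant a) y * gaussn b (x - (y + eps k *: ones)))%:E =
   e%:E * moll a k x)%E by rewrite moll_gaussn.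
have mol_fin x : moll a k x \is a fin_num.
  by rewrite ge0_fin_numE// (le_lt_trans (moll_le a k x))// ltry.
have iG x : mu.-integrable setT (fun y => (\1_(orthant a) y *
    gaussn b (x - (y + eps k *: ones)))%:E).
  have mGx : measurable_fun setT (fun y => (\1_(orthant a) y *
      gaussn b (x - (y + eps k *: ones)))%:E).
    by apply/measurable_EFinP; exact: (measurableT_comp mG (pair1_measurable x)).
  apply/integrableP; split => //.
  under eq_integral do rewrite gee0_abs ?lee_fin ?mulr_ge0 ?gaussn_ge0//.
  by rewrite momE ltey_eq fin_numM.
have iH : (mu \x mu)%E.-integrable setT H.
  apply/integrable12ltyP => //.
  apply: (@le_lt_trans _ _ (\int[mu]_x ((e * Cg)%:E * `|(F x)%:E|))%E).
    apply: ge0_le_integral => [//|x _|||x _].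
    - exact: integral_ge0.
    - apply: (measurable_fun_fubini_tonelli_F (abse \o H)) => [|z].
        exact: measurableT_comp.
      exact: abse_ge0.
    - by apply: measurable_funeM; apply: measurableT_comp => //; apply/measurable_EFinP.
    under eq_integral do rewrite abse_EFin normrM (ger0_norm (x := _ * _)) ?mulr_ge0 ?gaussn_ge0//.
    have G0 y : 0 <= \1_(orthant a) y * gaussn b (x - (y + eps k *: ones)).
      by rewrite mulr_ge0// gaussn_ge0.
    have mGx := measurableT_comp mG (pair1_measurable x).
    have := ge0_integralM mu mGx G0 (normr_ge0 (F x)).
    move=> ->; rewrite momE muleC lee_wpmul2r ?lee_fin//.
    by rewrite EFinM lee_wpmul2l// lee_fin ltW.
  rewrite ge0_integralZl//; last 2 first.
  - by apply: measurableT_comp => //; apply/measurable_EFinP.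
  - by rewrite lee_fin mulr_ge0// ltW.
  rewrite ltey_eq fin_numM// ge0_fin_numE ?integral_ge0//.
  by case/integrableP : iF.
have E1 x : (\int[mu]_y H (x, y) = e%:E * ((F x)%:E * moll a k x))%E.
  rewrite /H/=; under eq_integral do rewrite EFinM.
  by rewrite integralZl// momE muleCA.
have E2 y : (\int[mu]_x H (x, y) = 0)%E.
  rewrite /H/=; under eq_integral do rewrite mulrCA EFinM.
  rewrite integralZl ?integral_gaussn_translate_eq0 ?mule0//.
  apply: integrableFM; first by apply: measurable_gaussn; exact: measurable_sub_l.
  move=> x; rewrite ger0_norm ?gaussn_ge0// /gaussn -expR0 ler_expR oppr_le0.
  by rewrite mulr_ge0// ?(ltW b0)// dot_ge0.
have H1 : (\int[mu]_x \int[mu]_y H (x, y) = \int[mu]_x (e%:E * ((F x)%:E * moll a k x)))%E.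
  by apply: eq_integral => x _; exact: E1.
have H2 : (\int[mu]_y \int[mu]_x H (x, y) = 0)%E.
  by apply: integral0_eq => y _; exact: E2.
have : (\int[mu]_x (e%:E * ((F x)%:E * moll a k x)) = 0)%E.
  by rewrite -H1 -H2; exact: (Fubini iH).
rewrite integralZl//; last first.
  have iCF : mu.-integrable setT (fun x => Cg%:E * (F x)%:E)%E by exact: integrableZl.
  apply: le_integrable iCF => //.
    by apply: emeasurable_funM => //; apply/measurable_EFinP.
  move=> x _; rewrite !abseM muleC lee_wpmul2r// gee0_abs//.
  by rewrite gee0_abs ?lee_fin ?(ltW Cg_gt0).
move=> /eqP; rewrite mule_eq0 => /orP[|/eqP//].
by rewrite eqe gt_eqF.
Qed.

(** The integral of [F] against each mollified indicator is 0, and dominated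
    convergence gives the integral of [F] over the orthant itself. *)
Lemma fourier_eq0 : {ae mu, forall x, F x = 0}.
Proof.
apply: integral_orthant_eq0 => // a.
have mI : measurable_fun setT (fun y : rV => \1_(orthant a) y : R).
  by apply: measurable_indic; exact: measurable_orthant.
have H : (\int[mu]_x ((F x)%:E * moll a k x))%E @[k --> \oo] -->
    (\int[mu]_x ((F x)%:E * (Cg * \1_(orthant a) x)%:E))%E.
  apply: (@dominated_cvg _ _ _ mu setT measurableT
    (fun k x => (F x)%:E * moll a k x)%E _ (fun x => Cg%:E * `|(F x)%:E|)%E) => //.
  - by move=> k; apply: emeasurable_funM => //; apply/measurable_EFinP.
  - by move=> x _; apply: cvgeZl => //; exact: moll_cvg.
  - by apply: integrableZl => //; exact: integrable_abse.
  - move=> k x _; rewrite abseM muleC lee_wpmul2r// gee0_abs//.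
have H0 : (\int[mu]_x ((F x)%:E * moll a k x))%E @[k --> \oo] --> 0%E.
  by under eq_fun do rewrite integral_F_moll; exact: cvg_cst.
have : (\int[mu]_x ((F x)%:E * (Cg * \1_(orthant a) x)%:E) = 0)%E.
  exact: (cvg_unique _ H H0).
under eq_integral do rewrite -EFinM mulrCA EFinM.
rewrite integralZl//; last by apply: integrableFM => // x; exact: indic01.
move=> /eqP; rewrite mule_eq0 => /orP[|/eqP Fint0]; first by rewrite eqe gt_eqF.
rewrite -[RHS]Fint0 [LHS]integral_mkcond; apply: eq_integral => x _.
by rewrite patchE indicE; case: (_ \in _); rewrite ?mulr1 ?mulr0.
Qed.

End fourier_uniqueness.

(** * The gamma density *)

Section gamma_density.
Context {R : realType}.
Local Notation leb := (@lebesgue_measure R).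
Variable sg : R.
Hypotheses (sg_gt0 : 0 < sg) (sg_lt : sg < 2^-1).

Let pos : R -> R := \1_(`]0, +oo[%classic).

Let posE t : pos t = ((0 < t)%R)%:R.
Proof.
by rewrite /pos indicE; congr ((nat_of_bool _)%:R); apply/idP/idP;
  rewrite inE/= in_itv/= andbT.
Qed.

(** Up to the constant [gamma_mass], the gamma density of exponent [sg] is the
    law of the time in the mixture of heat kernels; [tail_power] is that law
    weighted by the modulus of continuity of the heat kernel, without the
    exponential. *)
Definition tail_power (t : R) : R :=
  \1_(`]0, +oo[%classic) t * (t `^ (sg - 1) * Num.min 1 (t `^ (- 2^-1))).

Definition gamma_density (t : R) : R :=
  \1_(`]0, +oo[%classic) t * (t `^ (sg - 1) * expR (- t)).

Let mpos : measurable_fun setT pos.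
Proof. by apply: measurable_indic; exact: measurable_itv. Qed.

Let mpow (a : R) : measurable_fun setT (fun t : R => t `^ a).
Proof. exact: measurable_powR. Qed.

Lemma measurable_tail_power : measurable_fun setT tail_power.
Proof.
apply: measurable_funM; first exact: mpos.
by apply: measurable_funM => //; exact: measurable_minr.
Qed.

Lemma measurable_gamma_density : measurable_fun setT gamma_density.
Proof.
apply: measurable_funM; first exact: mpos.
apply: measurable_funM => //; apply: (measurableT_comp (f := @expR R)) => //.
Qed.

Lemma tail_power_ge0 t : 0 <= tail_power t.
Proof.
by rewrite !mulr_ge0 ?powR_ge0// le_min ler01 powR_ge0.
Qed.

Lemma gamma_density_ge0 t : 0 <= gamma_density t.
Proof. by rewrite !mulr_ge0 ?powR_ge0// expR_ge0. Qed.

Lemma gamma_density_le t : gamma_density t <= tail_power t.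
Proof.
rewrite /gamma_density /tail_power -/pos posE.
case: ltP => [t0|_]; last by rewrite !mul0r.
rewrite ler_wpM2l// ler_wpM2l ?powR_ge0// le_min; apply/andP; split.
  by rewrite -expR0 ler_expR oppr_le0 ltW.
rewrite expRN powRN lef_pV2 ?posrE ?expR_gt0 ?powR_gt0//.
apply: le_trans (expR_ge1Dx t).
have [t1|t1] := leP t 1.
  rewrite (@le_trans _ _ 1) ?lerDl ?(ltW t0)//.
  apply: (@le_trans _ _ (1 `^ 2^-1)); last by rewrite powR1.
  by apply: ge0_ler_powR; rewrite ?nnegrE ?invr_ge0 ?(ltW t0).
rewrite (@le_trans _ _ t) ?lerDr//.
by rewrite ler1_powR ?(ltW t1)// invf_le1// ler1n.
Qed.

(** The integrand is at most [t^sg / t] below 1 and [t^(sg - 1/2) / t] above 1,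
    so the radial integrals of dimension 1 apply. *)
Lemma integral_tail_power_lty : (\int[leb]_t (tail_power t)%:E < +oo)%E.
Proof.
pose B := [set h : 'rV[R]_1 | enorm h < 1].
have mB : measurable B by exact: measurable_enorm_ball.
pose f (h : 'rV[R]_1) := (tail_power (rVhead h))%:E.
have mf : measurable_fun setT f.
  apply/measurable_EFinP; apply: measurableT_comp measurable_tail_power _.
  exact: measurable_coord.
have f0 h : (0 <= f h)%E by rewrite lee_fin tail_power_ge0.
have enE (h : 'rV[R]_1) : enorm h = `|rVhead h|.
  by rewrite /enorm /dot big_ord1 -expr2 sqrtr_sqr.
have -> : (\int[leb]_t (tail_power t)%:E = \int[lebesgue_rV 1]_h f h)%E.
  rewrite ge0_integral_rVS//; apply: eq_integral => t _.
  rewrite ge0_integral_rV0; last exact: measurable_rVcons_pair.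
  by rewrite /f /rVhead rVcons_head.
have -> : (\int[lebesgue_rV 1]_h f h =
    \int[lebesgue_rV 1]_(h in B) f h + \int[lebesgue_rV 1]_(h in ~` B) f h)%E.
  rewrite -ge0_integral_setU ?setUv//; first exact: measurableC.
  by rewrite disj_set2E setICr.
have mpw (a : R) : measurable_fun setT (fun h : 'rV[R]_1 => (enorm h `^ a / enorm h ^+ 1)%:E).
  have me := measurable_enorm (@measurable_id _ 'rV[R]_1 setT).
  apply/measurable_EFinP/measurable_funM.
    by apply: (measurableT_comp (f := fun x : R => x `^ a)) => //; exact: measurable_powR.
  apply: measurable_ge0_inv => [|x]; first exact: measurable_funX.
  by rewrite exprn_ge0// enorm_ge0.
have d0 : 0 < 2^-1 - sg by rewrite subr_gt0.
have half1 : 2^-1 <= 1 :> R by rewrite invf_le1// ler1n.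
apply: lte_add_pinfty.
  have sg1 : sg <= 1%:R :> R by rewrite (le_trans (ltW sg_lt)).
  apply: (le_lt_trans _ (le_lt_trans
    (ge0_integral_enorm_powR_in (ltn0Sn 0) sg_gt0 sg1) (ltry _))).
    apply: ge0_le_integral => [//|h _|||h _].
    - exact: f0.
    - exact: measurable_funTS mf.
    - exact: measurable_funTS (mpw _).
    rewrite lee_fin expr1 enE /tail_power -/pos posE.
    case: ltP => [t0|_]; last first.
      by rewrite mul0r divr_ge0 ?powR_ge0.
    rewrite mul1r ger0_norm ?(ltW t0)// powRD; last by rewrite (gt_eqF t0) implybT.
    rewrite powR_inv1 ?(ltW t0)// -[leRHS]mulr1 ler_wpM2l ?divr_ge0
      ?powR_ge0 ?(ltW t0)// ge_min lexx.
have sg1 : 2^-1 - sg <= 1%:R :> R by rewrite (le_trans _ half1)// gerBl ltW.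
apply: (le_lt_trans _ (le_lt_trans
  (ge0_integral_enorm_powR_out (ltn0Sn 0) d0 sg1) (ltry _))).
  apply: ge0_le_integral => [|h _|||h _].
  - exact: measurableC.
  - exact: f0.
  - exact: measurable_funTS mf.
  - exact: measurable_funTS (mpw _).
  rewrite lee_fin expr1 enE /tail_power -/pos posE.
  case: ltP => [t0|_]; last first.
    by rewrite mul0r divr_ge0 ?powR_ge0.
  rewrite mul1r ger0_norm ?(ltW t0)//.
  apply: (@le_trans _ _ (rVhead h `^ (sg - 1) * rVhead h `^ (- 2^-1))).
    by rewrite ler_wpM2l ?powR_ge0// ge_min lexx orbT.
  rewrite -[(rVhead h)^-1]powR_inv1 ?(ltW t0)// -!powRD ?(gt_eqF t0) ?implybT//.
  by rewrite le_eqVlt; apply/orP; left; apply/eqP; congr (_ `^ _); ring.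
Qed.

(** This is the value of the Gamma function at [sg]. *)
Definition gamma_mass : R := fine (\int[leb]_t (gamma_density t)%:E)%E.

Lemma gamma_massE : (\int[leb]_t (gamma_density t)%:E = gamma_mass%:E)%E.
Proof.
rewrite fineK// ge0_fin_numE; last first.
  by apply: integral_ge0 => t _; rewrite lee_fin gamma_density_ge0.
apply: le_lt_trans integral_tail_power_lty; apply: ge0_le_integral => [//|t _|||t _].
- by rewrite lee_fin gamma_density_ge0.
- by apply/measurable_EFinP; exact: measurable_gamma_density.
- by apply/measurable_EFinP; exact: measurable_tail_power.
- by rewrite lee_fin gamma_density_le.
Qed.

Lemma gamma_mass_gt0 : 0 < gamma_mass.
Proof.
rewrite -lte_fin -gamma_massE.
have mI : measurable (`]0, 1[%classic : set R) by exact: measurable_itv.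
apply: (@lt_le_trans _ _ (\int[leb]_t (expR (- 1) * \1_(`]0%R, 1%R[%classic) t)%:E)%E).
  rewrite ge0_integralM ?expR_ge0//.
  have leb01 : leb (`]0%R, 1%R[%classic) = 1%:E.
    by rewrite lebesgue_measure_itv/= lte_fin ltr01 -EFinB subr0.
  have -> : (\int[leb]_t (\1_(`]0%R, 1%R[%classic) t)%:E = 1%:E)%E.
    by rewrite integral_indic// setIT.
  by rewrite -EFinM lte_fin mulr1 expR_gt0.
apply: ge0_le_integral => [//|t _|||t _].
- by rewrite lee_fin mulr_ge0// expR_ge0.
- by apply/measurable_EFinP/measurable_funM => //; exact: measurable_indic.
- by apply/measurable_EFinP; exact: measurable_gamma_density.
rewrite lee_fin /gamma_density -/pos posE indicE.
have [|_] := boolP (t \in `]0, 1[%classic).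
  rewrite inE/= in_itv/= => /andP[t0 t1]; rewrite t0 mul1r mulr1 -[leLHS]mul1r.
  apply: ler_pM => //.
    have s10 : sg - 1 <= 0 by move: sg_lt; lra.
    by have := @ger_powR _ t (introT andP (conj t0 (ltW t1))) _ _ s10; rewrite powRr0.
  by rewrite ler_expR lerN2 ltW.
by rewrite mulr0 mulr_ge0// mulr_ge0 ?powR_ge0 ?expR_ge0.
Qed.

(** Substitute [(1 + r) t] for [t] in the integral of the gamma density. *)
Lemma integral_gamma_density_expR (r : R) : 0 <= r ->
  (\int[leb]_t (gamma_density t * expR (- (t * r)))%:E =
   ((1 + r) `^ (- sg) * gamma_mass)%:E)%E.
Proof.
move=> r0; set lam := 1 + r; have lam0 : 0 < lam by rewrite ltr_pwDl.
have := gamma_massE.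
rewrite (ge0_integral_affine 0 (lt0r_neq0 lam0)); last 2 first.
- by apply/measurable_EFinP; exact: measurable_gamma_density.
- by move=> t; rewrite lee_fin gamma_density_ge0.
rewrite gtr0_norm//.
have -> : (\int[leb]_t (gamma_density (lam * t + 0))%:E =
    (lam `^ (sg - 1))%:E * \int[leb]_t (gamma_density t * expR (- (t * r)))%:E)%E.
  have mg : measurable_fun setT (fun t : R => gamma_density t * expR (- (t * r))).
    apply: measurable_funM; first exact: measurable_gamma_density.
    apply: (measurableT_comp (f := @expR R)) => //.
    by apply: measurable_funN; exact: measurable_funM.
  have g0 t : 0 <= gamma_density t * expR (- (t * r)).
    by rewrite mulr_ge0 ?gamma_density_ge0 ?expR_ge0.
  apply: etrans (ge0_integralM leb mg g0 (powR_ge0 _ _)).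
  apply: eq_integral => t _; congr EFin.
  rewrite addr0 /gamma_density -/pos !posE pmulr_rgt0//.
  case: ltP => [t0|_]; last by rewrite !(mul0r, mulr0).
  rewrite !mul1r powRM ?(ltW lam0) ?(ltW t0)// -!mulrA; congr (_ * (_ * _)).
  by rewrite -expRD; congr expR; rewrite /lam; ring.
rewrite muleA -EFinM => E.
have lamE : lam * lam `^ (sg - 1) = lam `^ sg by rewrite mulr_powRB1 // ltW.
rewrite lamE in E.
have p0 : 0 < lam `^ sg by rewrite powR_gt0.
rewrite powRN EFinM -E muleA -EFinM mulVf ?mul1e// gt_eqF//.
Qed.

(** Substitute [r^2 t] for [t]: this scaling is the source of the exponent
    [s = 2 sg] in the Hoelder estimate for the Bessel kernel. *)
Lemma integral_tail_scale (r : R) : 0 < r ->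
  (\int[leb]_t (\1_(`]0%R, +oo[%classic) t *
     (t `^ (sg - 1) * Num.min 1 (r * t `^ (- 2^-1))))%:E =
   (r `^ (2 * sg))%:E * \int[leb]_t (tail_power t)%:E)%E.
Proof.
move=> r0; have r20 : 0 < r ^+ 2 by rewrite exprn_gt0.
rewrite (ge0_integral_affine 0 (lt0r_neq0 r20)); last 2 first.
- apply/measurable_EFinP/measurable_funM; first exact: mpos.
  apply: measurable_funM => //; apply: measurable_minr => //.
  exact: measurable_funM.
- move=> t; rewrite lee_fin mulr_ge0// mulr_ge0 ?powR_ge0// le_min ler01/=.
  by rewrite mulr_ge0 ?powR_ge0// ltW.
rewrite gtr0_norm//.
have -> : r `^ (2 * sg) = r ^+ 2 * (r ^+ 2) `^ (sg - 1).
  by rewrite mulr_powRB1 ?(ltW r20)// -powR_mulrn ?(ltW r0)// -powRrM.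
rewrite [in RHS]EFinM -[RHS]muleA; congr *%E.
apply: etrans (ge0_integralM leb measurable_tail_power tail_power_ge0 (powR_ge0 _ _)).
apply: eq_integral => t _; congr EFin.
rewrite addr0 /tail_power -/pos !posE pmulr_rgt0//.
case: ltP => [t0|_]; last by rewrite !(mul0r, mulr0).
rewrite !mul1r powRM ?(ltW r20) ?(ltW t0)// -!mulrA; congr (_ * (_ * Num.min _ _)).
rewrite mulrA -expr2 powRM ?(ltW r20) ?(ltW t0)//.
rewrite -[in X in X `^ _](powR_mulrn 2 (ltW r0)) -powRrM.
by rewrite mulrN mulfV// powR_inv1 ?(ltW r0)// mulrA mulfV ?mul1r// gt_eqF.
Qed.

End gamma_density.

(** * Continuity in mean of the heat kernel *)

Section gaussian_modulus.
Context {R : realType} (n : nat).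
Local Notation mu := (@lebesgue_rV R n).
Local Notation rV := 'rV[R]_n.

(** Since [dot (y + h) (y + h) - dot y y] is [2 dot y h + enorm h ^+ 2], it
    suffices to bound [2 dot y h] by [enorm h * (dot y y + 1)]; this holds because
    the squares of [enorm h *: y + h] and [enorm h *: y - h] are
    nonnegative. *)
Lemma norm_dotD_le (y h : rV) : enorm h <= 1 ->
  `|dot (y + h) (y + h) - dot y y| <= enorm h * (dot y y + 2).
Proof.
move=> h1; set e := enorm h in h1 *; have e0 : 0 <= e by exact: enorm_ge0.
have -> : dot (y + h) (y + h) - dot y y = 2 * dot y h + e ^+ 2.
  by rewrite sqr_enorm dotDl !dotDr (dotC h y); ring.
have H : `|2 * dot y h| <= e * (dot y y + 1).
  have [e_eq0|e_gt0] : e = 0 \/ 0 < e by move: e0; rewrite le_eqVlt => /orP[/eqP|]; auto.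
    have /eqP -> : h == 0 by rewrite -enorm_eq0 -/e e_eq0.
    by rewrite -(scale0r 0) dotZr mul0r mulr0 normr0 mulr_ge0// addr_ge0// dot_ge0.
  have P (t : R) : t ^+ 2 = 1 -> t * (2 * dot y h) <= e * (dot y y + 1).
    move=> t2; have := dot_ge0 (e *: y - t *: h).
    rewrite -scaleN1r dotDl !dotDr !(dotZl, dotZr) (dotC h y) -[dot h h]sqr_enorm -/e.
    have -> : e * (e * dot y y) + e * (-1 * (t * dot y h)) +
      (e * (-1 * (t * dot y h)) + -1 * (t * (-1 * (t * e ^+ 2)))) =
      e * (e * (dot y y + t ^+ 2) - t * (2 * dot y h)).
      by ring.
    by rewrite pmulr_rge0// subr_ge0 t2 mulrDr.
  rewrite ler_norml; apply/andP; split.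
    by rewrite lerNl -mulN1r; apply: P; rewrite sqrrN expr1n.
  by rewrite -[leLHS]mul1r; apply: P; rewrite expr1n.
apply: le_trans (ler_normD _ _) _.
rewrite (ger0_norm (sqr_ge0 e)) -[2%R]/(1 + 1) addrA mulrDr mulr1.
by apply: lerD => //; rewrite expr2 ler_piMr.
Qed.

Let expR_sub_le (a b : R) : a <= b -> `|expR (- b) - expR (- a)| <= (b - a) * expR (- a).
Proof.
move=> ab; have -> : expR (- b) = expR (- a) * expR (- (b - a)).
  by rewrite -expRD; congr expR; ring.
rewrite -[X in _ - X]mulr1 -mulrBr normrM ger0_norm ?expR_ge0// mulrC.
rewrite ler_wpM2r ?expR_ge0// ler0_norm.
  by have := expR_ge1Dx (- (b - a)); lra.
by rewrite subr_le0 -expR0 ler_expR oppr_le0 subr_ge0.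
Qed.

Let gaussn_half (y : rV) : (dot y y + 2) * gaussn 1 y <= 2 * gaussn 2^-1 y.
Proof.
have -> : gaussn 1 y = gaussn 2^-1 y * gaussn 2^-1 y.
  by rewrite /gaussn -expRD; congr expR; field.
rewrite mulrA ler_wpM2r ?gaussn_ge0// /gaussn expRN ler_pdivrMr ?expR_gt0//.
by have := expR_ge1Dx (2^-1 * dot y y); lra.
Qed.

(** The mean value inequality for [exp] reduces the difference to
    [norm_dotD_le], based at the one of [y] and [y + h] where the Gaussian is
    larger; half of its decay absorbs the factor [dot y y + 2]. *)
Lemma gaussn_diff_le (y h : rV) : enorm h <= 1 ->
  `|gaussn 1 (y + h) - gaussn 1 y| <=
  2 * enorm h * (gaussn 2^-1 y + gaussn 2^-1 (y + h)).
Proof.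
move=> h1.
wlog le_dot : y h h1 / dot y y <= dot (y + h) (y + h).
  move=> W; have [|/ltW le2] := leP (dot y y) (dot (y + h) (y + h)); first exact: W.
  have := W (y + h) (- h); rewrite enormN addrK => /(_ h1 le2).
  by rewrite distrC [X in _ * X]addrC.
have := expR_sub_le le_dot; rewrite /gaussn !mul1r -/(gaussn _ _) => /le_trans; apply.
apply: (@le_trans _ _ (enorm h * ((dot y y + 2) * expR (- dot y y)))).
  rewrite mulrA ler_wpM2r ?expR_ge0//.
  by apply: le_trans (norm_dotD_le y h1); exact: ler_norm.
have := gaussn_half y; rewrite {1}/gaussn mul1r => H.
apply: le_trans (ler_wpM2l (enorm_ge0 h) H) _.
rewrite mulrCA mulrA -[leLHS]addr0 [leRHS]mulrDr lerD2l.
by rewrite mulr_ge0 ?gaussn_ge0// mulr_ge0// enorm_ge0.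
Qed.

Let E0 := Num.sqrt (pi / 1) ^+ n : R.
Let E1 := Num.sqrt (pi / 2^-1) ^+ n : R.

(** [E0] and [E1] are the masses of the Gaussians of rates 1 and 1/2: the
    first term serves for [enorm h <= 1], the second one beyond. *)
Definition gauss_modulus : R := 4 * E1 + 2 * E0.

Let E0_ge0 : 0 <= E0. Proof. by rewrite exprn_ge0 ?sqrtr_ge0. Qed.
Let E1_ge0 : 0 <= E1. Proof. by rewrite exprn_ge0 ?sqrtr_ge0. Qed.

Lemma gauss_modulus_ge0 : 0 <= gauss_modulus.
Proof. by rewrite addr_ge0 ?mulr_ge0. Qed.

Lemma ge0_integral_translate_diff_le (g1 g2 : rV -> R) (a e : R) (h : rV) :
  measurable_fun setT g1 -> measurable_fun setT g2 -> (forall x, 0 <= g2 x) ->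
  0 <= a -> (\int[mu]_x (g2 x)%:E = e%:E)%E ->
  (forall x, `|g1 (x + h) - g1 x| <= a * (g2 x + g2 (x + h))) ->
  (\int[mu]_x `|g1 (x + h) - g1 x|%:E <= (a * (e + e))%:E)%E.
Proof.
move=> mg1 mg2 g20 a0 ge H.
have mh (g : rV -> R) : measurable_fun setT g -> measurable_fun setT (fun x : rV => g (x + h)).
  by move=> mg; apply: measurableT_comp => //; exact: measurable_rV_add.
have ms : measurable_fun setT (fun x : rV => g2 x + g2 (x + h)).
  by apply: measurable_funD => //; exact: mh.
apply: (@le_trans _ _ (\int[mu]_x (a * (g2 x + g2 (x + h)))%:E)%E).
  apply: ge0_le_integral => [//|x _|||x _].
  - by rewrite lee_fin.
  - apply/measurable_EFinP; apply: measurableT_comp => //.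
    by apply: measurable_funB => //; exact: mh.
  - by apply/measurable_EFinP; exact: measurable_funM.
  - by rewrite lee_fin.
have s0 x : 0 <= g2 x + g2 (x + h) by rewrite addr_ge0.
rewrite (ge0_integralM mu ms s0 a0) EFinM lee_wpmul2l ?lee_fin//.
under eq_integral do rewrite EFinD.
have mgh : measurable_fun setT (fun x : rV => (g2 (x + h))%:E).
  by apply/measurable_EFinP; exact: mh.
have mg2E : measurable_fun setT (EFin \o g2) by exact/measurable_EFinP.
have g20E x : (0 <= (EFin \o g2) x)%E by rewrite lee_fin.
rewrite (ge0_integralD mu measurableT (fun x _ => g20E x) mg2E
  (fun x _ => g20E (x + h)) mgh).
by rewrite (ge0_integral_rV_translate h mg2E g20E) ge.
Qed.

Lemma integral_norm_diff_le (g : rV -> R) (e : R) (h : rV) :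
  measurable_fun setT g -> (forall x, 0 <= g x) ->
  (\int[mu]_x (g x)%:E = e%:E)%E ->
  (\int[mu]_x `|g (x + h) - g x|%:E <= (2 * e)%:E)%E.
Proof.
move=> mg g0 ge.
have := @ge0_integral_translate_diff_le g g 1 e h mg mg g0 ler01 ge.
rewrite mul1r mulr2n mulrDl mul1r; apply => x; rewrite mul1r [leRHS]addrC.
by apply: le_trans (ler_normB _ _) _; rewrite !ger0_norm.
Qed.

Lemma gaussn1_modulus (h : rV) :
  (\int[mu]_x `|gaussn 1 (x + h) - gaussn 1 x|%:E <= (gauss_modulus * enorm h)%:E)%E.
Proof.
have m1 : measurable_fun setT (fun x : rV => gaussn 1 x) by exact: measurable_gaussn.
have m2 : measurable_fun setT (fun x : rV => gaussn 2^-1 x) by exact: measurable_gaussn.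
have half0 : 0 < 2^-1 :> R by rewrite invr_gt0.
have [h1|/ltW h1] := leP (enorm h) 1.
  apply: le_trans (ge0_integral_translate_diff_le m1 m2 (@gaussn_ge0 _ _ _) _
    (integral_gaussn half0 n) (fun x => gaussn_diff_le x h1)) _.
    by rewrite mulr_ge0// enorm_ge0.
  rewrite lee_fin -/E1 /gauss_modulus.
  have := mulr_ge0 E0_ge0 (enorm_ge0 h); have := enorm_ge0 h; nra.
apply: le_trans (integral_norm_diff_le h m1 (@gaussn_ge0 _ _ _)
  (integral_gaussn ltr01 n)) _.
rewrite lee_fin -/E0 /gauss_modulus.
apply: (@le_trans _ _ (2 * E0 * enorm h)); first by rewrite ler_peMr// mulr_ge0.
by rewrite ler_wpM2r ?enorm_ge0// lerDr mulr_ge0.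
Qed.

End gaussian_modulus.

Section heat_kernel.
Context {R : realType} (n : nat).
Local Notation mu := (@lebesgue_rV R n).
Local Notation leb := (@lebesgue_measure R).
Local Notation rV := 'rV[R]_n.

(** [(4 t)^-1] for positive [t]; the power makes it a measurable function
    of [t]. *)
Definition heat_rate (t : R) : R := 4^-1 * t `^ (-1).

Definition heat (t : R) (x : rV) : R :=
  Num.sqrt (heat_rate t / pi) ^+ n * gaussn (heat_rate t) x.

Lemma heat_rate_gt0 t : 0 < t -> 0 < heat_rate t.
Proof. by move=> t0; rewrite mulr_gt0 ?invr_gt0 ?powR_gt0. Qed.

Lemma heat_ge0 t x : 0 <= heat t x.
Proof. by rewrite mulr_ge0 ?gaussn_ge0// exprn_ge0 ?sqrtr_ge0. Qed.

Lemma measurable_heat d (T : measurableType d) (f : T -> R) (g : T -> rV) :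
  measurable_fun setT f -> measurable_fun setT g ->
  measurable_fun setT (fun z => heat (f z) (g z)).
Proof.
move=> mf mg.
have mr : measurable_fun setT (fun z => heat_rate (f z)).
  apply: measurable_funM => //.
  by apply: (measurableT_comp (f := fun x : R => x `^ (-1))) => //; exact: measurable_powR.
apply: measurable_funM.
  apply: measurable_funX; apply: (measurableT_comp (f := @Num.sqrt R)).
    by apply: continuous_measurable_fun; exact: sqrt_continuous.
  exact: measurable_funM.
apply: (measurableT_comp (f := @expR R)) => //; apply: measurable_funN.
by apply: measurable_funM => //; exact: measurable_dot.
Qed.

Let sqrt_rateK t : 0 < t ->
  Num.sqrt (heat_rate t / pi) ^+ n * Num.sqrt (pi / heat_rate t) ^+ n = 1.
Proof.
move=> t0; have k0 := heat_rate_gt0 t0; have p0 := @pi_gt0 R.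
rewrite -exprMn -sqrtrM ?divr_ge0 ?(ltW k0) ?(ltW p0)//.
rewrite mulrA divfK ?gt_eqF// mulfV ?gt_eqF// sqrtr1 expr1n//.
Qed.

Lemma integral_heat t : 0 < t -> (\int[mu]_x (heat t x)%:E = 1)%E.
Proof.
move=> t0; have k0 := heat_rate_gt0 t0.
have mg : measurable_fun setT (fun x : rV => gaussn (heat_rate t) x).
  exact: measurable_gaussn.
have e0 : 0 <= Num.sqrt (heat_rate t / pi) ^+ n by rewrite exprn_ge0 ?sqrtr_ge0.
have := ge0_integralM mu mg (@gaussn_ge0 _ _ _) e0.
by rewrite /heat => ->; rewrite integral_gaussn// -EFinM sqrt_rateK.
Qed.

Lemma integral_heat_cos t xi : 0 < t ->
  (\int[mu]_x (heat t x * cos (dot x xi))%:E = (expR (- (t * dot xi xi)))%:E)%E.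
Proof.
move=> t0; have k0 := heat_rate_gt0 t0.
rewrite /heat; under eq_integral do rewrite -mulrA EFinM.
rewrite integralZl//; last exact: integrable_gaussn_cos.
have [-> _] := integral_gaussn_cos_sin k0 xi.
rewrite -EFinM mulrA sqrt_rateK// mul1r; congr (expR (- _))%:E.
by rewrite /heat_rate powR_inv1 ?(ltW t0)//; field; rewrite gt_eqF.
Qed.

Lemma integral_heat_sin t xi : 0 < t ->
  (\int[mu]_x (heat t x * sin (dot x xi))%:E = 0)%E.
Proof.
move=> t0; have k0 := heat_rate_gt0 t0.
rewrite /heat; under eq_integral do rewrite -mulrA EFinM.
rewrite integralZl//; last exact: integrable_gaussn_sin.
by have [_ ->] := integral_gaussn_cos_sin k0 xi; rewrite mule0.
Qed.

Definition heat_modulus : R := 2 + (Num.sqrt pi ^+ n)^-1 * gauss_modulus n.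

Lemma heat_modulus_gt0 : 0 < heat_modulus.
Proof.
rewrite ltr_pwDl// mulr_ge0 ?gauss_modulus_ge0// invr_ge0.
Qed.

(** The dilation that turns [heat t] into the standard Gaussian multiplies [h]
    by [(4 t) `^ (- 2^-1)]. *)
Lemma heat_translate_le t (h : rV) : 0 < t ->
  (\int[mu]_x `|heat t (x + h) - heat t x|%:E <=
    (heat_modulus * Num.min 1 (enorm h * t `^ (- 2^-1)))%:E)%E.
Proof.
move=> t0; have k0 := heat_rate_gt0 t0; have p0 := @pi_gt0 R.
have mh : measurable_fun setT (heat t) by exact: measurable_heat.
have b1 : (\int[mu]_x `|heat t (x + h) - heat t x|%:E <= 2%:E)%E.
  rewrite -[2%R]mulr1.
  by apply: (integral_norm_diff_le h mh (heat_ge0 t)); rewrite integral_heat.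
have b2 : (\int[mu]_x `|heat t (x + h) - heat t x|%:E <=
    ((Num.sqrt pi ^+ n)^-1 * gauss_modulus n * (enorm h * t `^ (- 2^-1)))%:E)%E.
  pose r := (Num.sqrt (heat_rate t))^-1.
  have sk0 : 0 < Num.sqrt (heat_rate t) by rewrite sqrtr_gt0.
  have r0 : 0 < r by rewrite invr_gt0.
  have rr : heat_rate t * r * r = 1.
    have qE : heat_rate t = Num.sqrt (heat_rate t) * Num.sqrt (heat_rate t).
      by rewrite -expr2 sqr_sqrtr// ltW.
    by rewrite {1}qE /r mulfK ?mulfV// gt_eqF.
  have heatE y : heat t (r *: y) = Num.sqrt (heat_rate t / pi) ^+ n * gaussn 1 y.
    rewrite /heat; congr (_ * _); rewrite /gaussn dotZl dotZr !mulrA.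
    by rewrite rr.
  have mdiff : measurable_fun setT (fun x : rV => `|heat t (x + h) - heat t x|%:E).
    apply/measurable_EFinP; apply: measurableT_comp => //.
    by apply: measurable_funB => //; apply: measurableT_comp => //; exact: measurable_rV_add.
  rewrite (ge0_integral_rV_affine 0 (lt0r_neq0 r0))//.
  rewrite gtr0_norm//.
  have -> : (\int[mu]_x `|heat t (r *: x + 0 + h) - heat t (r *: x + 0)|%:E =
      \int[mu]_x (Num.sqrt (heat_rate t / pi) ^+ n *
        `|gaussn 1 (x + r^-1 *: h) - gaussn 1 x|)%:E)%E.
    apply: eq_integral => x _; rewrite !addr0.
    have -> : r *: x + h = r *: (x + r^-1 *: h).
      by rewrite scalerDr scalerA mulfV ?scale1r// gt_eqF.
    by rewrite !heatE -mulrBr normrM ger0_norm// exprn_ge0 ?sqrtr_ge0.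
  have mg1 : measurable_fun setT (fun x : rV => `|gaussn 1 (x + r^-1 *: h) - gaussn 1 x|).
    apply: measurableT_comp => //.
    by apply: measurable_funB; apply: measurable_gaussn => //; exact: measurable_rV_add.
  have e0 : 0 <= Num.sqrt (heat_rate t / pi) ^+ n by rewrite exprn_ge0 ?sqrtr_ge0.
  rewrite (ge0_integralM mu mg1 (fun x => normr_ge0 _) e0).
  rewrite muleA -EFinM.
  have -> : r ^+ n * Num.sqrt (heat_rate t / pi) ^+ n = (Num.sqrt pi ^+ n)^-1.
    rewrite -exprMn sqrtrM ?(ltW k0)// mulrA mulVf ?mul1r ?gt_eqF//.
    by rewrite sqrtrV ?(ltW p0)// exprVn.
  apply: le_trans (lee_wpmul2l _ (gaussn1_modulus _)) _.
    by rewrite lee_fin invr_ge0 exprn_ge0 ?sqrtr_ge0.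
  rewrite -EFinM lee_fin mulrA ler_wpM2l//.
    by rewrite mulr_ge0 ?gauss_modulus_ge0// invr_ge0 exprn_ge0 ?sqrtr_ge0.
  rewrite enormZ ger0_norm ?invr_ge0 ?(ltW r0)// mulrC ler_wpM2l ?enorm_ge0//.
  rewrite /r invrK /heat_rate sqrtrM ?invr_ge0//.
  have -> : Num.sqrt (t `^ (-1)) = t `^ (- 2^-1).
    by rewrite -powR12_sqrt ?powR_ge0// -powRrM mulN1r.
  rewrite ler_piMl ?powR_ge0// sqrtrV//.
  by rewrite invf_le1 ?sqrtr_gt0// -[leLHS]sqrtr1 ler_wsqrtr// ler1n.
have q0 : 0 <= (Num.sqrt pi ^+ n)^-1 * gauss_modulus n :> R.
  by apply: mulr_ge0; rewrite ?gauss_modulus_ge0// invr_ge0 exprn_ge0 ?sqrtr_ge0.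
have m0 : 0 <= enorm h * t `^ (- 2^-1) by rewrite mulr_ge0 ?enorm_ge0 ?powR_ge0.
rewrite /heat_modulus minEle; case: ifP => _.
  by apply: le_trans b1 _; rewrite lee_fin mulr1 lerDl.
by apply: le_trans b2 _; rewrite lee_fin ler_wpM2r// lerDr.
Qed.

End heat_kernel.

(** * The Bessel kernel as a mixture of heat kernels *)

Lemma fine_dist (R : realDomainType) (a b : \bar R) :
  a \is a fin_num -> b \is a fin_num -> (`|fine a - fine b|%:E = `|a - b|)%E.
Proof. by case: a b => [a||] [b||]. Qed.

Section bessel.
Context {R : realType} (n : nat).
Local Notation mu := (@lebesgue_rV R n).
Local Notation leb := (@lebesgue_measure R).
Local Notation rV := 'rV[R]_n.
Variable s : R.
Hypotheses (s_gt0 : 0 < s) (s_lt1 : s < 1).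

Let sg := s / 2.
Let sg_gt0 : 0 < sg. Proof. by rewrite divr_gt0. Qed.
Let sg_lt : sg < 2^-1. Proof. by rewrite ltr_pdivrMr// mulVf. Qed.
Let c0 := gamma_mass sg.
Let c0_gt0 : 0 < c0. Proof. exact: gamma_mass_gt0. Qed.

Let W (z : R * rV) : R := gamma_density sg z.1 * heat z.1 z.2.

Let W_ge0 z : 0 <= W z.
Proof. by rewrite mulr_ge0 ?gamma_density_ge0 ?heat_ge0. Qed.

Let mfst := @measurable_fst _ _ (measurableTypeR R) rV.
Let msnd := @measurable_snd _ _ (measurableTypeR R) rV.

Let mW : measurable_fun [set: measurableTypeR R * rV] W.
Proof.
apply: measurable_funM; last exact: measurable_heat.
exact: (measurableT_comp (measurable_gamma_density sg) mfst).
Qed.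

Let gamma_density_le0 t : t <= 0 -> gamma_density sg t = 0.
Proof.
move=> t0; rewrite /gamma_density indicE memNset ?mul0r//=.
by rewrite in_itv/= andbT; apply/negP; rewrite -leNgt.
Qed.

Let integral_gammaM (k : R -> rV -> R) (v : R -> R) t :
  measurable_fun setT (k t) -> (forall x, 0 <= k t x) ->
  (0 < t -> (\int[mu]_x (k t x)%:E = (v t)%:E)%E) ->
  (\int[mu]_x (gamma_density sg t * k t x)%:E = (gamma_density sg t * v t)%:E)%E.
Proof.
move=> mk k0 kv; rewrite (ge0_integralM mu mk k0 (gamma_density_ge0 sg t)).
have [t0|t0] := leP t 0; last by rewrite kv// -EFinM.
by rewrite gamma_density_le0// mul0e mul0r.
Qed.

Let mheat t : measurable_fun setT (heat t : rV -> R).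
Proof. exact: measurable_heat. Qed.

Let integral_W_x t : (\int[mu]_x (W (t, x))%:E = (gamma_density sg t)%:E)%E.
Proof.
rewrite /W/= -[in RHS](mulr1 (gamma_density sg t)).
apply: (@integral_gammaM (fun t => heat t) (fun=> 1) t (mheat t) (heat_ge0 t)).
exact: integral_heat.
Qed.

Let integrable_W : (leb \x mu)%E.-integrable setT (EFin \o W).
Proof.
apply/integrable12ltyP; first exact/measurable_EFinP.
have -> : (\int[leb]_t \int[mu]_x `|(EFin \o W) (t, x)| =
    \int[leb]_t (gamma_density sg t)%:E)%E.
  apply: eq_integral => t _; rewrite -integral_W_x.
  by apply: eq_integral => x _; rewrite gee0_abs ?lee_fin.
by rewrite gamma_massE// ltry.
Qed.

Let inner x := (\int[leb]_t (W (t, x))%:E)%E.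

(** [(1 + |xi|^2)^(-s/2)] is the Laplace transform of a gamma law at
    [|xi|^2], and [exp (- t |xi|^2)] is the transform of the heat kernel: so the
    mixture of the heat kernels under this law has the required transform.  The
    inner integral is finite almost everywhere only. *)
Definition bessel_model x : R := c0^-1 * fine (inner x).

Local Notation H := bessel_model.

Let ae_integrable_W : {ae mu, forall x, leb.-integrable setT (fun t => (W (t, x))%:E)}.
Proof. exact: (ae_integrable2 integrable_W). Qed.

Let inner_ge0 x : (0 <= inner x)%E.
Proof. by apply: integral_ge0 => t _; rewrite lee_fin. Qed.

Let mEW : measurable_fun [set: measurableTypeR R * rV] (EFin \o W).
Proof. exact/measurable_EFinP. Qed.

Let EW_ge0 z : (0 <= (EFin \o W) z)%E.
Proof. by rewrite lee_fin. Qed.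

Let minner : measurable_fun setT inner.
Proof. exact: (@measurable_fun_fubini_tonelli_G _ _ _ _ _ leb (EFin \o W) mEW EW_ge0). Qed.

Let mH : measurable_fun setT H.
Proof. by apply: measurable_funM => //; exact: measurableT_comp. Qed.

Let H_ge0 x : 0 <= H x.
Proof. by rewrite mulr_ge0 ?fine_ge0// invr_ge0 ltW. Qed.

Let HE x : leb.-integrable setT (fun t => (W (t, x))%:E) ->
  ((H x)%:E = (c0^-1)%:E * inner x)%E.
Proof. by move=> iW; rewrite EFinM fineK//; exact: integrable_fin_num iW. Qed.

Let integral_inner : (\int[mu]_x inner x = c0%:E)%E.
Proof.
have := @fubini_tonelli _ _ _ _ _ leb mu (EFin \o W) mEW EW_ge0.
rewrite /inner => <-; rewrite -(gamma_massE sg_gt0 sg_lt).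
by apply: eq_integral => t _; exact: integral_W_x.
Qed.

Let integrable_inner : mu.-integrable setT inner.
Proof.
apply/integrableP; split=> //.
under eq_integral do rewrite (gee0_abs (inner_ge0 _)).
by rewrite integral_inner ltry.
Qed.

Let integrable_H : mu.-integrable setT (EFin \o H).
Proof.
apply/integrableP; split; first exact/measurable_EFinP.
apply: (@le_lt_trans _ _ (\int[mu]_x ((c0^-1)%:E * inner x))%E).
  apply: ge0_le_integral => [//|x _|||x _].
  - exact: abse_ge0.
  - by apply: measurableT_comp => //; exact/measurable_EFinP.
  - exact: measurable_funeM.
  rewrite /= ger0_norm// /bessel_model EFinM lee_wpmul2l ?lee_fin ?invr_ge0 ?(ltW c0_gt0)//.
  by move: (inner_ge0 x); case: (inner x) => //= _; exact: leey.
rewrite ge0_integralZl ?lee_fin ?invr_ge0 ?(ltW c0_gt0)//.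
by rewrite integral_inner -EFinM ltry.
Qed.

(** Fubini: the integral of [bessel_model] against a bounded function is the
    mixture of those of the heat kernels. *)
Let integral_H_mul (k : rV -> R) (v : R -> R) :
  measurable_fun setT k -> (forall x, `|k x| <= 1) ->
  (forall t, 0 < t -> (\int[mu]_x (heat t x * k x)%:E = (v t)%:E)%E) ->
  (\int[mu]_x (H x * k x)%:E =
    (c0^-1)%:E * \int[leb]_t (gamma_density sg t * v t)%:E)%E.
Proof.
move=> mk k1 kv.
pose Wk (z : R * rV) := (W z * k z.2)%:E.
have mWk : measurable_fun [set: measurableTypeR R * rV] Wk.
  by apply/measurable_EFinP/measurable_funM => //; exact: (measurableT_comp mk msnd).
have iWk : (leb \x mu)%E.-integrable setT Wk.
  apply: le_integrable integrable_W => // z _.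
  by rewrite !abse_EFin lee_fin normrM ler_piMr.
have E1 : (\int[mu]_x (H x * k x)%:E =
    \int[mu]_x ((c0^-1)%:E * \int[leb]_t Wk (t, x)))%E.
  apply: ae_eq_integral => //.
  - by apply/measurable_EFinP; exact: measurable_funM.
  - by apply: measurable_funeM; exact: (measurable_fubini_G iWk).
  move: ae_integrable_W; apply: filterS => x iW _.
  rewrite EFinM HE// -muleA; congr *%E.
  rewrite /inner muleC -integralZl//.
  by apply: eq_integral => t _; rewrite /Wk/= -EFinM mulrC.
have iG : mu.-integrable setT (fun x => \int[leb]_t Wk (t, x))%E.
  apply: le_integrable integrable_inner => //; first exact: (measurable_fubini_G iWk).
  move=> x _; rewrite (gee0_abs (inner_ge0 x)).
  have mWkx : measurable_fun setT (fun t => Wk (t, x)).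
    exact: (measurableT_comp mWk (pair2_measurable x)).
  apply: le_trans (le_abse_integral leb measurableT mWkx) _.
  apply: ge0_le_integral => [//|t _|||t _].
  - exact: abse_ge0.
  - exact: measurableT_comp.
  - exact: (measurableT_comp mEW (pair2_measurable x)).
  - by rewrite abse_EFin lee_fin normrM (ger0_norm (W_ge0 _)) ler_piMr.
rewrite E1 integralZl//.
congr *%E; rewrite -(Fubini iWk); apply: eq_integral => t _.
rewrite /Wk /W/=; have [t0|t0] := leP t 0.
  by rewrite gamma_density_le0// mul0r; apply: integral0_eq => x _; rewrite !mul0r.
under eq_integral do rewrite -mulrA EFinM.
rewrite integralZl//; first by rewrite kv.
have ih : mu.-integrable setT (EFin \o heat t).
  apply/integrableP; split; first exact/measurable_EFinP.
  under eq_integral do rewrite gee0_abs ?lee_fin ?heat_ge0//.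
  by rewrite integral_heat// ltry.
apply: le_integrable ih => //.
  by apply/measurable_EFinP; exact: measurable_funM.
by move=> x _; rewrite !abse_EFin lee_fin normrM ler_piMr.
Qed.

Let integral_H_cos xi : (\int[mu]_x (H x * cos (dot x xi))%:E =
  ((1 + enorm xi ^+ 2) `^ (- sg))%:E)%E.
Proof.
rewrite (@integral_H_mul _ (fun t => expR (- (t * dot xi xi)))).
- rewrite integral_gamma_density_expR ?dot_ge0// -EFinM sqr_enorm mulrCA mulVf ?mulr1//.
  by rewrite gt_eqF.
- exact: measurable_cos_dot.
- by move=> x; exact: cos_max.
- by move=> t t0; exact: integral_heat_cos.
Qed.

Let integral_H_sin xi : (\int[mu]_x (H x * sin (dot x xi))%:E = 0)%E.
Proof.
rewrite (@integral_H_mul _ (fun=> 0)).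
- by rewrite integral0_eq ?mule0// => t _; rewrite mulr0.
- exact: measurable_sin_dot.
- by move=> x; exact: sin_max.
- by move=> t t0; exact: integral_heat_sin.
Qed.

Lemma is_bessel_kernel_model : is_bessel_kernel s H.
Proof.
split => // xi; rewrite /fourier /Rintegral integral_H_cos integral_H_sin.
by rewrite /= oppr0.
Qed.

Lemma is_bessel_kernel_ae_eq G : is_bessel_kernel s G ->
  {ae mu, forall x, G x = H x}.
Proof.
move=> [iG GE].
have mG : measurable_fun setT G by apply/measurable_EFinP; exact: measurable_int iG.
have ib (g : rV -> R) (k : rV -> R) : mu.-integrable setT (EFin \o g) ->
    measurable_fun setT k -> (forall x, `|k x| <= 1) ->
    mu.-integrable setT (fun x => (g x * k x)%:E).
  move=> ig mk k1.
  have mg : measurable_fun setT g by apply/measurable_EFinP; exact: measurable_int ig.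
  apply: le_integrable ig => //.
    by apply/measurable_EFinP; exact: measurable_funM.
  by move=> x _; rewrite !abse_EFin lee_fin normrM ler_piMr.
have iF : mu.-integrable setT (EFin \o (fun x => G x - H x)).
  rewrite (_ : _ \o _ = (EFin \o G) \- (EFin \o H))%E; last by apply/funext.
  exact: integrableB.
have FE (k : rV -> R) (e : R) : measurable_fun setT k -> (forall x, `|k x| <= 1) ->
    (\int[mu]_x (G x * k x))%R = e -> (\int[mu]_x (H x * k x)%:E = e%:E)%E ->
    (\int[mu]_x ((G x - H x) * k x)%:E = 0)%E.
  move=> mk k1 Ge He.
  under eq_integral do rewrite mulrBl EFinB.
  rewrite integralB//; [|exact: ib|exact: ib].
  rewrite He -Ge /Rintegral fineK ?subee//; exact: integrable_fin_num (ib _ _ iG mk k1).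
have : {ae mu, forall x, G x - H x = 0}.
  apply: fourier_eq0 => // xi; have := GE xi; rewrite /fourier => -[Gc Gs].
  - apply: FE (integral_H_cos xi) => //; first exact: measurable_cos_dot.
    by move=> x; exact: cos_max.
  - apply: FE (integral_H_sin xi) => //; first exact: measurable_sin_dot.
      by move=> x; exact: sin_max.
    by apply/eqP; rewrite -oppr_eq0 Gs.
by apply: filterS => x /eqP; rewrite subr_eq0 => /eqP.
Qed.

Let K := c0^-1 * (heat_modulus n * fine (\int[leb]_t (tail_power sg t)%:E)%E).

Let K_ge0 : 0 <= K.
Proof.
rewrite !mulr_ge0 ?invr_ge0 ?(ltW c0_gt0) ?(ltW (heat_modulus_gt0 n))//.
by rewrite fine_ge0//; apply: integral_ge0 => t _; rewrite lee_fin tail_power_ge0.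
Qed.

(** The modulus of continuity [min 1 (enorm h * t `^ (- 2^-1))] of the heat
    kernel at time [t], averaged over the gamma law, scales like
    [enorm h `^ s]. *)
Let holder_model h : (\int[mu]_x `|H (x + h) - H x|%:E <= (K * enorm h `^ s)%:E)%E.
Proof.
have [->|h0] := eqVneq h 0.
  rewrite [leLHS](_ : _ = 0%E); first by rewrite lee_fin (mulr_ge0 K_ge0 (powR_ge0 _ _)).
  by apply: integral0_eq => x _; rewrite addr0 subrr normr0.
have eh0 : 0 < enorm h by rewrite enorm_gt0.
pose D (z : R * rV) := `|W (z.1, z.2 + h) - W z|%:E.
have mWh : measurable_fun [set: measurableTypeR R * rV] (fun z => W (z.1, z.2 + h)).
  apply: (measurableT_comp mW); apply: measurable_fun_pair => //.
  exact: measurable_rV_add.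
have mD : measurable_fun [set: measurableTypeR R * rV] D.
  by apply/measurable_EFinP/measurableT_comp => //; exact: measurable_funB.
have D0 z : (0 <= D z)%E by rewrite lee_fin.
have ae_xh := ae_translate h ae_integrable_W.
apply: (@le_trans _ _ (\int[mu]_x ((c0^-1)%:E * \int[leb]_t D (t, x)))%E).
  have mGD : measurable_fun setT (fun x => \int[leb]_t D (t, x))%E.
    exact: (@measurable_fun_fubini_tonelli_G _ _ _ _ _ leb D mD D0).
  have mHh : measurable_fun setT (fun x : rV => H (x + h)).
    by apply: (measurableT_comp mH); exact: measurable_rV_add.
  have mHd : measurable_fun setT (fun x : rV => `|H (x + h) - H x|).
    by apply: measurableT_comp => //; exact: measurable_funB mHh mH.
  apply: ae_ge0_le_integral => [//|x _||x _||].
  - by rewrite lee_fin.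
  - exact/measurable_EFinP.
  - by rewrite mule_ge0 ?lee_fin ?invr_ge0 ?(ltW c0_gt0)// integral_ge0.
  - exact: measurable_funeM.
  move: ae_integrable_W ae_xh; apply: filterS2 => x iWx iWxh _.
  have ix : inner x \is a fin_num by exact: integrable_fin_num iWx.
  have ixh : inner (x + h) \is a fin_num by exact: integrable_fin_num iWxh.
  have -> : `|H (x + h) - H x| = c0^-1 * `|fine (inner (x + h)) - fine (inner x)|.
    by rewrite /bessel_model -mulrBr normrM ger0_norm// invr_ge0 ltW.
  rewrite EFinM; apply: lee_wpmul2l; first by rewrite lee_fin invr_ge0 ltW.
  rewrite (fine_dist ixh ix).
  have iB := integralB measurableT iWxh iWx.
  rewrite -[(inner (x + h) - inner x)%E]/(integral _ _ _ - integral _ _ _)%E -iB.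
  apply: (le_trans (le_abse_integral leb measurableT _)) => //.
  by apply: emeasurable_funB; [exact: measurable_int iWxh|exact: measurable_int iWx].
rewrite ge0_integralZl ?lee_fin ?invr_ge0 ?(ltW c0_gt0)//; last 2 first.
- exact: (@measurable_fun_fubini_tonelli_G _ _ _ _ _ leb D mD D0).
- by move=> x _; exact: integral_ge0.
rewrite -(@fubini_tonelli _ _ _ _ _ leb mu D mD D0) /K -mulrA EFinM.
apply: lee_wpmul2l; first by rewrite lee_fin invr_ge0 ltW.
have Q_fin : (\int[leb]_t (tail_power sg t)%:E \is a fin_num)%E.
  rewrite ge0_fin_numE; first exact: integral_tail_power_lty.
  by apply: integral_ge0 => t _; rewrite lee_fin tail_power_ge0.
have hm0 := ltW (heat_modulus_gt0 (R := R) n).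
pose B t := \1_(`]0%R, +oo[%classic) t *
     (t `^ (sg - 1) * Num.min 1 (enorm h * t `^ (- 2^-1))).
have B0 t : 0 <= B t.
  by rewrite mulr_ge0// mulr_ge0 ?powR_ge0// le_min ler01/= mulr_ge0 ?powR_ge0// enorm_ge0.
have mB : measurable_fun setT B.
  apply: measurable_funM; first by apply: measurable_indic; exact: measurable_itv.
  apply: measurable_funM; first exact: measurable_powR.
  apply: measurable_minr => //; apply: measurable_funM => //; exact: measurable_powR.
have -> : (heat_modulus n * fine (\int[leb]_t (tail_power sg t)%:E) * enorm h `^ s)%:E =
    (\int[leb]_t (heat_modulus n * B t)%:E)%E.
  rewrite (ge0_integralM leb mB B0 hm0) integral_tail_scale//.
  rewrite -mulrA EFinM; congr *%E; rewrite mulrC EFinM fineK//.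
  by rewrite (_ : 2 * sg = s)// /sg mulrC divfK.
apply: ge0_le_integral => [//|t _|||t _].
- exact: integral_ge0.
- exact: (@measurable_fun_fubini_tonelli_F _ _ _ _ _ mu D mD D0).
- by apply/measurable_EFinP; exact: measurable_funM.
rewrite /D /W/=; have [t0|t0] := leP t 0.
  rewrite [leLHS](_ : _ = 0%E); first by rewrite lee_fin mulr_ge0.
  by apply: integral0_eq => x _; rewrite gamma_density_le0// !mul0r subrr normr0.
under eq_integral do rewrite -mulrBr normrM (ger0_norm (gamma_density_ge0 sg t)).
have mdiff : measurable_fun setT (fun x : rV => `|heat t (x + h) - heat t x|).
  apply: measurableT_comp => //; apply: measurable_funB => //.
  by apply: measurableT_comp => //; exact: measurable_rV_add.
rewrite (ge0_integralM mu mdiff (fun=> normr_ge0 _) (gamma_density_ge0 sg t)).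
apply: le_trans (lee_wpmul2l _ (heat_translate_le h t0)) _.
  by rewrite lee_fin gamma_density_ge0.
rewrite -EFinM lee_fin mulrCA ler_wpM2l// /B /gamma_density -!mulrA.
rewrite ler_wpM2l// ler_wpM2l ?powR_ge0// ler_piMl//.
  by rewrite le_min ler01/= mulr_ge0 ?powR_ge0// enorm_ge0.
by rewrite -expR0 ler_expR oppr_le0 ltW.
Qed.

(** [bessel_model] shows that the set from which [bessel_kernel] is chosen is
    not empty. *)
Lemma bessel_kernelP : is_bessel_kernel s (@bessel_kernel R n s).
Proof.
have : [set G : rV -> R | is_bessel_kernel s G] !=set0 by exists H; exact: is_bessel_kernel_model.
by move=> [G HG]; rewrite /bessel_kernel; case: xgetP => // /(_ G).
Qed.

(** The kernel equals [bessel_model] almost everywhere, which is all that the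
    integral sees. *)
Lemma bessel_kernel_holder : exists2 K, 0 < K & forall h,
  (\int[mu]_x `|bessel_kernel s (x + h) - bessel_kernel s x|%:E <=
    (K * enorm h `^ s)%:E)%E.
Proof.
exists (K + 1); first by rewrite ltr_pwDr.
move=> h; have aeG := is_bessel_kernel_ae_eq bessel_kernelP.
have aeGh := ae_translate h aeG.
have mG : measurable_fun setT (@bessel_kernel R n s).
  by apply/measurable_EFinP; exact: measurable_int bessel_kernelP.1.
have md (g : rV -> R) : measurable_fun setT g ->
    measurable_fun setT (fun x : rV => `|g (x + h) - g x|%:E).
  move=> mg; apply/measurable_EFinP/measurableT_comp => //.
  by apply: measurable_funB => //; apply: measurableT_comp => //; exact: measurable_rV_add.
apply: le_trans (le_trans _ (holder_model h)) _.
  rewrite le_eqVlt; apply/orP; left; apply/eqP; apply: ae_eq_integral => //.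
  - exact: md.
  - exact: md.
  by move: aeG aeGh; apply: filterS2 => x -> -> _.
by rewrite lee_fin ler_wpM2r ?powR_ge0// lerDl.
Qed.

(** The transform is 1 at the origin, so the kernel has integral 1. *)
Lemma L1norm_bessel_kernel_gt0 : 0 < L1norm (@bessel_kernel R n s).
Proof.
have [iG /(_ 0)] := bessel_kernelP; rewrite enorm0 expr0n/= addr0 powR1 /fourier => -[G1 _].
have d0 x : dot x (0 : rV) = 0 by rewrite -(scale0r 0) dotZr mul0r.
apply: (@lt_le_trans _ _ `|\int[mu]_x bessel_kernel s x|); last first.
  exact: le_normr_Rintegral.
have -> : (\int[mu]_x bessel_kernel s x)%R = 1.
  by rewrite -G1; apply: eq_Rintegral => x _; rewrite d0 cos0 mulr1.
by rewrite normr1.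
Qed.

End bessel.

(** * The embedding theorem *)

Theorem theorem3p7 (R : realType) (n : nat) (A : R -> R) (s s' : R) :
  (0 < n)%N -> young_function A -> 0 < s -> s < s' -> s' < 1 ->
  (exists2 C : R, 0 < C &
    forall u : 'rV[R]_n -> R, in_bessel_orlicz s' A u ->
      in_frac_sobolev s A u /\
      (frac_sobolev_norm s A u
         <= (C / (s' - s))%:E * bessel_orlicz_norm s' A u)%E) /\
  (forall (u f : 'rV[R]_n -> R) (c : R),
    in_bessel_orlicz s' A u ->
    in_orlicz A f -> is_convolution (bessel_kernel s') f u ->
    0 < c ->
    (forall h : 'rV[R]_n,
      (\int[lebesgue_rV n]_x `|bessel_kernel s' (x + h) - bessel_kernel s' x|%:E
         <= (c / (1 - s') * enorm h `^ s')%:E)%E) ->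
    let C1 := 2 * n%:R * unit_ball_volume R n / s in
    let C2 := 2 * L1norm (@bessel_kernel R n s') + c / (1 - s') in
    (\int[lebesgue_rV n]_x (A `|u x|)%:E +
     \int[lebesgue_rV n]_h \int[lebesgue_rV n]_x
       (A (`|u (x + h)%R - u x| / enorm h `^ s) / enorm h ^+ n)%:E
     <= (C1 / (s' - s))%:E * \int[lebesgue_rV n]_x (A (C2 * `|f x|))%:E +
        \int[lebesgue_rV n]_x
          (A (L1norm (@bessel_kernel R n s') * `|f x|))%:E)%E).
Proof.
move=> n_gt0 YA s_gt0 ss' s'_lt1.
have s'_gt0 : 0 < s' by exact: lt_trans ss'.
have [iG _] := bessel_kernelP n s'_gt0 s'_lt1.
have G_gt0 := L1norm_bessel_kernel_gt0 n s'_gt0 s'_lt1.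
split.
  have [K K_gt0 holderG] := bessel_kernel_holder n s'_gt0 s'_lt1.
  have d_gt0 : 0 < s' - s by rewrite subr_gt0.
  pose L := @embedding_constant R n s s' (bessel_kernel s') K.
  have L_gt0 : 0 < L by exact: embedding_constant_gt0.
  exists (2 * L * (s' - s)); first by apply: mulr_gt0 => //; exact: mulr_gt0.
  move=> u [u_orlicz fGu]; rewrite mulfK ?gt_eqF//.
  exact: frac_sobolev_norm_le.
move=> u f c [[meas_u _] _] [mf _] fGu c_gt0 holderG; cbv zeta.
have K_gt0 : 0 < c / (1 - s') by rewrite divr_gt0// subr_gt0.
rewrite addeC -frac_modularE//; apply: leeD.
  exact: (frac_modular_le n_gt0 YA s_gt0 ss' s'_lt1 iG G_gt0 mf meas_u fGu K_gt0 holderG).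
exact: (modular_le YA iG G_gt0 mf meas_u fGu).
Qed.
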